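(* Let $N\ge 1$, let $W=\begin{pmatrix}0&I_N\\ I_N&0\end{pmatrix}$, and let $A\in G\mathcal{B}^{2N\times 2N}$. (a) Assume that an antisymmetric factorization of the function $F(t)=A(t)W\widetilde{A}^{-1}(t)$ is given by $F(t)=A_-(t)D(t)\widetilde{A}_-^{-1}(t)$, where $A_-\in G\mathcal{B}_-^{2N\times 2N}$ and $D(t)=\mathrm{diag}(\varrho_1t^{\kappa_1},\dots,\varrho_{2N}t^{\kappa_{2N}})$ with characteristic pairs $(\varrho_1,\kappa_1),\dots,(\varrho_{2N},\kappa_{2N})\in\{-1,1\}\times\mathbb{Z}$. Then $$\dim\ker\Phi(A)=-\sum_{\kappa_k<0}\Theta(\varrho_k,\kappa_k),\qquad \dim\ker\Phi(A)^*=\sum_{\kappa_k>0}\Theta(\varrho_k,\kappa_k).$$ Moreover, a pseudoinverse of $\Phi(A)$ is given by $$\Psi(A^{-1}A_-)\bigl(I-\tfrac12\mathcal{H}(DW)\bigr)\mathcal{T}(A_-^{-1}).$$ (b) Assume that an antisymmetric factorization of the function $G(t)=\widetilde{A}^{-1}(t)WA(t)$ is given by $G(t)=\widetilde{A}_+^{-1}(t)D(t)A_+(t)$, where $A_+\in G\mathcal{B}_+^{2N\times 2N}$ and $D(t)=\mathrm{diag}(\varrho_1t^{\kappa_1},\dots,\varrho_{2N}t^{\kappa_{2N}})$ with characteristic pairs $(\varrho_1,\kappa_1),\dots,(\varrho_{2N},\kappa_{2N})\in\{-1,1\}\times\mathbb{Z}$. Then $$\dim\ker\Psi(A)=-\sum_{\kappa_k<0}\Theta(-\varrho_k,\kappa_k),\qquad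 \dim\ker\Psi(A)^*=\sum_{\kappa_k>0}\Theta(-\varrho_k,\kappa_k).$$ Moreover, a pseudoinverse of $\Psi(A)$ is given by $$\mathcal{T}(A_+^{-1})\bigl(I-\tfrac12\mathcal{H}(D^{-1}W)\bigr)\Phi(A_+A^{-1}).$$
   Context: $\mathbb{T}$ is the unit circle in $\mathbb{C}$, $L^2=L^2(\mathbb{T})$; $f_n$ denotes the $n$-th Fourier coefficient of $f$. $H^2=\{f\in L^2: f_n=0 \text{ for } n<0\}$, $\overline{H^2}=\{f\in L^2: f_n=0\text{ for }n>0\}$, $H^\infty=L^\infty(\mathbb{T})\cap H^2$, $\overline{H^\infty}=L^\infty(\mathbb{T})\cap\overline{H^2}$. $GB$ denotes the group of invertible elements of a Banach algebra $B$. For a function $A$ on $\mathbb{T}$, $\widetilde{A}(t)=A(1/t)$ and $\widetilde{A}^{-1}(t)=(A(1/t))^{-1}$. $^*$ is the Hilbert space adjoint. On vector-valued $L^2$ spaces (any number of components): $M(A)$ is multiplication by the matrix function $A$; $P:\sum_{n\in\mathbb{Z}}f_nt^n\mapsto\sum_{n\ge0}f_nt^n$; $Q=I-P$; $(Jf)(t)=t^{-1}f(1/t)$. For $A\in L^\infty(\mathbb{T})^{2N\times2N}$ define the following operators on $(L^2)^N$, where rows act $(L^2)^{2N}\to(L^2)^N$ and columns act $(L^2)^N\to(L^2)^{2N}$: $$\mathcal{T}(A)=(P,\,JP)M(A)\begin{pmatrix}P\\ PJ\end{pmatrix},\quad \mathcal{H}(A)=(P,\,JP)M(A)\begin{pmatrix}Q\\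 QJ\end{pmatrix},$$ $$\Phi(A)=(P,\,JP)M(A)\begin{pmatrix}I\\ J\end{pmatrix},\quad \Psi(A)=(I,\,J)M(A)\begin{pmatrix}P\\ PJ\end{pmatrix}.$$ If $A=\begin{pmatrix}a&b\\ c&d\end{pmatrix}$ with $N\times N$ blocks, then $\Phi(A)=PM(a)+PJM(\widetilde b)+QJM(c)+QM(\widetilde d)$ and $\Psi(A)=M(a)P+M(b)JQ+M(\widetilde c)JP+M(\widetilde d)Q$ (singular integral operators with flip). Standing assumptions on $\mathcal{B}$: $\mathcal{B}$ is a Banach algebra of functions on $\mathbb{T}$ (for example the Wiener algebra or the Hölder algebras $C^\alpha$, $0<\alpha<1$) such that: (a) $\mathcal{B}$ is an inverse closed Banach subalgebra of $C(\mathbb{T})$ (i.e. $b\in\mathcal{B}$ invertible in $C(\mathbb{T})$ implies $b^{-1}\in\mathcal{B}$); (b) $\mathcal{B}$ contains all trigonometric polynomials; (c) $a\in\mathcal{B}$ implies $\widetilde a\in\mathcal{B}$; (d) for each $n$, each $A\in G\mathcal{B}^{n\times n}$ can be written as $A=A_-\Lambda A_+$ with $\Lambda(t)=\mathrm{diag}(t^{\kappa_1},\dots,t^{\kappa_n})$, $\kappa_j\in\mathbb{Z}$, $A_\pm\in G\mathcal{B}_\pm^{n\times n}$, where $\mathcal{B}_+=\mathcal{B}\cap H^\infty$ and $\mathcal{B}_-=\mathcal{B}\cap\overline{H^\infty}$. An antisymmetric factorization of $F\in G\mathcal{B}^{n\times n}$ (within $\mathcal{B}$) is a representation $F(t)=F_-(t)D(t)\widetilde{F}_-^{-1}(t)$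 with $F_-\in G\mathcal{B}_-^{n\times n}$ and $D(t)=\mathrm{diag}(\varrho_1t^{\kappa_1},\dots,\varrho_nt^{\kappa_n})$, $\varrho_k\in\{-1,1\}$, $\kappa_k\in\mathbb{Z}$; equivalently (with $F_+=\widetilde{F}_-^{-1}$), $F=\widetilde{F}_+^{-1}DF_+$ with $F_+\in G\mathcal{B}_+^{n\times n}$. The pairs $(\varrho_k,\kappa_k)$ are its characteristic pairs. $\Theta:\{-1,1\}\times\mathbb{Z}\to\mathbb{Z}$ is defined by $\Theta(\varrho,\kappa)=\kappa/2$ if $\kappa$ is even and $\Theta(\varrho,\kappa)=(\kappa-\varrho)/2$ if $\kappa$ is odd. A pseudoinverse of a bounded operator $X$ is a bounded operator $X^\dagger$ with $XX^\dagger X=X$ and $X^\dagger XX^\dagger=X^\dagger$. *)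

(* Defs.v *)
From HB Require Import structures.
From mathcomp Require Import all_boot all_order all_algebra.
From mathcomp Require Import generic_quotient ring_quotient.
From mathcomp Require Import all_classical all_reals all_analysis.
From mathcomp Require Import complex.

Set Implicit Arguments.
Unset Strict Implicit.
Unset Printing Implicit Defensive.

Import Order.TTheory GRing.Theory Num.Theory.
Import numFieldTopology.Exports numFieldNormedType.Exports.
Import ComplexField.

Local Open Scope classical_set_scope.
Local Open Scope ring_scope.
Local Open Scope complex_scope.

(* The topology on [R[i]] is carried by the alias [R[i]^o]; as a type,
   [circle R] has the induced (subspace) topology. *)
Definition circle (R : realType) : set R[i]^o := [set z | `|z| = 1].
Arguments circle : clear implicits.

Section Circle.
Variable R : realType.
Local Notation C := R[i].
Local Notation T := (circle R).

Definition ptval (t : T) : C := set_val t.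

Lemma cis_subproof (x : R) :
  (cos (2 * pi * x) +i* sin (2 * pi * x)) \in T.
Proof. by rewrite inE /circle /= normc_def cos2Dsin2 sqrtr1. Qed.

Definition cis (x : R) : T := SigSub (cis_subproof x).

Lemma inv_subproof (t : T) : (ptval t)^-1 \in T.
Proof.
have /set_mem /= t1 := valP t.
by rewrite inE /circle /= normfV t1 invr1.
Qed.

Definition ptinv (t : T) : T := SigSub (inv_subproof t).

(* The normalised arc length on the circle is the image under [cis] of the
   Lebesgue measure on [0, 1]; measurability, integrability, "almost
   everywhere" and integrals on the circle are taken through [cis]. *)
Definition mu01 : {measure set (measurableTypeR R) -> \bar R} :=
  mrestr (@lebesgue_measure R) (@measurable_itv R `[0, 1]).

Definition cint (f : T -> C) : C :=
  Rintegral mu01 setT (fun x => complex.Re (f (cis x)))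
  +i* Rintegral mu01 setT (fun x => complex.Im (f (cis x))).

Definition Lp (p : \bar R) : {pred (T -> C)} := fun f =>
  ((fun x => complex.Re (f (cis x))) \in Lfun mu01 p) &&
  ((fun x => complex.Im (f (cis x))) \in Lfun mu01 p).

Definition fourier (f : T -> C) (n : int) : C :=
  cint (fun t => f t * ptval t ^ (- n)).

Definition H2 (f : T -> C) : Prop :=
  f \in Lp 2%:E /\ forall n : int, n < 0 -> fourier f n = 0.
Definition H2bar (f : T -> C) : Prop :=
  f \in Lp 2%:E /\ forall n : int, 0 < n -> fourier f n = 0.
Definition Hoo (f : T -> C) : Prop := f \in Lp +oo%E /\ H2 f.
Definition Hoobar (f : T -> C) : Prop := f \in Lp +oo%E /\ H2bar f.

End Circle.

Section L2.
Variable R : realType.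
Local Notation C := R[i].
Local Notation T := (circle R).

Lemma L2_submod_closed : submod_closed (Lp 2%:E : {pred (T -> C)}).
Proof.
have [L0 LP] := @Lfun_submod_closed _ _ _ (mu01 R) 2%:E (lee1n 2).
split.
  by rewrite unfold_in; apply/andP; split; exact: L0.
move=> a f g; rewrite !unfold_in => /andP[fr fi] /andP[gr gi].
case: a => a b; apply/andP; split.
  rewrite (_ : (fun x => _) = a *: (fun x => complex.Re (f (cis x))) +
     (- b *: (fun x => complex.Im (f (cis x))) +
      (fun x => complex.Re (g (cis x))))).
    by apply: (LP) => //; apply: (LP).
  apply/funext => x /=; rewrite /GRing.scale/= /GRing.add/=.
  rewrite /GRing.scale/=/GRing.add/=.
  case: (f (cis x)) (g (cis x)) => [u v] [u' v'] /=.
  by rewrite mulNr -addrA.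
rewrite (_ : (fun x => _) = a *: (fun x => complex.Im (f (cis x))) +
     (b *: (fun x => complex.Re (f (cis x))) + (fun x => complex.Im (g (cis x))))).
  by apply: (LP) => //; apply: (LP).
apply/funext => x /=; rewrite /GRing.scale/= /GRing.add/=.
rewrite /GRing.scale/=/GRing.add/=.
case: (f (cis x)) (g (cis x)) => [u v] [u' v'] /=.
by rewrite -addrA.
Qed.

HB.instance Definition _ :=
  GRing.isSubmodClosed.Build C (T -> C) (Lp 2%:E) L2_submod_closed.

Record L2fun := MkL2fun { L2val :> T -> C; _ : L2val \in Lp 2%:E }.
HB.instance Definition _ := [isSub for L2val].
HB.instance Definition _ := [Choice of L2fun by <:].
HB.instance Definition _ := [SubChoice_isSubLmodule of L2fun by <:].

Definition L2null : {pred L2fun} :=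
  fun f => `[< {ae mu01 R, forall x, f (cis x) = 0} >].

Lemma L2null_submod_closed : submod_closed L2null.
Proof.
split.
  by rewrite unfold_in; apply/asboolP; apply: aeW.
move=> a f g; rewrite !unfold_in => /asboolP f0 /asboolP g0; apply/asboolP.
have aeF : Filter (almost_everywhere (mu01 R)).
  exact: (@ae_filter_ringOfSetsType _ _ _ (mu01 R)).
apply: filterS2 f0 g0 => x fx gx.
rewrite (_ : L2val _ = a *: L2val f + L2val g)//.
by rewrite [LHS](_ : _ = a * f (cis x) + g (cis x))// fx gx mulr0 addr0.
Qed.

HB.instance Definition _ :=
  GRing.isSubmodClosed.Build C L2fun L2null L2null_submod_closed.

Definition L2 : Type := Quotient.quot L2null.
HB.instance Definition _ := GRing.Zmodule.on L2.
HB.instance Definition _ := EqQuotient.on L2.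

Local Open Scope quotient_scope.

Definition L2repr (f : L2) : T -> C := repr f.

(* The class of a function, 0 when the function is not square integrable. *)
Definition L2class (f : T -> C) : L2 := \pi_L2 (insubd (0 : L2fun) f).

Definition L2scale (a : C) (f : L2) : L2 := \pi_L2 (a *: (repr f : L2fun)).

Lemma L2scale_pi a (f : L2fun) : L2scale a (\pi_L2 f) = \pi_L2 (a *: f).
Proof.
apply/eqP; rewrite /L2scale -Quotient.idealrBE -scalerBr.
apply: rpredZ; rewrite Quotient.idealrBE; apply/eqP.
exact: reprK.
Qed.

Lemma L2piD (f g : L2fun) : \pi_L2 (f + g) = \pi_L2 f + \pi_L2 g.
Proof. exact: Quotient.pi_add. Qed.

Lemma L2piP (f : L2) : exists g : L2fun, f = \pi_L2 g.
Proof. by exists (repr f); rewrite reprK. Qed.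

Fact L2scaleA a b (f : L2) : L2scale a (L2scale b f) = L2scale (a * b) f.
Proof. by have [g ->] := L2piP f; rewrite !L2scale_pi scalerA. Qed.
Fact L2scale1 : left_id 1 L2scale.
Proof. by move=> f; have [g ->] := L2piP f; rewrite L2scale_pi scale1r. Qed.
Fact L2scaleDr : right_distributive L2scale +%R.
Proof.
move=> a f g; have [f' ->] := L2piP f; have [g' ->] := L2piP g.
by rewrite -L2piD !L2scale_pi scalerDr L2piD.
Qed.
Fact L2scaleDl (f : L2) : {morph L2scale^~ f : a b / a + b}.
Proof.
by move=> a b; have [g ->] := L2piP f; rewrite !L2scale_pi scalerDl L2piD.
Qed.

HB.instance Definition _ := GRing.Zmodule_isLmodule.Build C L2
  L2scaleA L2scale1 L2scaleDr L2scaleDl.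

End L2.

Section Operators.
Variable R : realType.
Local Notation C := R[i].
Local Notation T := (circle R).

Definition L2v (n : nat) := {ffun 'I_n -> L2 R}.

Definition inner (f g : L2 R) : C :=
  cint (fun t => L2repr f t * (L2repr g t)^* ).
Definition vinner n (f g : L2v n) : C := \sum_i inner (f i) (g i).
Definition vnorm n (f : L2v n) : R := Num.sqrt (complex.Re (vinner f f)).

Definition bounded_op m n (X : L2v m -> L2v n) : Prop :=
  linear X /\ exists M : R, forall f, vnorm (X f) <= M * vnorm f.

(* The Hilbert space adjoint, selected by its defining property; it exists and
   is unique for every bounded [X]. *)
Definition adjoint m n (X : L2v m -> L2v n) : L2v n -> L2v m :=
  xget (fun=> 0)
    [set Y | bounded_op Y /\ forall f g, vinner (X f) g = vinner f (Y g)].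

Definition pseudoinverse m n (X : L2v m -> L2v n) (Y : L2v n -> L2v m) : Prop :=
  [/\ bounded_op X, bounded_op Y,
      forall f, X (Y (X f)) = X f & forall f, Y (X (Y f)) = Y f].

Definition ker (V W : lmodType C) (X : V -> W) : set V := [set f | X f = 0].

(* The subspace [K] has the finite dimension [d]: it has a basis with [d]
   elements.  An integer [d] is allowed so that signed sums can be used. *)
Definition has_dim (V : lmodType C) (K : set V) (d : int) : Prop :=
  exists (n : nat) (e : 'I_n -> V),
    [/\ d = n%:Z, forall i, K (e i),
        forall c : 'I_n -> C, \sum_i c i *: e i = 0 -> forall i, c i = 0 &
        forall v, K v -> exists c : 'I_n -> C, v = \sum_i c i *: e i].

(* P, characterised by its action on Fourier coefficients: [xget] selects the
   only class in L^2 whose coefficients are those of [f] for n >= 0 and vanish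
   for n < 0. *)
Definition projP1 (f : L2 R) : L2 R :=
  xget 0 [set g | forall n : int, fourier (L2repr g) n =
                    if 0 <= n then fourier (L2repr f) n else 0].
Definition flipJ1 (f : L2 R) : L2 R :=
  L2class (fun t => (ptval t)^-1 * L2repr f (ptinv t)).

Definition projP n (f : L2v n) : L2v n := [ffun i => projP1 (f i)].
Definition projQ n (f : L2v n) : L2v n := f - projP f.
Definition flipJ n (f : L2v n) : L2v n := [ffun i => flipJ1 (f i)].

Definition mulM n (A : T -> 'M[C]_n) (f : L2v n) : L2v n :=
  [ffun i => \sum_j L2class (fun t => A t i j * L2repr (f j) t)].

(* The row (X, Y) and the column (X ; Y) of operators on (L^2)^N. *)
Definition rowop N (X Y : L2v N -> L2v N) (f : L2v (N + N)) : L2v N :=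
  X [ffun i => f (lshift N i)] + Y [ffun i => f (rshift N i)].
Definition colop N (X Y : L2v N -> L2v N) (f : L2v N) : L2v (N + N) :=
  [ffun k : 'I_(N + N) =>
     match fintype.split k with inl i => X f i | inr i => Y f i end].

Definition opT N (A : T -> 'M[C]_(N + N)) : L2v N -> L2v N :=
  rowop (@projP N) (@flipJ N \o @projP N) \o mulM A
    \o colop (@projP N) (@projP N \o @flipJ N).
Definition opH N (A : T -> 'M[C]_(N + N)) : L2v N -> L2v N :=
  rowop (@projP N) (@flipJ N \o @projP N) \o mulM A
    \o colop (@projQ N) (@projQ N \o @flipJ N).
Definition Phi N (A : T -> 'M[C]_(N + N)) : L2v N -> L2v N :=
  rowop (@projP N) (@flipJ N \o @projP N) \o mulM A \o colop id (@flipJ N).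
Definition Psi N (A : T -> 'M[C]_(N + N)) : L2v N -> L2v N :=
  rowop id (@flipJ N) \o mulM A \o colop (@projP N) (@projP N \o @flipJ N).

Definition id_minus_half n (X : L2v n -> L2v n) (f : L2v n) : L2v n :=
  f - (2^-1 : C) *: X f.

End Operators.

Section Factorization.
Variable R : realType.
Local Notation C := R[i].
Local Notation T := (circle R).

(* [nB] is the norm of the Banach algebra with carrier [B]; its values outside
   [B] are irrelevant. *)
Record banach_function_algebra (B : set (T -> C)) (nB : (T -> C) -> R) : Prop := {
  bfa_add : forall a b, B a -> B b -> B (a \+ b);
  bfa_mul : forall a b, B a -> B b -> B (a \* b);
  bfa_scale : forall (k : C) a, B a -> B (fun t => k * a t);
  bfa_norm_ge0 : forall a, B a -> 0 <= nB a;
  bfa_norm_eq0 : forall a, B a -> nB a = 0 -> forall t, a t = 0;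
  bfa_normD : forall a b, B a -> B b -> nB (a \+ b) <= nB a + nB b;
  bfa_normZ : forall (k : C) a, B a -> nB (fun t => k * a t) = Normc.normc k * nB a;
  bfa_normM : forall a b, B a -> B b -> nB (a \* b) <= nB a * nB b;
  bfa_complete : forall u : nat -> (T -> C), (forall n, B (u n)) ->
    (forall eps : R, 0 < eps -> exists n0, forall m n, (n0 <= m)%N -> (n0 <= n)%N ->
       nB (u m \- u n) < eps) ->
    exists2 b, B b & (fun n => nB (u n \- b)) @ \oo --> (0 : R)
}.

Definition Bplus (B : set (T -> C)) : set (T -> C) := [set b | B b /\ Hoo b].
Definition Bminus (B : set (T -> C)) : set (T -> C) := [set b | B b /\ Hoobar b].

(* Invertibility is meant in the algebra of matrix functions with entries in
   [S]: the inverse must also have its entries in [S]. *)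
Definition GLmx (S : set (T -> C)) n (A : T -> 'M[C]_n) : Prop :=
  (forall i j, S (fun t => A t i j)) /\
  exists2 A' : T -> 'M[C]_n, (forall i j, S (fun t => A' t i j)) &
    forall t, A t *m A' t = 1%:M /\ A' t *m A t = 1%:M.

Definition diagt n (rho kappa : 'I_n -> int) (t : T) : 'M[C]_n :=
  diag_mx (\row_k ((rho k)%:~R * ptval t ^ kappa k)).

Record standing_assumptions (B : set (T -> C)) (nB : (T -> C) -> R) : Prop := {
  sa_banach : banach_function_algebra B nB;
  sa_continuous : forall b, B b -> continuous (b : T -> C^o);
  sa_inverse_closed : forall b c, B b -> continuous (c : T -> C^o) ->
    (forall t, b t * c t = 1) -> B c;
  sa_trig_poly : forall s : seq (C * int),
    B (fun t => \sum_(m <- s) m.1 * ptval t ^ m.2);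
  sa_flip : forall a, B a -> B (fun t => a (ptinv t));
  sa_factorization : forall n (A : T -> 'M[C]_n), GLmx B A ->
    exists (kappa : 'I_n -> int) (Am Ap : T -> 'M[C]_n),
      [/\ GLmx (Bminus B) Am, GLmx (Bplus B) Ap &
          forall t, A t = Am t *m diagt (fun=> 1) kappa t *m Ap t]
}.

Definition tilde n (A : T -> 'M[C]_n) (t : T) : 'M[C]_n := A (ptinv t).

Definition minv n (A : T -> 'M[C]_n) (t : T) : 'M[C]_n := invmx (A t).

Definition antisym_fact_minus (B : set (T -> C)) n (F Fm : T -> 'M[C]_n)
    (rho kappa : 'I_n -> int) : Prop :=
  [/\ GLmx (Bminus B) Fm, forall k, rho k = 1 \/ rho k = -1 &
      forall t, F t = Fm t *m diagt rho kappa t *m minv (tilde Fm) t].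

Definition antisym_fact_plus (B : set (T -> C)) n (F Fp : T -> 'M[C]_n)
    (rho kappa : 'I_n -> int) : Prop :=
  [/\ GLmx (Bplus B) Fp, forall k, rho k = 1 \/ rho k = -1 &
      forall t, F t = minv (tilde Fp) t *m diagt rho kappa t *m Fp t].

Definition Theta (rho kappa : int) : int :=
  if (2 %| kappa)%Z then (kappa %/ 2)%Z else ((kappa - rho) %/ 2)%Z.

Definition Wmx N : 'M[C]_(N + N) := block_mx 0 1%:M 1%:M 0.

End Factorization.
Arguments Wmx R N : clear implicits.

(* Main.v *)
(* Write V f = (f, J f) and V* = (I, J), so that Phi(A) = V* P M(A) V and
   Psi(A) = V* M(A) P V, with V* P V = I, V* V = 2I and V V* = I + J W.
   Multiplication by a factor that is anti-analytic together with its inverse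
   splits off on the left of Phi(A) as the invertible operator T(A_-); in the
   same way T(A_+) splits off on the right of Psi(A).  What remains is Phi(B) or
   Psi(B^-1) with B W B~^-1 = D diagonal.  The relation between B, W and D says
   that M(B) V maps onto the fixed space of D J; hence ker Phi(B) is the kernel
   of P on that fixed space and ker Psi(B^-1) is the range of P intersected with
   the space where D J = -1.  Both split into scalar problems on Fourier
   coefficients, which Theta counts.  Also Phi(B) Psi(B^-1) = I + H, where H = H(DW)
   acts through K = P D J P, and K^2 = K on the relevant vectors because
   P D Q D^-1 Q = 0 and Q D Q D^-1 P = 0 for diagonal D.  The adjoint of Phi(A) is
   Psi(A^* ), so the dimension of the cokernel follows from the other half.
   The L^2 facts behind this (P exists and a class is determined by its Fourier
   coefficients) use completeness of L^2 and the totality of the exponentials. *)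

From mathcomp Require Import all_boot all_order all_algebra.
From mathcomp Require Import all_classical all_reals all_analysis measurable_realfun.
From mathcomp Require Import complex.
From mathcomp Require Import ring lra zify.
Require Import Defs.

Set Implicit Arguments.
Unset Strict Implicit.
Unset Printing Implicit Defensive.

Import Order.TTheory GRing.Theory Num.Theory.
Import numFieldTopology.Exports numFieldNormedType.Exports.
Import ComplexField.

Local Open Scope classical_set_scope.
Local Open Scope ring_scope.
Local Open Scope complex_scope.
Local Notation Re := complex.Re.
Local Notation Im := complex.Im.

(** * Reflection of the circle and determination by rays *)

(** The factor 1/2 in the pseudoinverse comes from [(I + H)(I - H/2) = I + (H - H^2)/2]. H is not
    shown to be idempotent; what holds is [H^2 = H] on the range of Phi(B), and
    [Psi(B^-1) H^2 = Psi(B^-1) H] everywhere. These two facts give the two equations of a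
    pseudoinverse. The parity case in [Theta] has this origin: coefficient n of D J v is rho times
    coefficient kappa - 1 - n of v. For kappa < 0 a fixed vector without coefficients at n >= 0
    therefore lives on the window kappa <= n <= -1 and is symmetric up to rho. An odd window has a
    centre, and rho decides whether the coefficient there is free or zero. In (b) the choice B = A_+
    A^-1 leads to D^-1 instead of D: kappa changes sign, rho does not, and [Theta rho (-kappa) = -
    Theta (-rho) kappa] produces the sign in front of rho. Functions on the circle are seen only
    through [cis], which has period 1, so every limit built on the parameter line has to be shown to
    descend to the circle. *)

Section Reflection.
Variable R : realType.
Local Notation mu01 := (mu01 R).

Lemma mu01E (A : set (measurableTypeR R)) : mu01 A = lebesgue_measure (A `&` `[0, 1]).
Proof. by []. Qed.

Lemma mu01T : mu01 setT = 1%:E.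
Proof. by rewrite mu01E setTI lebesgue_measure_itv /= lte01 oppr0 adde0. Qed.

Lemma mu01C : mu01 (~` `[0, 1]) = 0%E.
Proof. by rewrite mu01E setICl measure0. Qed.

Lemma ae_mu01 (P : R -> Prop) : (forall x, 0 <= x <= 1 -> P x) ->
  {ae mu01, forall x, P x}.
Proof.
move=> h; exists (~` `[0, 1]); split.
- exact: measurableC.
- exact: mu01C.
- by move=> x /= nP; rewrite in_itv /= => x01; apply: nP; exact: h.
Qed.

Definition refl01 (x : measurableTypeR R) : measurableTypeR R := 1 - x.

Lemma measurable_refl01 : measurable_fun setT refl01.
Proof. by apply: (@measurable_funB _ _ _ setT (cst 1) id). Qed.

(** By uniqueness of Lebesgue measure only half-open intervals matter; their preimages are open at
    the other end, which does not change the length. *)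
Lemma lebesgue_measure_refl01 (A : set (measurableTypeR R)) : measurable A ->
  lebesgue_measure (refl01 @^-1` A) = lebesgue_measure A.
Proof.
move=> mA; rewrite -/(pushforward lebesgue_measure refl01 A).
apply/esym/lebesgue_measure_unique => //=; first exact: measurable_refl01.
move=> _ _ [[a b]] _ <-.
rewrite /pushforward /=.
rewrite (_ : _ @^-1` _ = `[1 - b, 1 - a[%classic); last first.
  by apply/seteqP; split => x /=; rewrite /refl01 !in_itv/=; lra.
rewrite !lebesgue_measure_itv/= !lte_fin ltrD2l ltrN2.
by case: ifP => // _; rewrite -!EFinD; congr (_%:E); ring.
Qed.

Lemma mu01_refl01 (A : set (measurableTypeR R)) : measurable A ->
  mu01 (refl01 @^-1` A) = mu01 A.
Proof.
move=> mA; rewrite !mu01E -[RHS]lebesgue_measure_refl01; last exact: measurableI.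
congr (lebesgue_measure _).
by apply/seteqP; split => x /=; rewrite /refl01 !in_itv/= => -[? ?]; split=> //; lra.
Qed.

Lemma ae_refl01 (P : R -> Prop) : {ae mu01, forall x, P x} ->
  {ae mu01, forall x, P (1 - x)}.
Proof.
move=> [N [mN N0 PN]]; exists (refl01 @^-1` N); split.
- by rewrite -[X in measurable X]setTI; exact: measurable_refl01.
- by rewrite mu01_refl01.
- by move=> x /= nP; exact: PN.
Qed.

Lemma ge0_integral_refl01 (f : R -> \bar R) :
  measurable_fun setT f -> (forall x, 0 <= f x)%E ->
  (\int[mu01]_x f (1 - x)%R = \int[mu01]_x f x)%E.
Proof.
move=> mf f0.
have := @ge0_integral_pushforward _ _ _ _ _ _ measurable_refl01 mu01 setT f
  measurableT mf (in1W f0).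
rewrite preimage_setT => <-; apply: eq_measure_integral; first exact: measurable_refl01.
by move=> ? A mA _; exact: mu01_refl01.
Qed.

Lemma integral_refl01 (f : R -> \bar R) :
  measurable_fun setT f ->
  (\int[mu01]_x f (1 - x)%R = \int[mu01]_x f x)%E.
Proof.
move=> mf; rewrite integralE [RHS]integralE; congr (_ - _)%E.
  rewrite -[RHS](ge0_integral_refl01 (f := f^\+%E))//.
    by apply: eq_integral => x _; exact: (congr1 (@^~ x) (funepos_comp f refl01)).
  exact: (@measurable_funepos _ (measurableTypeR R) R setT f mf).
rewrite -[RHS](ge0_integral_refl01 (f := f^\-%E))//.
  by apply: eq_integral => x _; exact: (congr1 (@^~ x) (funeneg_comp f refl01)).
exact: (@measurable_funeneg _ (measurableTypeR R) R setT f mf).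
Qed.

End Reflection.

Section Rays.
Variable R : realType.
Local Notation mu01 := (mu01 R).

(* The rays form a pi-system generating the Borel sets, so the positive and the
   negative part of f have the same integral over every Borel set. *)
Lemma ae_eq0_of_rays (f : R -> R) :
  mu01.-integrable setT (EFin \o f) ->
  (\int[mu01]_x (f x)%:E = 0)%E ->
  (forall a, \int[mu01]_(x in `]a, +oo[) (f x)%:E = 0)%E ->
  {ae mu01, forall x, f x = 0}.
Proof.
move=> fi fT fr.
have H (S : set R) : measurable S -> (\int[mu01]_(x in S) (f x)%:E = 0)%E.
  move=> mS0; have mS : <<s @RGenOInfty.G R >> S.
    by rewrite -[<<s _ >>]RGenOInfty.measurableE.
  pose PP (S : set (measurableTypeR R)) := (\int[mu01]_(x in S) (f x)%:E = 0)%E.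
  have dy := @dynkin_induction _ (measurableTypeR R) (@RGenOInfty.G R) PP.
  apply: (dy _ _ _ _ _ _ S mS).
  - exact: RGenOInfty.measurableE.
  - move=> _ _ [a ->] [b ->]; exists (Num.max a b).
    by apply/seteqP; split => x /=; rewrite !in_itv/= !andbT gt_max;
      [move=> [-> ->]|move=> /andP[]].
  - exact: fT.
  - by move=> _ [a ->]; exact: fr.
  (* Complements: here the vanishing of the integral over the whole space enters. *)
  - rewrite /PP => A mA fA.
    have := fT; rewrite -(setUv A) integral_setU//; last 3 first.
    + exact: measurableC.
    + by rewrite setUv; exact: measurable_int fi.
    + by apply/disj_setPS => x [].
    + by rewrite fA add0e.
  - rewrite /PP => F mF tF F0; rewrite integral_bigcup//.
      by rewrite eseries0//.
    by apply: integrableS fi => //; exact: bigcup_measurable.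
have := @integral_ae_eq _ _ _ mu01 setT measurableT (cst 0%E) (EFin \o f) fi.
move=> /(_ (measurable_cst _)) h.
apply: filterS (h _); first by move=> x /(_ I) [].
by move=> E _ mE; rewrite integral0 H.
Qed.

End Rays.

(** * Completeness of L^2 *)

Section Complete.
Context d (X : measurableType d) (R : realType).
Variable mu : {measure set X -> \bar R}.
Hypothesis muT : (mu setT < +oo)%E.

Lemma Lfun2P (f : X -> R) :
  f \in Lfun mu 2%:E <-> measurable_fun setT f /\ (\int[mu]_x (f x ^+ 2)%:E < +oo)%E.
Proof.
split=> [f2|[mf fi]].
  split; first by have /set_mem := sub_Lfun_mfun f2.
  have /integrableP[_] := Lfun2_integrable_sqr f2.
  by under eq_integral do rewrite /= ger0_norm ?sqr_ge0//.
rewrite inE; apply/andP; split; rewrite inE//= /finite_norm unlock /Lnorm.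
rewrite poweR_lty//.
apply: le_lt_trans fi; rewrite le_eqVlt; apply/orP; left; apply/eqP.
by apply: eq_integral => x _; rewrite /= powR_mulrn// real_normK// num_real.
Qed.

(** Plays the part of Cauchy-Schwarz on a space of finite measure c: with [p = 2^k], an increment
    whose square has integral at most [4^-k] has L^1 norm at most [(1 + c) 2^-k], which is
    summable. *)
Lemma normr_le_sqr (h p : R) : 0 < p -> `|h| <= p * h ^+ 2 + p^-1.
Proof.
move=> p0; rewrite -(real_normK (num_real h)).
have : 0 <= `|h| by [].
move: `|h| => k k0; rewrite -(ler_pM2l p0) mulrDr divff ?gt_eqF//.
nra.
Qed.

Lemma series_half_lt (c : R) n : 0 <= c -> \sum_(0 <= k < n) c / 2 ^+ k <= 2 * c.
Proof.
move=> c0; suff -> : \sum_(0 <= k < n) c / 2 ^+ k = 2 * c - 2 * c / 2 ^+ n.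
  by rewrite gerBl divr_ge0// mulr_ge0.
elim: n => [|n IH]; first by rewrite big_geq// expr0 divr1 subrr.
rewrite big_nat_recr//= IH exprS; field; exact: expf_neq0.
Qed.

(** Riesz-Fischer: along a fast subsequence the absolute increments have an integrable sum, so the
    subsequence converges almost everywhere, and Fatou turns this into L^2 convergence. The middle
    conclusion holds because the limit at a point is computed from the values [u n] there alone; it
    is what lets the limit descend to the circle. *)
Lemma Lfun2_complete (u : nat -> X -> R) :
  (forall n, u n \in Lfun mu 2%:E) ->
  (forall e : R, 0 < e -> exists N, forall m n, (N <= m)%N -> (N <= n)%N ->
     (\int[mu]_x ((u m x - u n x) ^+ 2)%:E <= e%:E)%E) ->
  exists v, [/\ v \in Lfun mu 2%:E,
    forall x y, (forall n, u n x = u n y) -> v x = v y &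
    forall e : R, 0 < e -> exists N, forall n,
     (N <= n)%N -> (\int[mu]_x ((u n x - v x) ^+ 2)%:E <= e%:E)%E].
Proof.
move=> u2 uC.
have mu_ n : measurable_fun setT (u n) by have /Lfun2P[] := u2 n.
have [N_ NP] : {N_ : nat -> nat & forall k m n, (N_ k <= m)%N -> (N_ k <= n)%N ->
    (\int[mu]_x ((u m x - u n x) ^+ 2)%:E <= (4 ^- k)%:E)%E}.
  apply: (@choice _ _ (fun k N => forall m n, (N <= m)%N -> (N <= n)%N ->
    (\int[mu]_x ((u m x - u n x) ^+ 2)%:E <= (4 ^- k)%:E)%E)) => k.
  by apply: uC; rewrite invr_gt0 exprn_gt0.
(* Adding k and all earlier thresholds gives a monotone sequence beyond both k and [N_ k], with no
   recursive choice. *)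
pose phi k := (k + \sum_(i < k.+1) N_ i)%N.
have phi_ge k : (k <= phi k)%N by exact: leq_addr.
have phi_N k : (N_ k <= phi k)%N.
  by rewrite /phi big_ord_recr /= !addnA leq_addl.
have phi_S k : (phi k <= phi k.+1)%N.
  by rewrite /phi [in leqRHS]big_ord_recr /= addnA (leq_trans _ (leq_addr _ _))// leq_add2r.
pose w k := u (phi k).
pose g k x : R := `|w k.+1 x - w k x|.
have mg k : measurable_fun setT (g k).
  exact: (measurableT_comp (@normr_measurable R setT)
    (measurable_funB (mu_ (phi k.+1)) (mu_ (phi k)))).
have [c c0 muc] : exists2 c : R, 0 <= c & mu setT = c%:E.
  exists (fine (mu setT)); first exact: fine_ge0.
  by rewrite fineK// ge0_fin_numE.
have gle k : (\int[mu]_x (g k x)%:E <= ((1 + c) / 2 ^+ k)%:E)%E.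
  have k0 : 0 < (2 : R) ^+ k by exact: exprn_gt0.
  have mq : measurable_fun setT (fun x => ((w k.+1 x - w k x) ^+ 2)%:E).
    by apply/measurable_EFinP; apply: measurable_funX; by apply: measurable_funB; try exact: mu_.
  apply: (@le_trans _ _ (\int[mu]_x ((2 ^+ k)%:E * ((w k.+1 x - w k x) ^+ 2)%:E
      + (2 ^- k)%:E))%E).
    apply: ge0_le_integral => //.
    - by move=> x _; rewrite lee_fin /g.
    - exact/measurable_EFinP.
    - apply: emeasurable_funD => //; exact: emeasurable_funM.
    - move=> x _; rewrite -EFinM -EFinD lee_fin /g; exact: normr_le_sqr.
  rewrite ge0_integralD//; last 2 first.
    - by move=> x _; rewrite -EFinM lee_fin mulr_ge0 ?sqr_ge0 ?exprn_ge0.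
    - exact: emeasurable_funM.
  rewrite ge0_integralZl//; last by move=> x _; rewrite lee_fin sqr_ge0.
  rewrite integral_cst// muc.
  apply: (@le_trans _ _ ((2 ^+ k)%:E * (4 ^- k)%:E + (2 ^- k)%:E * c%:E)%E).
    rewrite leeD2r// lee_pmul2l// ?lte_fin//.
    apply: NP; last exact: phi_N.
    exact: leq_trans (phi_N k) (phi_S k).
  rewrite -!EFinM -EFinD lee_fin (_ : 4 = 2 * 2 :> R); last by ring.
  rewrite exprMn mulrDl mul1r invfM mulrA divff ?gt_eqF// mul1r.
  by rewrite [c / _]mulrC.
have g0 k x : (0 <= (g k x)%:E)%E by rewrite lee_fin /g.
pose F x := (\sum_(0 <= k <oo) (g k x)%:E)%E.
have mF : measurable_fun setT F.
  apply: (@ge0_emeasurable_sum _ _ _ setT (fun k x => (g k x)%:E) xpredT).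
    by move=> *; exact: g0.
  by move=> k _; exact/measurable_EFinP.
have iF : (\int[mu]_x F x < +oo)%E.
  rewrite /F integral_nneseries//; last by move=> n; exact/measurable_EFinP.
  apply: (@le_lt_trans _ _ (2 * (1 + c))%:E); last exact: ltry.
  apply: lime_le; first by apply: is_cvg_nneseries => *; exact: integral_ge0.
  apply: nearW => n; apply: (@le_trans _ _ (\sum_(0 <= k < n) ((1 + c) / 2 ^+ k)%:E)%E).
    by apply: lee_sum => k _; exact: gle.
  by rewrite sumEFin lee_fin series_half_lt// addr_ge0.
pose A := [set x | (F x < +oo)%E].
have mA : measurable A.
  by rewrite -[A]setTI; exact: emeasurable_fun_infty_o.
have F0 x : (0 <= F x)%E by apply: nneseries_ge0.
have A1 : {ae mu, forall x, A x}.
  have iFF : mu.-integrable setT F.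
    by apply/integrableP; split => //; under eq_integral do rewrite gee0_abs//.
  apply: filterS (integrable_ae measurableT iFF) => x /(_ I).
  by rewrite ge0_fin_numE.
(* Cut off to 0 outside the set of convergence, so that the limit exists everywhere and is
   measurable. *)
pose w' k := (w k) \_ A.
have mw' k : measurable_fun setT (w' k).
  by apply/(measurable_restrictT _ mA); apply: measurable_funTS; exact: mu_.
have cw' x : cvgn (w' ^~ x).
  have [Ax|/negPf nAx] := boolP (x \in A); last first.
    by rewrite /w' /patch nAx; exact: is_cvg_cst.
  rewrite /w' /patch Ax; move: Ax => /set_mem Ax.
  have cg : cvgn (series (g ^~ x)).
    apply: nondecreasing_is_cvgn.
      by apply: nondecreasing_series => n _ _; rewrite /g.
    exists (fine (F x)) => _ [n _ <-].
    rewrite -lee_fin fineK ?ge0_fin_numE// /series/= -sumEFin.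
    exact: nneseries_lim_ge.
  have /normed_cvg : cvgn [normed series (fun k => w k.+1 x - w k x)] by exact: cg.
  have -> : series (fun k => w k.+1 x - w k x) = (fun n => w n x - w 0 x).
    by apply/funext => n; rewrite /series/= telescope_sumr.
  move=> cw; have -> : (fun k => w k x) = (fun n => w n x - w 0 x + w 0 x).
    by apply/funext => n; rewrite subrK.
  by apply: is_cvgD => //; exact: is_cvg_cst.
pose v x := limn (w' ^~ x).
have mv : measurable_fun setT v.
  by apply: (measurable_fun_cvg mw') => x _; exact: cw'.
have H (e : R) : 0 < e -> exists N, forall n, (N <= n)%N ->
    (\int[mu]_x ((u n x - v x) ^+ 2)%:E <= e%:E)%E.
  move=> e0; have [N Ne] := uC _ e0; exists N => n Nn.
  pose f_ k x := ((u n x - w' (k + N)%N x) ^+ 2)%:E.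
  have mf_ k : measurable_fun setT (f_ k).
    by apply/measurable_EFinP; apply: measurable_funX; by apply: measurable_funB; try exact: mu_.
  have f_0 k x : setT x -> (0 <= f_ k x)%E by move=> _; rewrite lee_fin sqr_ge0.
  have f_e k : (\int[mu]_x f_ k x <= e%:E)%E.
    rewrite (@ae_eq_integral _ _ _ mu setT (fun x => ((u n x - w (k + N)%N x) ^+ 2)%:E))//.
    - by apply: Ne => //; apply: leq_trans (phi_ge _); exact: leq_addl.
    - by apply/measurable_EFinP; apply: measurable_funX; apply: measurable_funB => //; exact: mu_.
    - by apply: filterS A1 => x Ax _; rewrite /f_ /w' /patch mem_set.
  (* Fatou passes the Cauchy bound [f_e], uniform in k, to the limit. *)
  have := fatou mu measurableT mf_ f_0.
  rewrite (_ : (fun x => limn_einf (f_^~ x)) = (fun x => ((u n x - v x) ^+ 2)%:E)); last first.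
    apply/funext => x.
    have cw : (fun k => w' (k + N)%N x) @ \oo --> v x.
      by rewrite (cvg_shiftn N (w' ^~ x)); exact: cw'.
    have cf : (fun k => (u n x - w' (k + N)%N x) ^+ 2) @ \oo --> (u n x - v x) ^+ 2.
      by rewrite expr2; apply: cvgM; apply: cvgB => //; exact: cvg_cst.
    have cfE : f_ ^~ x @ \oo --> ((u n x - v x) ^+ 2)%:E.
      by apply: cvg_EFin; [exact: nearW|exact: cf].
    by have [] := cvg_limn_einf_sup cfE.
  move=> /le_trans; apply.
  rewrite limn_einf_lim; apply: lime_le; first exact: is_cvg_einfs.
  apply: nearW => k; apply: le_trans (f_e k).
  by apply: ereal_inf_lbound; exists k => //=.
exists v; split => //; last first.
  move=> x y xy; rewrite /v.
  have Fxy : F x = F y.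
    by apply: congr_lim; apply/funext => n; apply: eq_bigr => i _; rewrite /g /w !xy.
  have Axy : (x \in A) = (y \in A) by apply/idP/idP; rewrite !inE /A /= Fxy.
  suff -> : w' ^~ x = w' ^~ y by [].
  by apply/funext => k; rewrite /w' /patch Axy /w xy.
have [N /(_ N (leqnn N)) HN] := H _ ltr01.
have : (fun x => u N x - v x) \in Lfun mu 2%:E.
  apply/Lfun2P; split; first by apply: measurable_funB; try exact: mu_.
  by apply: le_lt_trans HN _; exact: ltry.
have [L0 LP] := @Lfun_submod_closed _ _ _ mu 2%:E (lee1n 2).
move=> h; have := LP (-1) _ _ h (u2 N).
rewrite (_ : _ + _ = v)//; apply/funext => x /=.
by rewrite -[LHS]/(-1 * (u N x - v x) + u N x); ring.
Qed.

End Complete.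

(** * Integration on the circle and the inner product *)

Section Cint.
Variable R : realType.
Local Notation C := R[i].
Local Notation T := (circle R).
Local Notation mu01 := (mu01 R).
Implicit Types (f g z : T -> C).

Lemma cReD (x y : C) : Re (x + y) = Re x + Re y.
Proof. by case: x y => [? ?] [? ?]. Qed.
Lemma cImD (x y : C) : Im (x + y) = Im x + Im y.
Proof. by case: x y => [? ?] [? ?]. Qed.
Lemma cReM (x y : C) : Re (x * y) = Re x * Re y - Im x * Im y.
Proof. by case: x y => [? ?] [? ?]. Qed.
Lemma cImM (x y : C) : Im (x * y) = Re x * Im y + Im x * Re y.
Proof. by case: x y => [? ?] [? ?]. Qed.
Lemma cRe_conj (x : C) : Re x^* = Re x. Proof. by case: x. Qed.
Lemma cIm_conj (x : C) : Im x^* = - Im x. Proof. by case: x. Qed.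

Definition cmeas f : Prop :=
  measurable_fun (setT : set (measurableTypeR R)) (fun x => Re (f (cis x))) /\
  measurable_fun (setT : set (measurableTypeR R)) (fun x => Im (f (cis x))).

Definition aeq f g : Prop := {ae mu01, forall x, f (cis x) = g (cis x)}.

Lemma aeW01 (P Q : R -> Prop) : (forall x, P x -> Q x) ->
  {ae mu01, forall x, P x} -> {ae mu01, forall x, Q x}.
Proof.
have aeF : Filter (almost_everywhere mu01).
  exact: (@ae_filter_ringOfSetsType _ _ _ mu01).
by move=> PQ; apply: filterS => x; exact: PQ.
Qed.

Lemma aeW2 (P Q S : R -> Prop) : (forall x, P x -> Q x -> S x) ->
  {ae mu01, forall x, P x} -> {ae mu01, forall x, Q x} -> {ae mu01, forall x, S x}.
Proof.
have aeF : Filter (almost_everywhere mu01).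
  exact: (@ae_filter_ringOfSetsType _ _ _ mu01).
by move=> PQ; apply: filterS2 => x; exact: PQ.
Qed.

Lemma aeq_refl f : aeq f f. Proof. exact: aeW. Qed.
Lemma aeq_sym f g : aeq f g -> aeq g f.
Proof. by apply: aeW01 => x ->. Qed.
Lemma aeq_trans g f h : aeq f g -> aeq g h -> aeq f h.
Proof. by apply: aeW2 => x -> ->. Qed.

Lemma cmeasD f g : cmeas f -> cmeas g -> cmeas (fun t => f t + g t).
Proof.
move=> [f1 f2] [g1 g2]; split.
  by under eq_fun do rewrite cReD; exact: measurable_funD.
by under eq_fun do rewrite cImD; exact: measurable_funD.
Qed.

Lemma cmeasM f g : cmeas f -> cmeas g -> cmeas (fun t => f t * g t).
Proof.
move=> [f1 f2] [g1 g2]; split.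
  by under eq_fun do rewrite cReM; apply: measurable_funB; exact: measurable_funM.
by under eq_fun do rewrite cImM; apply: measurable_funD; exact: measurable_funM.
Qed.

Lemma cmeas_conj f : cmeas f -> cmeas (fun t => (f t)^*).
Proof.
move=> [f1 f2]; split.
  by under eq_fun do rewrite cRe_conj.
by under eq_fun do rewrite cIm_conj; exact: measurable_funN.
Qed.

Lemma cmeas_cst (c : C) : cmeas (fun=> c).
Proof. by split; exact: measurable_cst. Qed.

Lemma Lfun_mes p (f : R -> R) : f \in Lfun mu01 p ->
  measurable_fun (setT : set (measurableTypeR R)) f.
Proof. by move=> h; have /set_mem := sub_Lfun_mfun h. Qed.

Lemma LpP p f : (f \in Lp p) = ((fun x => Re (f (cis x))) \in Lfun mu01 p) &&
  ((fun x => Im (f (cis x))) \in Lfun mu01 p).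
Proof. by []. Qed.

Lemma Lp_cmeas p f : f \in Lp p -> cmeas f.
Proof. by rewrite LpP => /andP[/Lfun_mes ? /Lfun_mes ?]. Qed.

Lemma Lp1_int f : f \in Lp 1 ->
  mu01.-integrable setT (EFin \o (fun x => Re (f (cis x)))) /\
  mu01.-integrable setT (EFin \o (fun x => Im (f (cis x)))).
Proof. by rewrite LpP => /andP[/Lfun1_integrable ? /Lfun1_integrable ?]. Qed.

Lemma int_Lp1 f :
  mu01.-integrable setT (EFin \o (fun x => Re (f (cis x)))) ->
  mu01.-integrable setT (EFin \o (fun x => Im (f (cis x)))) -> f \in Lp 1.
Proof. by rewrite LpP => ? ?; apply/andP; split; exact/Lfun1_integrable. Qed.

Lemma cintD f g : f \in Lp 1 -> g \in Lp 1 ->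
  cint (fun t => f t + g t) = cint f + cint g.
Proof.
move=> /Lp1_int[f1 f2] /Lp1_int[g1 g2]; rewrite /cint.
under eq_Rintegral do rewrite cReD.
under [X in _ +i* X]eq_Rintegral do rewrite cImD.
by rewrite !RintegralD.
Qed.

Lemma cintZ (a : C) f : f \in Lp 1 -> cint (fun t => a * f t) = a * cint f.
Proof.
move=> /Lp1_int[f1 f2]; rewrite /cint.
under eq_Rintegral do rewrite cReM.
under [X in _ +i* X]eq_Rintegral do rewrite cImM.
rewrite RintegralB//; [|exact: (integrableZl _ _ f1)|exact: (integrableZl _ _ f2)].
rewrite RintegralD//; [|exact: (integrableZl _ _ f2)|exact: (integrableZl _ _ f1)].
by rewrite !RintegralZl//; case: a.
Qed.

Lemma cint_conj f : f \in Lp 1 -> cint (fun t => (f t)^*) = (cint f)^*.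
Proof.
move=> /Lp1_int[f1 f2]; rewrite /cint.
under eq_Rintegral do rewrite cRe_conj.
under [X in _ +i* X]eq_Rintegral do rewrite cIm_conj -mulN1r.
by rewrite RintegralZl// mulN1r.
Qed.

Lemma cint_aeq f g : cmeas f -> cmeas g -> aeq f g -> cint f = cint g.
Proof.
move=> [f1 f2] [g1 g2] fg; rewrite /cint /Rintegral.
congr (fine _ +i* fine _); apply: ae_eq_integral => //; try exact/measurable_EFinP.
  by apply: aeW01 fg => x -> _.
by apply: aeW01 fg => x -> _.
Qed.

(** The link that makes reflection invariance of Lebesgue measure on [0, 1] into invariance of
    [cint] under t -> 1/t. *)
Lemma cis_refl (x : R) : cis (1 - x) = ptinv (cis x).
Proof.
apply: val_inj => /=; rewrite /ptval /=.
have -> : (cos (2 * pi * x) +i* sin (2 * pi * x))^-1 =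
  (cos (2 * pi * x) -i* sin (2 * pi * x)).
  apply: (@mulfI _ (cos (2 * pi * x) +i* sin (2 * pi * x))).
    apply/negP => /eqP[c0 s0].
    by have := cos2Dsin2 (2 * pi * x); rewrite c0 s0 expr0n addr0 => /esym/eqP; rewrite oner_eq0.
  rewrite mulfV.
    apply/eqP; rewrite eq_complex /=; apply/andP; split; apply/eqP.
      by rewrite mulrN opprK -!expr2 cos2Dsin2.
    by ring.
  apply/negP => /eqP[c0 s0].
  by have := cos2Dsin2 (2 * pi * x); rewrite c0 s0 expr0n addr0 => /esym/eqP; rewrite oner_eq0.
rewrite mulrBr mulr1 mulr_natl cosB sinB cos2pi sin2pi.
by congr (_ +i* _); ring.
Qed.

Lemma cint_ptinv f : cmeas f -> cint (fun t => f (ptinv t)) = cint f.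
Proof.
move=> [f1 f2]; rewrite /cint /Rintegral.
congr (fine _ +i* fine _).
  under eq_integral do rewrite -cis_refl.
  rewrite (integral_refl01 (f := fun x => (Re (f (cis x)))%:E))//.
  exact/measurable_EFinP.
under eq_integral do rewrite -cis_refl.
rewrite (integral_refl01 (f := fun x => (Im (f (cis x)))%:E))//.
exact/measurable_EFinP.
Qed.

Lemma aeq_ptinv f g : aeq f g -> aeq (fun t => f (ptinv t)) (fun t => g (ptinv t)).
Proof.
by move=> /ae_refl01; apply: aeW01 => x; rewrite cis_refl.
Qed.

Lemma cmeas_ptinv f : cmeas f -> cmeas (fun t => f (ptinv t)).
Proof.
move=> [f1 f2]; split.
  under eq_fun do rewrite -cis_refl.
  exact: (measurableT_comp f1 (@measurable_refl01 R)).
under eq_fun do rewrite -cis_refl.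
exact: (measurableT_comp f2 (@measurable_refl01 R)).
Qed.

End Cint.

(** * Bounded multipliers and continuity of the parametrization *)

Section Bounded.
Variable R : realType.
Local Notation C := R[i].
Local Notation T := (circle R).
Implicit Types (f g z : T -> C).

(** The class of multipliers. All of them come from continuous functions, so a pointwise bound over
    the interval carrying [mu01] takes the place of an essential supremum. *)
Definition bmeas z : Prop := cmeas z /\ exists M : R, forall x : R, 0 <= x <= 1 ->
  `|Re (z (cis x))| <= M /\ `|Im (z (cis x))| <= M.

Lemma bmeas_cmeas z : bmeas z -> cmeas z. Proof. by case. Qed.

Lemma bmeasD z w : bmeas z -> bmeas w -> bmeas (fun t => z t + w t).
Proof.
move=> [mz [M zM]] [mw [K wK]]; split; first exact: cmeasD.
exists (M + K) => x x01; have [? ?] := zM x x01; have [? ?] := wK x x01.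
by rewrite cReD cImD; split; apply: le_trans (ler_normD _ _) _; exact: lerD.
Qed.

Lemma bmeasM z w : bmeas z -> bmeas w -> bmeas (fun t => z t * w t).
Proof.
move=> [mz [M zM]] [mw [K wK]]; split; first exact: cmeasM.
exists (M * K + M * K) => x x01; have [? ?] := zM x x01; have [? ?] := wK x x01.
rewrite cReM cImM; split.
  by apply: le_trans (ler_normB _ _) _; rewrite !normrM lerD// ler_pM.
by apply: le_trans (ler_normD _ _) _; rewrite !normrM lerD// ler_pM.
Qed.

Lemma bmeas_cst (c : C) : bmeas (fun=> c).
Proof.
split; first exact: cmeas_cst.
exists (Num.max `|Re c| `|Im c|) => x _.
by rewrite !le_max !lexx orbT.
Qed.

Lemma bmeas_conj z : bmeas z -> bmeas (fun t => (z t)^*).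
Proof.
move=> [mz [M zM]]; split; first exact: cmeas_conj.
by exists M => x /zM[? ?]; rewrite cRe_conj cIm_conj normrN.
Qed.

Lemma bmeas_ptinv z : bmeas z -> bmeas (fun t => z (ptinv t)).
Proof.
move=> [mz [M zM]]; split; first exact: cmeas_ptinv.
by exists M => x x01; rewrite -cis_refl; apply: zM; lra.
Qed.

Lemma bmeas_sum (I : Type) (r : seq I) (F : I -> T -> C) :
  (forall i, bmeas (F i)) -> bmeas (fun t => \sum_(i <- r) F i t).
Proof.
move=> bF; elim: r => [|i r IH].
  by under eq_fun do rewrite big_nil; exact: bmeas_cst.
by under eq_fun do rewrite big_cons; exact: bmeasD.
Qed.

Lemma normc_circle (t : T) : `|ptval t| = 1.
Proof. by have /set_mem := valP t. Qed.

Lemma ptval_neq0 (t : T) : ptval t != 0.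
Proof. by rewrite -normr_eq0 normc_circle oner_eq0. Qed.

Lemma conj_ptval (t : T) : (ptval t)^* = (ptval t)^-1.
Proof.
apply: (mulfI (ptval_neq0 t)); rewrite (mulfV (ptval_neq0 t)).
by rewrite -sqr_normc normc_circle expr1n.
Qed.

Lemma ptval_inv (t : T) : ptval (ptinv t) = (ptval t)^-1. Proof. by []. Qed.

Lemma ptinvK (t : T) : ptinv (ptinv t) = t.
Proof. by apply: val_inj; rewrite /= /ptval /= invrK. Qed.

Lemma continuous_real_complex : continuous (fun x : R => (x%:C : C^o)).
Proof.
move=> x; apply/cvgrPdist_lt => e e0.
have [r r0 ->] : exists2 r : R, 0 < r & e = r%:C.
  case: e e0 => a b; rewrite ltcE /= => /andP[/eqP -> a0].
  by exists a.
near=> y; rewrite -rmorphB normc_def /= expr0n addr0 sqrtr_sqr ltcR.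
by near: y; exists r.
Unshelve. all: by end_near. Qed.

Lemma continuous_Re (g : R -> C^o) : continuous g -> continuous (fun x => Re (g x)).
Proof.
move=> cg x; apply/cvgrPdist_lt => e e0.
have e0' : 0 < e%:C by rewrite ltcR.
have /cvgrPdist_lt/(_ _ e0') ge := cg x.
near=> y; rewrite -ltcR; apply: (@le_lt_trans _ _ `|g x - g y|); last by near: y.
case: (g x) (g y) => [a b] [c d]; rewrite normc_def /= lecR -sqrtr_sqr ler_wsqrtr//.
by rewrite lerDl sqr_ge0.
Unshelve. all: by end_near. Qed.

Lemma continuous_Im (g : R -> C^o) : continuous g -> continuous (fun x => Im (g x)).
Proof.
move=> cg x; apply/cvgrPdist_lt => e e0.
have e0' : 0 < e%:C by rewrite ltcR.
have /cvgrPdist_lt/(_ _ e0') ge := cg x.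
near=> y; rewrite -ltcR; apply: (@le_lt_trans _ _ `|g x - g y|); last by near: y.
case: (g x) (g y) => [a b] [c d]; rewrite normc_def /= lecR -sqrtr_sqr ler_wsqrtr//.
by rewrite lerDr sqr_ge0.
Unshelve. all: by end_near. Qed.

(** The circle has the induced topology, so continuity is tested after the inclusion into the
    plane. *)
Lemma continuous_cis : continuous (@cis R).
Proof.
apply/(@continuous_comp_initial _ _ _ (set_val : T -> C^o)).
move=> x.
have -> : (set_val : T -> C^o) \o @cis R =
    (fun y : R => ((cos (2 * pi * y))%:C : C^o) + ('i%C : C^o) * (sin (2 * pi * y))%:C).
  apply/funext => y /=; apply/eqP; rewrite eq_complex /=.
  by apply/andP; split; apply/eqP; ring.
have c2 : continuous (fun y : R => 2 * pi * y).
  by move=> y; apply: cvgMr; exact: cvg_id.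
apply: cvgD.
  apply: (@continuous_comp _ _ _ (fun y : R => cos (2 * pi * y)) (fun r : R => r%:C : C^o)).
    by apply: continuous_comp; [exact: c2|exact: continuous_cos].
  exact: continuous_real_complex.
apply: cvgM; first exact: cvg_cst.
apply: (@continuous_comp _ _ _ (fun y : R => sin (2 * pi * y)) (fun r : R => r%:C : C^o)).
  by apply: continuous_comp; [exact: c2|exact: continuous_sin].
exact: continuous_real_complex.
Qed.

Lemma bmeas_continuous z : continuous (z : T -> C^o) -> bmeas z.
Proof.
move=> cz.
have czc : continuous (fun x : R => z (cis x) : C^o).
  by move=> x; apply: continuous_comp; [exact: continuous_cis|exact: cz].
have cR := continuous_Re czc; have cI := continuous_Im czc.
split; first by split; exact: continuous_measurable_fun.
have bnd (h : R -> R) : continuous h -> exists M : R, forall x : R, 0 <= x <= 1 -> `|h x| <= M.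
  move=> ch; have cw : {within `[0, 1], continuous (fun x => `|h x|)}.
    apply: continuous_subspaceT => x; apply: continuous_comp; first exact: ch.
    exact: norm_continuous.
  have [c _ hc] := @EVT_max _ (fun x => `|h x|) 0 1 ler01 cw.
  by exists `|h c| => x x01; apply: hc; rewrite in_itv.
have [M hM] := bnd _ cR; have [K hK] := bnd _ cI.
exists (Num.max M K) => x x01.
by rewrite !le_max hM// hK// orbT.
Qed.

End Bounded.

(** * Square integrable classes and their inner product *)

Section L2api.
Variable R : realType.
Local Notation C := R[i].
Local Notation T := (circle R).
Local Notation mu01 := (mu01 R).
Local Notation L2 := (L2 R).
Implicit Types (f g z : T -> C) (u v w : L2).

Local Open Scope quotient_scope.

Lemma mu01_lty : (mu01 setT < +oo)%E.
Proof. by rewrite mu01T ltry. Qed.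

Lemma Lfun2_bounded (h g : R -> R) (M : R) :
  measurable_fun (setT : set (measurableTypeR R)) h ->
  (forall x, 0 <= x <= 1 -> `|h x| <= M) ->
  g \in Lfun mu01 2%:E -> (fun x => h x * g x) \in Lfun mu01 2%:E.
Proof.
move=> mh hM g2; have /Lfun2P[mg ig] := g2.
have mgg : measurable_fun (setT : set (measurableTypeR R)) (fun x => (g x ^+ 2)%:E).
  by apply/measurable_EFinP; exact: measurable_funX.
apply/Lfun2P; split; first exact: measurable_funM.
apply: (@le_lt_trans _ _ (\int[mu01]_x ((M ^+ 2)%:E * (g x ^+ 2)%:E))%E).
  apply: ae_ge0_le_integral => //.
  - by move=> x _; rewrite lee_fin sqr_ge0.
  - by apply/measurable_EFinP; apply: measurable_funX; exact: measurable_funM.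
  - by move=> x _; rewrite -EFinM lee_fin mulr_ge0 ?sqr_ge0.
  - exact: emeasurable_funM.
  - apply: ae_mu01 => x x01 _; rewrite -EFinM lee_fin exprMn ler_wpM2r ?sqr_ge0//.
    by rewrite -(real_normK (num_real (h x))) ler_pXn2r ?nnegrE ?hM// (le_trans _ (hM x x01)).
have M2 : (0 <= (M ^+ 2)%:E)%E by rewrite lee_fin sqr_ge0.
rewrite ge0_integralZl//; first by rewrite lte_mul_pinfty.
by move=> x _; rewrite lee_fin sqr_ge0.
Qed.

Lemma Lfun2D (f g : R -> R) : f \in Lfun mu01 2%:E -> g \in Lfun mu01 2%:E ->
  (fun x => f x + g x) \in Lfun mu01 2%:E.
Proof.
have [_ LP] := @Lfun_submod_closed _ _ _ mu01 2%:E (lee1n 2).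
move=> f2 g2; rewrite (_ : (fun x => _) = 1 *: f + g); first exact: LP.
by rewrite scale1r.
Qed.

Lemma Lfun2N (f : R -> R) : f \in Lfun mu01 2%:E ->
  (fun x => - f x) \in Lfun mu01 2%:E.
Proof.
have [L0 LP] := @Lfun_submod_closed _ _ _ mu01 2%:E (lee1n 2).
move=> f2; rewrite (_ : (fun x => _) = (-1) *: f + 0); first exact: LP.
by rewrite scaleN1r addr0.
Qed.

Lemma Lp2M f g : f \in Lp 2%:E -> g \in Lp 2%:E -> (fun t => f t * g t) \in Lp 1.
Proof.
rewrite (LpP _ f) (LpP _ g) => /andP[f1 f2] /andP[g1 g2].
have Hi (a b : R -> R) : a \in Lfun mu01 2%:E -> b \in Lfun mu01 2%:E ->
    mu01.-integrable setT (EFin \o (fun x => a x * b x)).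
  by move=> a2 b2; apply/Lfun1_integrable; exact: Lfun2_mul_Lfun1.
apply: int_Lp1.
  under eq_fun do rewrite cReM.
  exact: (integrableB _ (Hi _ _ f1 g1) (Hi _ _ f2 g2)).
under eq_fun do rewrite cImM.
exact: (integrableD _ (Hi _ _ f1 g2) (Hi _ _ f2 g1)).
Qed.

Lemma Lp2_conj f : f \in Lp 2%:E -> (fun t => (f t)^*) \in Lp 2%:E.
Proof.
rewrite !LpP => /andP[f1 f2]; apply/andP; split.
  by under eq_fun do rewrite cRe_conj.
by under eq_fun do rewrite cIm_conj; exact: Lfun2N.
Qed.

Lemma Lp2_bounded z f : bmeas z -> f \in Lp 2%:E -> (fun t => z t * f t) \in Lp 2%:E.
Proof.
move=> [[z1 z2] [M zM]]; rewrite !LpP => /andP[f1 f2].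
have zR x : 0 <= x <= 1 -> `|Re (z (cis x))| <= M by move=> /zM[].
have zI x : 0 <= x <= 1 -> `|Im (z (cis x))| <= M by move=> /zM[].
apply/andP; split.
  under eq_fun do rewrite cReM.
  exact: (Lfun2D (Lfun2_bounded z1 zR f1) (Lfun2N (Lfun2_bounded z2 zI f2))).
under eq_fun do rewrite cImM.
exact: (Lfun2D (Lfun2_bounded z1 zR f2) (Lfun2_bounded z2 zI f1)).
Qed.

Lemma Lp2_ptinv f : f \in Lp 2%:E -> (fun t => f (ptinv t)) \in Lp 2%:E.
Proof.
move=> f2; have [m1 m2] := cmeas_ptinv (Lp_cmeas f2).
have [n1 n2] := Lp_cmeas f2.
move: f2; rewrite !LpP => /andP[/Lfun2P[f1 i1] /Lfun2P[f2 i2]].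
apply/andP; split; apply/Lfun2P; split => //.
  under eq_integral do rewrite -cis_refl.
  rewrite (integral_refl01 (f := fun x => (Re (f (cis x)) ^+ 2)%:E))//.
  by apply/measurable_EFinP; exact: measurable_funX.
under eq_integral do rewrite -cis_refl.
rewrite (integral_refl01 (f := fun x => (Im (f (cis x)) ^+ 2)%:E))//.
by apply/measurable_EFinP; exact: measurable_funX.
Qed.

Lemma Lp2D f g : f \in Lp 2%:E -> g \in Lp 2%:E -> (fun t => f t + g t) \in Lp 2%:E.
Proof.
move=> f2 g2; have [_ LP] := @L2_submod_closed R.
have := LP 1 _ _ f2 g2; rewrite (_ : 1 *: f + g = (fun t => f t + g t))//.
by rewrite scale1r.
Qed.

Lemma Lp2_bmeas z : bmeas z -> z \in Lp 2%:E.
Proof.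
move=> bz; rewrite (_ : z = fun t => z t * 1); last by apply/funext => t; rewrite mulr1.
apply: Lp2_bounded => //; rewrite LpP.
have h (c : R) : (fun _ : measurableTypeR R => c) \in Lfun mu01 2%:E.
  apply/Lfun2P; split; first exact: measurable_cst.
  by rewrite integral_cst// -[X in (_ * X)%E]/(mu01 setT) mu01T mule1 ltry.
by apply/andP; split; exact: h.
Qed.

(** [inner] on functions instead of classes: bilinearity is proved here and transported through
    [ip_aeq]. *)
Definition ip f g : C := cint (fun t => f t * conjc (g t)).

Lemma ipDl f g h : f \in Lp 2%:E -> g \in Lp 2%:E -> h \in Lp 2%:E ->
  ip (fun t => f t + g t) h = ip f h + ip g h.
Proof.
move=> f2 g2 h2; rewrite /ip -cintD; try by apply: Lp2M => //; exact: Lp2_conj.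
by congr cint; apply/funext => t; rewrite mulrDl.
Qed.

Lemma ipZl a f h : f \in Lp 2%:E -> h \in Lp 2%:E ->
  ip (fun t => a * f t) h = a * ip f h.
Proof.
move=> f2 h2; rewrite /ip -cintZ; last by apply: Lp2M => //; exact: Lp2_conj.
by congr cint; apply/funext => t; rewrite mulrA.
Qed.

Lemma ip_conj f g : f \in Lp 2%:E -> g \in Lp 2%:E -> ip g f = (ip f g)^*.
Proof.
move=> f2 g2; rewrite /ip -cint_conj; last by apply: Lp2M => //; exact: Lp2_conj.
by congr cint; apply/funext => t; rewrite rmorphM /= conjcK mulrC.
Qed.

Lemma ip_aeq f f' g g' : f \in Lp 2%:E -> f' \in Lp 2%:E ->
  g \in Lp 2%:E -> g' \in Lp 2%:E -> aeq f f' -> aeq g g' -> ip f g = ip f' g'.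
Proof.
move=> f2 f2' g2 g2' ff gg; apply: cint_aeq.
- by apply: cmeasM; [|apply: cmeas_conj]; apply: Lp_cmeas; eassumption.
- by apply: cmeasM; [|apply: cmeas_conj]; apply: Lp_cmeas; eassumption.
- by apply: aeW2 ff gg => x -> ->.
Qed.

Lemma L2classE f (f2 : f \in Lp 2%:E) : L2class f = \pi_L2 (MkL2fun f2).
Proof.
congr (\pi_L2 _); rewrite /insubd insubT/=.
exact: val_inj.
Qed.

Lemma L2repr_Lp2 u : L2repr u \in Lp 2%:E.
Proof. exact: valP. Qed.
Hint Resolve L2repr_Lp2 : core.

Lemma L2reprK u : L2class (L2repr u) = u.
Proof.
rewrite (L2classE (L2repr_Lp2 u)) -[RHS]reprK; congr (\pi_L2 _).
exact: val_inj.
Qed.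

Lemma L2class_eqP f g : f \in Lp 2%:E -> g \in Lp 2%:E ->
  (L2class f = L2class g <-> aeq f g).
Proof.
move=> f2 g2; rewrite (L2classE f2) (L2classE g2).
rewrite (rwP eqP) -Quotient.idealrBE unfold_in -(rwP (asboolP _)).
have E t : L2val (MkL2fun f2 - MkL2fun g2) t = f t - g t by [].
split; first by apply: aeW01 => x; rewrite E => /subr0_eq.
by apply: aeW01 => x; rewrite E => ->; rewrite subrr.
Qed.

Lemma L2repr_class f : f \in Lp 2%:E -> aeq (L2repr (L2class f)) f.
Proof. by move=> f2; apply/L2class_eqP => //; rewrite L2reprK. Qed.

Lemma L2class_aeq f g : f \in Lp 2%:E -> g \in Lp 2%:E -> aeq f g ->
  L2class f = L2class g.
Proof. by move=> ? ? ?; exact/L2class_eqP. Qed.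

Lemma L2classD f g : f \in Lp 2%:E -> g \in Lp 2%:E ->
  L2class (fun t => f t + g t) = L2class f + L2class g.
Proof.
move=> f2 g2; rewrite (L2classE f2) (L2classE g2) -L2piD (L2classE (Lp2D f2 g2)).
by congr (\pi_L2 _); exact: val_inj.
Qed.

Lemma Lp2Z a f : f \in Lp 2%:E -> (fun t => a * f t) \in Lp 2%:E.
Proof. by apply: Lp2_bounded; exact: bmeas_cst. Qed.

Lemma L2classZ a f : f \in Lp 2%:E ->
  L2class (fun t => a * f t) = a *: L2class f.
Proof.
move=> f2; rewrite (L2classE f2) -[RHS]/(L2scale _ _) L2scale_pi (L2classE (Lp2Z a f2)).
by congr (\pi_L2 _); exact: val_inj.
Qed.

Lemma L2reprD u v : aeq (L2repr (u + v)) (fun t => L2repr u t + L2repr v t).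
Proof.
apply: aeq_trans (L2repr_class (Lp2D _ _)) => //.
by rewrite L2classD// !L2reprK; exact: aeq_refl.
Qed.

Lemma L2reprZ a u : aeq (L2repr (a *: u)) (fun t => a * L2repr u t).
Proof.
apply: aeq_trans (L2repr_class (Lp2Z _ _)) => //.
by rewrite L2classZ// !L2reprK; exact: aeq_refl.
Qed.

Lemma L2repr0 : aeq (L2repr (0 : L2)) (fun=> 0).
Proof.
have := L2reprZ 0 0; rewrite scale0r => h; apply: aeq_trans h _.
by apply: aeW => x /=; rewrite mul0r.
Qed.

Lemma inner_class f g : f \in Lp 2%:E -> g \in Lp 2%:E ->
  inner (L2class f) (L2class g) = ip f g.
Proof. by move=> f2 g2; apply: ip_aeq => //; exact: L2repr_class. Qed.

Lemma innerDl u v w : inner (u + v) w = inner u w + inner v w.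
Proof.
rewrite -[inner u w]/(ip _ _) -[inner v w]/(ip _ _) -ipDl//.
by apply: ip_aeq => //; [exact: Lp2D|exact: L2reprD|exact: aeq_refl].
Qed.

Lemma innerZl a u w : inner (a *: u) w = a * inner u w.
Proof.
rewrite -[inner u w]/(ip _ _) -ipZl//.
by apply: ip_aeq => //; [exact: Lp2Z|exact: L2reprZ|exact: aeq_refl].
Qed.

Lemma inner_conj u v : inner v u = (inner u v)^*.
Proof. exact: ip_conj. Qed.

Lemma Re_innerE u : Re (inner u u) =
  Rintegral mu01 setT (fun x => Re (L2repr u (cis x)) ^+ 2 + Im (L2repr u (cis x)) ^+ 2).
Proof.
rewrite /inner /cint /=; apply: eq_Rintegral => x _.
by rewrite cReM cRe_conj cIm_conj; ring.
Qed.

Lemma Re_inner_ge0 u : 0 <= Re (inner u u).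
Proof. by rewrite Re_innerE; apply: Rintegral_ge0 => x _; rewrite addr_ge0 ?sqr_ge0. Qed.

Lemma Im_inner u : Im (inner u u) = 0.
Proof. by have := inner_conj u u; case: (inner u u) => a b [] /=; lra. Qed.

Lemma Lp2_int f : f \in Lp 2%:E ->
  mu01.-integrable setT (EFin \o (fun x => Re (f (cis x)) ^+ 2 + Im (f (cis x)) ^+ 2)).
Proof.
rewrite LpP => /andP[/Lfun2_integrable_sqr f1 /Lfun2_integrable_sqr f2].
exact: (integrableD _ f1 f2).
Qed.

Lemma inner_eq0 u : Re (inner u u) = 0 -> u = 0.
Proof.
rewrite Re_innerE => I0.
have [m1 m2] := Lp_cmeas (L2repr_Lp2 u).
have fi := Lp2_int (L2repr_Lp2 u).
pose h (x : measurableTypeR R) : R := Re (L2repr u (cis x)) ^+ 2 + Im (L2repr u (cis x)) ^+ 2.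
have h0 x : 0 <= h x by rewrite addr_ge0 ?sqr_ge0.
have hi : mu01.-integrable setT (EFin \o h) by exact: fi.
have : (\int[mu01]_x `|(EFin \o h) x| = 0)%E.
  under eq_integral do rewrite /= ger0_norm//.
  by rewrite -[LHS]fineK ?(integrable_fin_num _ hi)// -[X in X%:E]/(Rintegral _ _ _) I0.
move/(ae_eq_integral_abs _ measurableT (measurable_int _ hi)) => H.
rewrite -[u]L2reprK -[RHS]L2reprK; apply: L2class_aeq => //.
apply: aeW2 H L2repr0 => x /(_ I) [hx] ->.
move: hx => /eqP; rewrite /h paddr_eq0 ?sqr_ge0// !sqrf_eq0 => /andP[/eqP a0 /eqP b0].
by move: a0 b0; case: (L2repr u (cis x)) => a b /= -> ->.
Qed.

End L2api.

(** * Multiplication and flip on scalar classes, completeness *)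

Section ScalarOps.
Variable R : realType.
Local Notation C := R[i].
Local Notation T := (circle R).
Local Notation mu01 := (mu01 R).
Local Notation L2 := (L2 R).
Implicit Types (f g z w : T -> C) (u v : L2).
Local Hint Resolve L2repr_Lp2 : core.

Lemma L2reprN u : aeq (L2repr (- u)) (fun t => - L2repr u t).
Proof.
by rewrite -scaleN1r; apply: aeq_trans (L2reprZ _ _) _; apply: aeW => x; rewrite mulN1r.
Qed.

Lemma L2reprB u v : aeq (L2repr (u - v)) (fun t => L2repr u t - L2repr v t).
Proof.
apply: aeq_trans (L2reprD _ _) _.
by apply: aeW01 (L2reprN v) => x ->.
Qed.

Lemma L2_eqP u v : (u = v) <-> aeq (L2repr u) (L2repr v).
Proof. by rewrite -L2class_eqP// !L2reprK. Qed.

Lemma cconjD (a b : C) : conjc (a + b) = conjc a + conjc b. Proof. exact: rmorphD. Qed.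
Lemma cconjM (a b : C) : conjc (a * b) = conjc a * conjc b. Proof. exact: rmorphM. Qed.
Lemma cconjN (a : C) : conjc (- a) = - conjc a. Proof. exact: rmorphN. Qed.

Definition nsq u : R := Re (inner u u).

Lemma nsq_ge0 u : 0 <= nsq u. Proof. exact: Re_inner_ge0. Qed.
Lemma nsq_eq0 u : nsq u = 0 -> u = 0. Proof. exact: inner_eq0. Qed.

Lemma innerE u : inner u u = (nsq u)%:C.
Proof. by rewrite /nsq; have := Im_inner u; case: (inner u u) => a b /= ->. Qed.

Lemma innerNl u v : inner (- u) v = - inner u v.
Proof. by rewrite -scaleN1r innerZl mulN1r. Qed.
Lemma innerBl u v (w : L2) : inner (u - v) w = inner u w - inner v w.
Proof. by rewrite innerDl innerNl. Qed.
Lemma inner0l u : inner 0 u = 0.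
Proof. by rewrite -(scale0r 0) innerZl mul0r. Qed.
Lemma innerDr u v (w : L2) : inner u (v + w) = inner u v + inner u w.
Proof. by rewrite inner_conj innerDl cconjD -!inner_conj. Qed.
Lemma innerZr (a : C) u v : inner u (a *: v) = conjc a * inner u v.
Proof. by rewrite inner_conj innerZl cconjM -inner_conj. Qed.
Lemma innerNr u v : inner u (- v) = - inner u v.
Proof. by rewrite inner_conj innerNl cconjN -inner_conj. Qed.
Lemma innerBr u v (w : L2) : inner u (v - w) = inner u v - inner u w.
Proof. by rewrite innerDr innerNr. Qed.
Lemma inner0r u : inner u 0 = 0.
Proof. by rewrite inner_conj inner0l conjc0. Qed.

Lemma inner_suml (I : Type) (r : seq I) (F : I -> L2) v :
  inner (\sum_(i <- r) F i) v = \sum_(i <- r) inner (F i) v.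
Proof. exact: (big_morph (fun u => inner u v) (fun x y => innerDl x y v) (inner0l v)). Qed.

(** The parallelogram identity with the square of [u - v] dropped. *)
Lemma nsqD_le u v : nsq (u + v) <= 2 * nsq u + 2 * nsq v.
Proof.
have := nsq_ge0 (u - v); rewrite /nsq !innerBl !innerBr !innerDl !innerDr.
by case: (inner u u) (inner u v) (inner v u) (inner v v) => [? ?] [? ?] [? ?] [? ?] /=; lra.
Qed.

Lemma nsqZ (a : C) u : nsq (a *: u) = (Re a ^+ 2 + Im a ^+ 2) * nsq u.
Proof.
by rewrite /nsq innerZl innerZr innerE; case: a => a b /=; ring.
Qed.

Definition mulL2 z u : L2 := L2class (fun t => z t * L2repr u t).

Lemma mulL2_repr z u : bmeas z -> aeq (L2repr (mulL2 z u)) (fun t => z t * L2repr u t).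
Proof. by move=> bz; apply: L2repr_class; exact: Lp2_bounded. Qed.

Lemma mulL2Dr z u v : bmeas z -> mulL2 z (u + v) = mulL2 z u + mulL2 z v.
Proof.
move=> bz; rewrite -L2classD; try exact: Lp2_bounded.
apply: L2class_aeq; first exact: Lp2_bounded.
  by apply: Lp2D; exact: Lp2_bounded.
by apply: aeW01 (L2reprD u v) => x ->; rewrite mulrDr.
Qed.

Lemma mulL2Zr z (a : C) u : bmeas z -> mulL2 z (a *: u) = a *: mulL2 z u.
Proof.
move=> bz; rewrite -L2classZ; last exact: Lp2_bounded.
apply: L2class_aeq; first exact: Lp2_bounded.
  by apply: Lp2Z; exact: Lp2_bounded.
by apply: aeW01 (L2reprZ a u) => x ->; rewrite mulrCA.
Qed.

Lemma mulL2Dl z w u : bmeas z -> bmeas w -> mulL2 (fun t => z t + w t) u = mulL2 z u + mulL2 w u.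
Proof.
move=> bz bw; rewrite -L2classD; try exact: Lp2_bounded.
apply: L2class_aeq; first by apply: Lp2_bounded => //; exact: bmeasD.
  by apply: Lp2D; exact: Lp2_bounded.
by apply: aeW => x; rewrite mulrDl.
Qed.

Lemma mulL2A z w u : bmeas z -> bmeas w -> mulL2 z (mulL2 w u) = mulL2 (fun t => z t * w t) u.
Proof.
move=> bz bw; apply: L2class_aeq; first exact: Lp2_bounded.
  by apply: Lp2_bounded => //; exact: bmeasM.
by apply: aeW01 (mulL2_repr u bw) => x ->; rewrite mulrA.
Qed.

Lemma mulL2_cst (c : C) u : mulL2 (fun=> c) u = c *: u.
Proof.
rewrite -[in RHS](L2reprK u) -L2classZ//.
Qed.

Lemma mulL2_sum (I : Type) (r : seq I) (F : I -> T -> C) u : (forall i, bmeas (F i)) ->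
  mulL2 (fun t => \sum_(i <- r) F i t) u = \sum_(i <- r) mulL2 (F i) u.
Proof.
move=> bF; elim: r => [|i r IH].
  rewrite big_nil -[RHS](scale0r u) -mulL2_cst; congr mulL2.
  by apply/funext => t; rewrite big_nil.
rewrite big_cons -IH -mulL2Dl//; last exact: bmeas_sum.
by congr mulL2; apply/funext => t; rewrite big_cons.
Qed.

Lemma inner_mulL2 z u v : bmeas z -> inner (mulL2 z u) v = inner u (mulL2 (fun t => (z t)^*) v).
Proof.
move=> bz; rewrite -{1}(L2reprK v) -{2}(L2reprK u).
rewrite /mulL2 !inner_class//; try by apply: Lp2_bounded => //; exact: bmeas_conj.
by congr cint; apply/funext => t; rewrite cconjM conjcK mulrCA mulrA.
Qed.

Lemma nsqE u : nsq u =
  Rintegral mu01 setT (fun x => Re (L2repr u (cis x)) ^+ 2 + Im (L2repr u (cis x)) ^+ 2).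
Proof. exact: Re_innerE. Qed.

Lemma nsq_EFin u : ((nsq u)%:E = \int[mu01]_x
  (Re (L2repr u (cis x)) ^+ 2 + Im (L2repr u (cis x)) ^+ 2)%:E)%E.
Proof.
rewrite nsqE /Rintegral fineK//.
exact: (integrable_fin_num _ (Lp2_int (L2repr_Lp2 u))).
Qed.

Lemma cmeas_sq f : cmeas f -> measurable_fun (setT : set (measurableTypeR R))
  (fun x => (Re (f (cis x)) ^+ 2 + Im (f (cis x)) ^+ 2)%:E).
Proof.
move=> [f1 f2]; apply/measurable_EFinP.
by apply: measurable_funD; exact: measurable_funX.
Qed.

Lemma nsq_mulL2 z : bmeas z -> exists2 M, 0 <= M & forall u, nsq (mulL2 z u) <= M * nsq u.
Proof.
(* M bounds the real and the imaginary part separately, so the squared modulus of z is at most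
   [2 M^2]. *)
move=> bz; have [_ [M zM]] := bz; exists (2 * M ^+ 2); first by rewrite mulr_ge0 ?sqr_ge0.
move=> u; rewrite -lee_fin EFinM !nsq_EFin.
have M2 : 0 <= 2 * M ^+ 2 by rewrite mulr_ge0 ?sqr_ge0.
rewrite -ge0_integralZl//; last 2 first.
- exact: cmeas_sq (Lp_cmeas _).
- by move=> x _; rewrite lee_fin addr_ge0 ?sqr_ge0.
apply: ae_ge0_le_integral => //.
- by move=> x _; rewrite lee_fin addr_ge0 ?sqr_ge0.
- exact: cmeas_sq (Lp_cmeas _).
- by move=> x _; rewrite -EFinM lee_fin mulr_ge0// addr_ge0 ?sqr_ge0.
- by apply: emeasurable_funM => //; exact: cmeas_sq (Lp_cmeas _).
have h : {ae mu01, forall x, `|Re (z (cis x))| <= M /\ `|Im (z (cis x))| <= M}.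
  exact: ae_mu01.
apply: aeW2 h (mulL2_repr u bz) => x [h1 h2] -> _.
rewrite -EFinM lee_fin cReM cImM.
have r1 : Re (z (cis x)) ^+ 2 <= M ^+ 2.
  by rewrite -(real_normK (num_real (Re _))) ler_pXn2r ?nnegrE ?(le_trans _ h1).
have r2 : Im (z (cis x)) ^+ 2 <= M ^+ 2.
  by rewrite -(real_normK (num_real (Im _))) ler_pXn2r ?nnegrE ?(le_trans _ h2).
move: (Re (z _)) (Im (z _)) (Re (L2repr u _)) (Im (L2repr u _)) r1 r2 => a b c d r1 r2.
rewrite (_ : _ + _ = (a ^+ 2 + b ^+ 2) * (c ^+ 2 + d ^+ 2)); last by ring.
by apply: ler_wpM2r; [rewrite addr_ge0 ?sqr_ge0|lra].
Qed.

Lemma bmeas_ptval : bmeas (@ptval R).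
Proof. by apply: bmeas_continuous; exact: initial_continuous. Qed.

Lemma bmeas_ptval_inv : bmeas (fun t : T => (ptval t)^-1).
Proof. exact: (bmeas_ptinv bmeas_ptval). Qed.

Lemma bmeasX z n : bmeas z -> bmeas (fun t => z t ^+ n).
Proof.
move=> bz; elim: n => [|n IH]; first exact: (bmeas_cst 1).
by under eq_fun do rewrite exprS; exact: bmeasM.
Qed.

Lemma bmeas_ptvalX (n : int) : bmeas (fun t : T => ptval t ^ n).
Proof.
case: n => n; first exact: bmeasX bmeas_ptval.
rewrite (_ : (fun t => _) = (fun t : T => (ptval t)^-1 ^+ n.+1)).
  exact: bmeasX bmeas_ptval_inv.
by apply/funext => t; rewrite NegzE exprVn.
Qed.

Lemma Lp2_flip f : f \in Lp 2%:E -> (fun t => (ptval t)^-1 * f (ptinv t)) \in Lp 2%:E.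
Proof. by move=> f2; apply: Lp2_bounded; [exact: bmeas_ptval_inv|exact: Lp2_ptinv]. Qed.

Lemma flip_repr u : aeq (L2repr (flipJ1 u)) (fun t => (ptval t)^-1 * L2repr u (ptinv t)).
Proof. by apply: L2repr_class; exact: Lp2_flip. Qed.

Lemma flipD u v : flipJ1 (u + v) = flipJ1 u + flipJ1 v.
Proof.
rewrite -L2classD; try exact: Lp2_flip.
apply: L2class_aeq; [exact: Lp2_flip|by apply: Lp2D; exact: Lp2_flip|].
by apply: aeW01 (aeq_ptinv (L2reprD u v)) => x ->; rewrite mulrDr.
Qed.

Lemma flipZ (a : C) u : flipJ1 (a *: u) = a *: flipJ1 u.
Proof.
rewrite -L2classZ; last exact: Lp2_flip.
apply: L2class_aeq; [exact: Lp2_flip|by apply: Lp2Z; exact: Lp2_flip|].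
by apply: aeW01 (aeq_ptinv (L2reprZ a u)) => x ->; rewrite mulrCA.
Qed.

Lemma flipK u : flipJ1 (flipJ1 u) = u.
Proof.
rewrite -[RHS]L2reprK; apply: L2class_aeq; [exact: Lp2_flip|by []|].
apply: aeW01 (aeq_ptinv (flip_repr u)) => x ->.
by rewrite ptval_inv invrK ptinvK mulrA mulVf ?mul1r// ptval_neq0.
Qed.

Lemma flip_mulL2 z u : bmeas z -> flipJ1 (mulL2 z u) = mulL2 (fun t => z (ptinv t)) (flipJ1 u).
Proof.
move=> bz; apply: L2class_aeq; [exact: Lp2_flip|by apply: Lp2_bounded => //; exact: bmeas_ptinv|].
apply: aeW2 (aeq_ptinv (mulL2_repr u bz)) (flip_repr u) => x -> ->.
by rewrite mulrCA.
Qed.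

(** The substitution t -> 1/t moves the inversion to the other factor and turns [t^-1] into t, the
    conjugate of [t^-1]. *)
Lemma inner_flip u v : inner (flipJ1 u) v = inner u (flipJ1 v).
Proof.
rewrite -{1}(L2reprK v) -{2}(L2reprK u) /flipJ1 !inner_class//; try exact: Lp2_flip.
rewrite /ip -cint_ptinv; last first.
  by apply: cmeasM; [|apply: cmeas_conj]; apply: Lp_cmeas => //; exact: Lp2_flip.
congr cint; apply/funext => t.
rewrite ptinvK ptval_inv invrK cconjM conjc_inv conj_ptval invrK.
by rewrite mulrA [ptval t * _]mulrC.
Qed.

Lemma nsq_flip u : nsq (flipJ1 u) = nsq u.
Proof. by rewrite /nsq inner_flip flipK. Qed.

Lemma L2_complete (u : nat -> L2) :
  (forall e : R, 0 < e -> exists N, forall m n, (N <= m)%N -> (N <= n)%N ->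
     nsq (u m - u n) <= e) ->
  exists v, forall e : R, 0 < e -> exists N, forall n, (N <= n)%N -> nsq (u n - v) <= e.
Proof.
move=> uC.
pose a n (x : measurableTypeR R) : R := Re (L2repr (u n) (cis x)).
pose b n (x : measurableTypeR R) : R := Im (L2repr (u n) (cis x)).
have ab n : a n \in Lfun mu01 2%:E /\ b n \in Lfun mu01 2%:E.
  by apply/andP; exact: (L2repr_Lp2 (u n)).
have maa n : measurable_fun setT (a n) by exact: Lfun_mes (ab n).1.
have mbb n : measurable_fun setT (b n) by exact: Lfun_mes (ab n).2.
have nsqab m n : ((nsq (u m - u n))%:E =
    \int[mu01]_x ((a m x - a n x) ^+ 2 + (b m x - b n x) ^+ 2)%:E)%E.
  rewrite nsq_EFin; apply: ae_eq_integral => //.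
  - exact: cmeas_sq (Lp_cmeas _).
  - apply/measurable_EFinP.
    by apply: measurable_funD; apply: measurable_funX; exact: measurable_funB.
  - apply: aeW01 (L2reprB (u m) (u n)) => x -> _.
    by rewrite /a /b; case: (L2repr (u m) _) (L2repr (u n) _) => [? ?] [? ?].
have [al [al2 alxy aC]] : exists al, [/\ al \in Lfun mu01 2%:E,
    forall x y, (forall n, a n x = a n y) -> al x = al y &
    forall e : R, 0 < e -> exists N, forall n,
     (N <= n)%N -> (\int[mu01]_x ((a n x - al x) ^+ 2)%:E <= e%:E)%E].
  apply: (Lfun2_complete (@mu01_lty R)) => [n|e e0]; first exact: (ab n).1.
  have [N NP] := uC e e0; exists N => m n Nm Nn.
  apply: le_trans (_ : _ <= (nsq (u m - u n))%:E)%E _; last by rewrite lee_fin NP.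
  rewrite nsqab; apply: ge0_le_integral => //.
  - by move=> x _; rewrite lee_fin sqr_ge0.
  - by apply/measurable_EFinP; apply: measurable_funX; exact: measurable_funB.
  - apply/measurable_EFinP.
    by apply: measurable_funD; apply: measurable_funX; exact: measurable_funB.
  - by move=> x _; rewrite lee_fin lerDl sqr_ge0.
have [be [be2 bexy bC]] : exists al, [/\ al \in Lfun mu01 2%:E,
    forall x y, (forall n, b n x = b n y) -> al x = al y &
    forall e : R, 0 < e -> exists N, forall n,
     (N <= n)%N -> (\int[mu01]_x ((b n x - al x) ^+ 2)%:E <= e%:E)%E].
  apply: (Lfun2_complete (@mu01_lty R)) => [n|e e0]; first exact: (ab n).2.
  have [N NP] := uC e e0; exists N => m n Nm Nn.
  apply: le_trans (_ : _ <= (nsq (u m - u n))%:E)%E _; last by rewrite lee_fin NP.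
  rewrite nsqab; apply: ge0_le_integral => //.
  - by move=> x _; rewrite lee_fin sqr_ge0.
  - by apply/measurable_EFinP; apply: measurable_funX; exact: measurable_funB.
  - apply/measurable_EFinP.
    by apply: measurable_funD; apply: measurable_funX; exact: measurable_funB.
  - by move=> x _; rewrite lee_fin lerDr sqr_ge0.
have cisP (x : R) : exists y : R, cis y = cis x by exists x.
(* Some parameter of t is picked; by [alxy] and [bexy] the value does not depend on which one. *)
pose w (t : T) : C := let x := xget 0 [set y : R | cis y = t] in al x +i* be x.
have wE x : w (cis x) = al x +i* be x.
  rewrite /w; case: xgetP => [y _ /= yx|/(_ x) /= []]; last by [].
  by rewrite (alxy y x)// /a /b => [|n]; [rewrite (bexy y x)// /b => n|]; rewrite yx.
have w2 : w \in Lp 2%:E.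
  rewrite LpP; apply/andP; split; first by under eq_fun do rewrite wE.
  by under eq_fun do rewrite wE.
exists (L2class w) => e e0.
have e2 : 0 < e / 2 by rewrite divr_gt0.
have [N1 N1P] := aC _ e2; have [N2 N2P] := bC _ e2.
exists (maxn N1 N2) => n; rewrite geq_max => /andP[n1 n2].
have mal : measurable_fun setT al by exact: Lfun_mes al2.
have mbe : measurable_fun setT be by exact: Lfun_mes be2.
rewrite -lee_fin nsq_EFin.
rewrite (_ : (\int[mu01]_x _ = \int[mu01]_x (((a n x - al x) ^+ 2)%:E + ((b n x - be x) ^+ 2)%:E))%E).
  rewrite ge0_integralD//; last 4 first.
  - by move=> x _; rewrite lee_fin sqr_ge0.
  - by apply/measurable_EFinP; apply: measurable_funX; exact: measurable_funB.
  - by move=> x _; rewrite lee_fin sqr_ge0.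
  - by apply/measurable_EFinP; apply: measurable_funX; exact: measurable_funB.
  by rewrite [e]splitr EFinD; apply: leeD; [exact: N1P|exact: N2P].
apply: ae_eq_integral => //.
- exact: cmeas_sq (Lp_cmeas _).
- apply/measurable_EFinP.
  by apply: measurable_funD; apply: measurable_funX; exact: measurable_funB.
- apply: aeW2 (L2reprB (u n) (L2class w)) (L2repr_class w2) => x -> -> _.
  by rewrite wE -EFinD /a /b; case: (L2repr (u n) _) => [? ?].
Qed.

End ScalarOps.

(** * Totality of the exponentials *)

Section Exponentials.
Variable R : realType.
Local Notation C := R[i].
Local Notation T := (circle R).
Local Notation mu01 := (mu01 R).
Local Notation L2 := (L2 R).
Implicit Types (f g z w : T -> C) (u v : L2).
Local Hint Resolve L2repr_Lp2 : core.

Lemma bmeas_Lp1 z : bmeas z -> z \in Lp 1.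
Proof.
move=> bz; rewrite (_ : z = fun t => z t * 1); last by apply/funext => t; rewrite mulr1.
by apply: Lp2M; apply: Lp2_bmeas => //; exact: bmeas_cst.
Qed.

(** Over a segment the fundamental theorem of calculus applies; this serves the orthogonality
    relations. *)
Lemma integral_mu01 (f : R -> R) : mu01.-integrable setT (EFin \o f) ->
  (\int[mu01]_x (f x)%:E = \int[lebesgue_measure]_(x in `[0%R, 1%R]) (f x)%:E)%E.
Proof.
move=> fi; have mC : measurable (~` `[0, 1] : set (measurableTypeR R)) by exact: measurableC.
rewrite (negligible_integral mC measurableT fi); last exact: mu01C.
rewrite setTD setCK; apply: eq_measure_integral => A mA A01.
by rewrite mu01E setIidl.
Qed.

Lemma integral_cos (c : R) : c != 0 -> sin c = 0 ->
  (\int[lebesgue_measure]_(x in `[0%R, 1%R]) (cos (c * x))%:E = 0)%E.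
Proof.
move=> c0 sc.
have dF (x : R) : is_derive x 1 (fun x => c^-1 * sin (c * x)) (cos (c * x)).
  have -> : cos (c * x) = c^-1 *: (cos (c * x) * c).
    by rewrite [c^-1 *: _]mulrCA mulVf// mulr1.
  apply: is_deriveZ.
  have h : is_derive x 1 (fun x : R => c * x) c.
    by have := is_deriveZ c (is_derive_id x 1); rewrite [c *: 1]mulr1.
  exact: is_derive1_comp (is_derive_sin _) h.
have cF : continuous (fun x : R => c^-1 * sin (c * x)).
  by move=> x; apply/differentiable_continuous/derivable1_diffP; case: (dF x).
rewrite (@continuous_FTC2 _ _ (fun x => c^-1 * sin (c * x)) 0 1)//.
- by rewrite mulr1 mulr0 sc sin0 mulr0 subee.
- apply: continuous_subspaceT => x; apply: continuous_comp; last exact: continuous_cos.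
  by apply: cvgMr; exact: cvg_id.
- split => [x _| |]; first by case: (dF x).
  + by apply: cvg_at_right_filter; exact: cF.
  + by apply: cvg_at_left_filter; exact: cF.
- by move=> x _; rewrite derive1E; case: (dF x).
Qed.

Lemma integral_sin (c : R) : c != 0 -> cos c = 1 ->
  (\int[lebesgue_measure]_(x in `[0%R, 1%R]) (sin (c * x))%:E = 0)%E.
Proof.
move=> c0 sc.
have dF (x : R) : is_derive x 1 (fun x => - c^-1 * cos (c * x)) (sin (c * x)).
  have -> : sin (c * x) = - c^-1 *: (- sin (c * x) * c).
    by rewrite [- c^-1 *: _]mulrCA [- c^-1 * c]mulNr mulVf// mulrN1 opprK.
  apply: is_deriveZ.
  have h : is_derive x 1 (fun x : R => c * x) c.
    by have := is_deriveZ c (is_derive_id x 1); rewrite [c *: 1]mulr1.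
  exact: is_derive1_comp (is_derive_cos _) h.
have cF : continuous (fun x : R => - c^-1 * cos (c * x)).
  by move=> x; apply/differentiable_continuous/derivable1_diffP; case: (dF x).
rewrite (@continuous_FTC2 _ _ (fun x => - c^-1 * cos (c * x)) 0 1)//.
- by rewrite mulr1 mulr0 sc cos0 subee.
- apply: continuous_subspaceT => x; apply: continuous_comp; last exact: continuous_sin.
  by apply: cvgMr; exact: cvg_id.
- split => [x _| |]; first by case: (dF x).
  + by apply: cvg_at_right_filter; exact: cF.
  + by apply: cvg_at_left_filter; exact: cF.
- by move=> x _; rewrite derive1E; case: (dF x).
Qed.

Lemma cisX (x : R) (n : nat) : ptval (cis x) ^+ n =
  cos (2 * pi * n%:R * x) +i* sin (2 * pi * n%:R * x).
Proof.
elim: n => [|n IH].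
  by rewrite expr0 mulr0 mul0r cos0 sin0.
have -> : 2 * pi * n.+1%:R * x = 2 * pi * n%:R * x + 2 * pi * x.
  by rewrite -natr1; ring.
rewrite exprSr IH cosD sinD /ptval /=; apply/eqP; rewrite eq_complex /=.
by apply/andP; split; apply/eqP; ring.
Qed.

Lemma cint_ptvalX_nat (n : nat) : cint (fun t : T => ptval t ^+ n.+1) = 0.
Proof.
have b := bmeasX n.+1 (bmeas_ptval R).
have [i1 i2] := Lp1_int (bmeas_Lp1 b).
have c0 : 2 * pi * n.+1%:R != 0 :> R by rewrite !mulf_neq0// gt_eqF// pi_gt0.
have [c1 s0] : cos (2 * pi * n.+1%:R) = 1 :> R /\ sin (2 * pi * n.+1%:R) = 0 :> R.
  have := cisX 1 n.+1; rewrite mulr1 => h.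
  have c1 : ptval (cis (1 : R)) = 1.
    by rewrite -[LHS]/(cos (2 * pi * 1) +i* sin (2 * pi * 1)) mulr1 mulr_natl cos2pi sin2pi.
  by move: h; rewrite c1 expr1n => -[<- <-].
apply/eqP; rewrite eq_complex /=; apply/andP; split; apply/eqP.
  rewrite /Rintegral integral_mu01//.
  under eq_integral do rewrite cisX /=.
  by rewrite integral_cos.
rewrite /Rintegral integral_mu01//.
under eq_integral do rewrite cisX /=.
by rewrite integral_sin.
Qed.

Lemma cint1 : cint (fun=> 1 : C) = 1 :> C.
Proof.
rewrite /cint /= !Rintegral_cst//= -[X in fine X]/(mu01 setT) mu01T /= !mul0r mul1r.
by [].
Qed.

Lemma cint_ptvalX (n : int) : cint (fun t : T => ptval t ^ n) = (n == 0)%:R.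
Proof.
case: n => [[|n]|n].
- by rewrite eqxx -[RHS]cint1; congr cint.
- exact: cint_ptvalX_nat.
- rewrite -[RHS](cint_ptvalX_nat n) -[RHS]cint_ptinv.
    by congr cint; apply/funext => t; rewrite NegzE ptval_inv exprVn.
  exact: bmeas_cmeas (bmeasX _ (bmeas_ptval R)).
Qed.

Definition ee (n : int) : L2 := L2class (fun t => ptval t ^ n).

Lemma conj_ptvalX (t : T) (n : int) : conjc (ptval t ^ n) = ptval t ^ (- n).
Proof.
have cX (z : C) (k : nat) : conjc (z ^+ k) = conjc z ^+ k.
  by elim: k => [|k IH]; rewrite ?conjc1// !exprS cconjM IH.
case: n => k.
  by rewrite -[LHS]/(conjc (ptval t ^+ k)) cX conj_ptval exprVn -invr_expz.
by rewrite NegzE opprK -invr_expz conjc_inv cX conj_ptval exprVn invrK.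
Qed.

Lemma fourier_class f n : f \in Lp 2%:E -> fourier f n = inner (L2class f) (ee n).
Proof.
move=> f2; rewrite inner_class//; last by apply: Lp2_bmeas; exact: bmeas_ptvalX.
by congr cint; apply/funext => t; rewrite conj_ptvalX.
Qed.

Lemma fourierE u n : fourier (L2repr u) n = inner u (ee n).
Proof. by rewrite fourier_class// L2reprK. Qed.

Lemma ee_orthonormal m n : inner (ee m) (ee n) = (m == n)%:R.
Proof.
rewrite inner_class; try by apply: Lp2_bmeas; exact: bmeas_ptvalX.
rewrite -subr_eq0 -cint_ptvalX; congr cint; apply/funext => t.
by rewrite conj_ptvalX -expfzDr// ptval_neq0.
Qed.

Lemma mulL2_class z f : bmeas z -> f \in Lp 2%:E ->
  mulL2 z (L2class f) = L2class (fun t => z t * f t).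
Proof.
move=> bz f2; apply: L2class_aeq; try exact: Lp2_bounded.
by apply: aeW01 (L2repr_class f2) => x ->.
Qed.

Lemma mulL2_ptvalX_ee m n : mulL2 (fun t => ptval t ^ m) (ee n) = ee (m + n).
Proof.
rewrite mulL2_class; [|exact: bmeas_ptvalX|by apply: Lp2_bmeas; exact: bmeas_ptvalX].
by congr L2class; apply/funext => t; rewrite expfzDr// ptval_neq0.
Qed.

Lemma flip_ee n : flipJ1 (ee n) = ee (- 1 - n).
Proof.
apply: L2class_aeq.
- exact: Lp2_flip.
- by apply: Lp2_bmeas; exact: bmeas_ptvalX.
- have e2 : (fun t : T => ptval t ^ n) \in Lp 2%:E.
    by apply: Lp2_bmeas; exact: bmeas_ptvalX.
  apply: aeW01 (aeq_ptinv (L2repr_class e2)) => x ->.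
  by rewrite ptval_inv expfzDr ?ptval_neq0// -exprz_inv.
Qed.

Lemma inner_mulL2_ee z u m n : bmeas z -> inner (mulL2 z (ee m)) (ee n) = fourier z (n - m).
Proof.
move=> bz; rewrite mulL2_class//; last by apply: Lp2_bmeas; exact: bmeas_ptvalX.
rewrite -fourier_class; last by apply: Lp2_bmeas; apply: bmeasM => //; exact: bmeas_ptvalX.
congr cint; apply/funext => t; rewrite -mulrA -expfzDr ?ptval_neq0//.
by rewrite opprB addrC.
Qed.

End Exponentials.

(** * Polynomials approximating a jump at 1/2 *)

Section StepPolynomials.
Variable R : realType.
Implicit Types (r s y : R).

Lemma bernoulli_sub r n : 0 <= r <= 1 -> 1 - n%:R * r <= (1 - r) ^+ n.
Proof.
move=> /andP[r0 r1]; elim: n => [|n IH]; first by rewrite mul0r subr0 expr0.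
have h : (1 - n%:R * r) * (1 - r) <= (1 - r) ^+ n * (1 - r).
  by apply: ler_wpM2r => //; rewrite subr_ge0.
rewrite exprSr; apply: le_trans h; rewrite -natr1.
have : 0 <= n%:R * r * r by rewrite !mulr_ge0.
lra.
Qed.

Lemma bernoulli_add r n : 0 <= r -> 1 + n%:R * r <= (1 + r) ^+ n.
Proof.
move=> r0; elim: n => [|n IH]; first by rewrite mul0r addr0 expr0.
have h : (1 + n%:R * r) * (1 + r) <= (1 + r) ^+ n * (1 + r).
  by apply: ler_wpM2r => //; rewrite addr_ge0.
rewrite exprSr; apply: le_trans h; rewrite -natr1.
have : 0 <= n%:R * r * r by rewrite !mulr_ge0.
lra.
Qed.

(** Each of the k terms of [1 + s + ... + s^(k-1)] is at least [s^k], and the sum times [1 - s] is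
    [1 - s^k]. *)
Lemma natr_expr_le s k : 0 <= s <= 1 -> k%:R * s ^+ k * (1 - s) <= 1 - s ^+ k.
Proof.
move=> /andP[s0 s1]; elim: k => [|k IH]; first by rewrite !mul0r expr0 subrr.
have sk0 : 0 <= s ^+ k.+1 by exact: exprn_ge0.
have sk1 : s ^+ k.+1 <= 1 by exact: exprn_ile1.
have h : s * (k%:R * s ^+ k * (1 - s)) <= s * (1 - s ^+ k) by apply: ler_wpM2l.
rewrite -natr1 mulrDl mul1r mulrDl.
have -> : k%:R * s ^+ k.+1 * (1 - s) = s * (k%:R * s ^+ k * (1 - s)).
  by rewrite exprS; ring.
have h2 : s ^+ k.+1 * (1 - s) <= 1 - s by rewrite ler_piMl// subr_ge0.
have h3 : s * (1 - s ^+ k) = s - s ^+ k.+1 by rewrite exprS; ring.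
lra.
Qed.

Lemma cvg_natr_expr r : 0 <= r < 1 -> (fun k => k%:R * r ^+ k) @ \oo --> (0 : R).
Proof.
(* One square root absorbs the factor k, the other tends to 0:
   [k r^k = (k s^k) s^k <= s^k / (1 - s)]. *)
move=> /andP[r0 r1]; pose s := Num.sqrt r.
have s0 : 0 <= s by exact: sqrtr_ge0.
have sr : s ^+ 2 = r by rewrite sqr_sqrtr.
have s1 : s < 1 by rewrite -[1]sqrtr1 ltr_sqrt// ltr01.
have d0 : 0 < 1 - s by rewrite subr_gt0.
have h : geometric (1 - s)^-1 s @ \oo --> (0 : R) by apply: cvg_geometric; rewrite ger0_norm.
apply: (squeeze_cvgr _ (cvg_cst 0) h); apply: nearW => k; apply/andP; split.
  by rewrite mulr_ge0// exprn_ge0.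
rewrite -sr -exprM mulnC exprM expr2 mulrA /geometric /=.
apply: ler_wpM2r; first exact: exprn_ge0.
rewrite -[leRHS]mul1r ler_pdivlMr//.
have := @natr_expr_le s k; rewrite s0 (ltW s1) => /(_ isT) /le_trans; apply.
by rewrite gerBl exprn_ge0.
Qed.

(* The usual Stone-Weierstrass exponent 2^k carries an extra factor k to make the
   limit 0 also at y = 1/2, where (1 - 2^-k)^(2^k) tends to 1/e. *)
Definition step_poly (k : nat) y : R := (1 - y ^+ k) ^+ (k * 2 ^ k).

Lemma step_poly_01 k y : 0 <= y <= 1 -> 0 <= step_poly k y <= 1.
Proof.
move=> /andP[y0 y1]; have h : 0 <= 1 - y ^+ k <= 1.
  by rewrite subr_ge0 exprn_ile1//= gerBl exprn_ge0.
by case/andP: h => h0 h1; rewrite exprn_ge0//= exprn_ile1.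
Qed.

Lemma cvg_step_poly y : 0 <= y <= 1 -> (fun k => step_poly k y) @ \oo --> ((y < 1/2)%R%:R : R).
Proof.
move=> y01; have /andP[y0 y1] := y01.
have yk k : 0 <= y ^+ k <= 1 by rewrite exprn_ge0//= exprn_ile1.
case: ltrP => y2; rewrite /= ?mulr1n ?mulr0n.
  (* Below 1/2, Bernoulli's inequality with exponent [k 2^k] bounds the polynomial from below by
     [1 - k (2y)^k]. *)
  have h : (fun k => 1 - k%:R * (2 * y) ^+ k) @ \oo --> (1 : R).
    rewrite -[X in _ --> X]subr0; apply: cvgB; first exact: cvg_cst.
    by apply: cvg_natr_expr; rewrite mulr_ge0//=; lra.
  have h1 : (fun _ : nat => 1 : R) @ \oo --> (1 : R) by exact: cvg_cst.
  apply: (squeeze_cvgr _ h h1); apply: nearW => k; apply/andP; split.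
    apply: le_trans (bernoulli_sub _ (yk k)).
    by rewrite natrM natrX exprMn mulrA.
  by case/andP: (step_poly_01 k y01).
(* From 1/2 on, with [n = k 2^k]: [(1 + y^k)^n >= 1 + k (2y)^k >= 1 + k], while [(1 - y^k)^n (1 +
   y^k)^n = (1 - y^(2k))^n <= 1]. *)
have h : (fun k => (k.+1%:R)^-1) @ \oo --> (0 : R) by exact: cvg_harmonic.
apply: (squeeze_cvgr _ (cvg_cst 0) h); apply: nearW => k; apply/andP; split.
  by case/andP: (step_poly_01 k y01).
have /andP[yk0 yk1] := yk k.
rewrite -[leRHS]mul1r ler_pdivlMr// /step_poly; set n := (k * 2 ^ k)%N.
apply: (@le_trans _ _ ((1 - y ^+ k) ^+ n * (1 + y ^+ k) ^+ n)).
  apply: ler_wpM2l; first by rewrite exprn_ge0// subr_ge0.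
  apply: le_trans (bernoulli_add n yk0); rewrite -natr1 addrC lerD2l.
  rewrite /n natrM natrX -mulrA -exprMn ler_peMr//.
  by apply: exprn_ege1; lra.
rewrite -exprMn exprn_ile1//.
  by rewrite mulr_ge0 ?subr_ge0 ?addr_ge0.
have : 0 <= y ^+ k * y ^+ k by exact: mulr_ge0.
lra.
Qed.

End StepPolynomials.

Section Total.
Variable R : realType.
Local Notation C := R[i].
Local Notation T := (circle R).
Local Notation mu01 := (mu01 R).
Local Notation L2 := (L2 R).
Implicit Types (f g z w : T -> C) (u v : L2).
Local Hint Resolve L2repr_Lp2 : core.

Definition coefs_vanish u := forall n, inner u (ee R n) = 0.

(* The functions whose multiplication operator preserves the annihilator of all
   trigonometric polynomials form an algebra containing t and t^-1. *)
Definition stab z := bmeas z /\ forall u, coefs_vanish u -> coefs_vanish (mulL2 z u).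

Lemma stab_cst (c : C) : stab (fun=> c).
Proof.
split; first exact: bmeas_cst.
by move=> u u0 n; rewrite mulL2_cst innerZl u0 mulr0.
Qed.

Lemma stabD z w : stab z -> stab w -> stab (fun t => z t + w t).
Proof.
move=> [bz sz] [bw sw]; split; first exact: bmeasD.
by move=> u u0 n; rewrite mulL2Dl// innerDl (sz _ u0) (sw _ u0) addr0.
Qed.

Lemma stabM z w : stab z -> stab w -> stab (fun t => z t * w t).
Proof.
move=> [bz sz] [bw sw]; split; first exact: bmeasM.
by move=> u u0 n; rewrite -mulL2A// sz//; exact: sw.
Qed.

Lemma stabX z n : stab z -> stab (fun t => z t ^+ n).
Proof.
move=> sz; elim: n => [|n IH]; first exact: (stab_cst 1).
by under eq_fun do rewrite exprS; exact: stabM.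
Qed.

Lemma stab_ptvalX (m : int) : stab (fun t => ptval t ^ m).
Proof.
split; first exact: bmeas_ptvalX.
move=> u u0 n; rewrite inner_mulL2; last exact: bmeas_ptvalX.
rewrite (_ : (fun t => _) = (fun t : T => ptval t ^ (- m))); last first.
  by apply/funext => t; exact: conj_ptvalX.
by rewrite mulL2_ptvalX_ee.
Qed.

(** Read off from the zeroth coefficient of [z u]; z being real, it separates into the two
    integrals. *)
Lemma stab_int0 z (q : R -> R) u : stab z -> (forall x, z (cis x) = (q x)%:C) ->
  coefs_vanish u ->
  Rintegral mu01 setT (fun x => q x * Re (L2repr u (cis x))) = 0 /\
  Rintegral mu01 setT (fun x => q x * Im (L2repr u (cis x))) = 0.
Proof.
move=> [bz sz] zq u0; have := sz u u0 0.
rewrite -fourierE /fourier (cint_aeq (g := fun t => z t * L2repr u t)); first last.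
- by apply: aeW01 (mulL2_repr u bz) => x ->; rewrite oppr0 mulr1.
- by apply: cmeasM; [exact: bmeas_cmeas|exact: Lp_cmeas].
- by apply: cmeasM; [exact: Lp_cmeas|exact: bmeas_cmeas (bmeas_ptvalX _ _)].
rewrite /cint => -[h1 h2]; split.
  rewrite -[RHS]h1; apply: eq_Rintegral => x _.
  by rewrite zq cReM /= mul0r subr0.
rewrite -[RHS]h2; apply: eq_Rintegral => x _.
by rewrite zq cImM /= mul0r addr0.
Qed.

(** The endpoint 1 has to be discarded: functions of [cis x] agree at 0 and 1, so they cannot follow
    the indicator of [a < x] at both when [0 <= a < 1]. *)
Lemma ae_mu01_co (P : R -> Prop) : (forall x, 0 <= x < 1 -> P x) ->
  {ae mu01, forall x, P x}.
Proof.
move=> h; exists (~` `[0, 1[); split.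
- exact: measurableC.
- rewrite mu01E (_ : _ `&` _ = [set 1]) ?lebesgue_measure_set1//.
  apply/seteqP; split => x /=; rewrite !in_itv/=.
    by move=> [/negP + /andP[x0 x1]]; rewrite x0 /= -leNgt => ?; apply/eqP; rewrite eq_le x1.
  by move=> ->; rewrite ltxx andbF lexx ler01.
- by move=> x /= nP; rewrite in_itv /= => x01; apply: nP; exact: h.
Qed.

(** The arc of parameters ]a, 1[ has midpoint (1 + a)/2 and angular half-width pi (1 - a); a point
    belongs to it when the cosine of its angle to the midpoint exceeds that of the half-width. *)
Lemma cos_ray (a x : R) : 0 <= a < 1 -> 0 <= x < 1 ->
  (cos (pi * (1 - a)) < cos (2 * pi * x - 2 * pi * ((1 + a) / 2))) = (a < x).
Proof.
move=> /andP[a0 a1] /andP[x0 x1].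
have p0 : 0 < pi :> R := pi_gt0 R.
have -> : 2 * pi * x - 2 * pi * ((1 + a) / 2) = pi * (2 * x - 1 - a) by field.
have ina (t : R) : 0 <= t <= 1 -> pi * t \in `[0, pi].
  move=> /andP[t0 t1]; rewrite in_itv /= mulr_ge0 ?(ltW p0)//=.
  by rewrite -[leRHS]mulr1 ler_pM2l.
have [x1a|x1a] := lerP (1 + a) (2 * x).
  rewrite ltr_cos; try by apply: ina; lra.
  by rewrite ltr_pM2l//; apply/idP/idP; lra.
rewrite -[cos (pi * (2 * x - 1 - a))]cosN -mulrN.
have [x2a|x2a] := lerP a (2 * x).
  rewrite ltr_cos; try by apply: ina; lra.
  by rewrite ltr_pM2l//; apply/idP/idP; lra.
(* The angle exceeds pi here; parity and periodicity bring it back to where cos is decreasing. *)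
have -> : pi * - (2 * x - 1 - a) = - (pi * (1 - a + 2 * x)) + pi *+ 2.
  by rewrite mulr2n; ring.
rewrite cosD2pi cosN ltr_cos; try by apply: ina; lra.
by rewrite ltr_pM2l//; apply/idP/idP; lra.
Qed.

(* For 0 <= a < 1 the arc {cis x : a < x < 1} is cut out by a trigonometric
   polynomial of degree one, [yc], being smaller than 1/2 there. *)
Lemma stab_ray (a : R) : exists (z : nat -> T -> C) (q : nat -> R -> R),
  [/\ forall k, stab (z k), forall k x, z k (cis x) = (q k x)%:C,
      forall k x, 0 <= q k x <= 1 &
      forall x, 0 <= x < 1 -> q ^~ x @ \oo --> ((a < x)%R%:R : R)].
Proof.
have [a0|a0] := ltrP a 0.
  exists (fun _ _ => 1), (fun _ _ => 1); split => //.
  - by move=> _; exact: stab_cst.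
  - by move=> k x; rewrite ler01 lexx.
  - by move=> x /andP[x0 _]; rewrite (lt_le_trans a0 x0); exact: cvg_cst.
have [a1|a1] := lerP 1 a.
  exists (fun _ _ => 0), (fun _ _ => 0); split => //.
  - by move=> _; exact: stab_cst.
  - by move=> k x; rewrite ler01 lexx.
  - by move=> x /andP[_ x1]; rewrite ltNge (le_trans (ltW x1) a1); exact: cvg_cst.
pose c := (1 + a) / 2; pose d : R := cos (pi * (1 - a)).
(* Division by 4 keeps the values in [0, 1], and [yr x < 1/2] means that the cosine exceeds d. In
   [yc] the cosine is half a sum of two exponentials, whence the coefficients -1/8. *)
pose yr (x : R) : R := 1 / 2 + (d - cos (2 * pi * x - 2 * pi * c)) / 4.
pose wc := ptval (cis c).
pose yc (t : T) : C := (1 / 2 + d / 4)%:C +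
  ((- 1 / 8)%:C * wc^-1 * ptval t ^ 1 + (- 1 / 8)%:C * wc * ptval t ^ (- 1)).
have ycE x : yc (cis x) = (yr x)%:C.
  rewrite /yc /yr exprN1 expr1z -!conj_ptval cosB /wc.
  rewrite -[ptval (cis x)]/(cos (2 * pi * x) +i* sin (2 * pi * x)).
  rewrite -[ptval (cis c)]/(cos (2 * pi * c) +i* sin (2 * pi * c)).
  by apply/eqP; rewrite eq_complex /=; apply/andP; split; apply/eqP; field.
have sy : stab yc.
  apply: stabD; first exact: stab_cst.
  by apply: stabD; apply: stabM; (exact: stab_cst || exact: stab_ptvalX).
have y01 x : 0 <= yr x <= 1.
  rewrite /yr /d; have := cos_le1 (pi * (1 - a)); have := cos_geN1 (pi * (1 - a)).
  have := cos_le1 (2 * pi * x - 2 * pi * c); have := cos_geN1 (2 * pi * x - 2 * pi * c).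
  by move=> *; lra.
exists (fun k t => (1 + (-1) * yc t ^+ k) ^+ (k * 2 ^ k)), (fun k x => step_poly k (yr x)).
split.
- move=> k; apply: stabX; apply: stabD; first exact: stab_cst.
  by apply: stabM; [exact: stab_cst|exact: stabX].
- by move=> k x; rewrite ycE mulN1r /step_poly !(rmorphXn, rmorphB, rmorph1).
- by move=> k x; exact: step_poly_01.
- move=> x x01; have := cvg_step_poly (y01 x).
  have -> // : (yr x < 1 / 2) = (a < x).
  by rewrite -(cos_ray _ x01) ?a0//; apply/idP/idP; rewrite /yr /d; lra.
Qed.

(** Dominated convergence, with the modulus of f as dominating function. *)
Lemma ray_int0 (f : R -> R) (a : R) (q : nat -> R -> R) :
  mu01.-integrable setT (EFin \o f) ->
  (forall k, measurable_fun (setT : set (measurableTypeR R)) (q k)) ->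
  (forall k x, 0 <= q k x <= 1) ->
  (forall x, 0 <= x < 1 -> q ^~ x @ \oo --> ((a < x)%R%:R : R)) ->
  (forall k, Rintegral mu01 setT (fun x => q k x * f x) = 0) ->
  (\int[mu01]_(x in `]a, +oo[) (f x)%:E = 0)%E.
Proof.
move=> fi mq q01 qa q0; have mf := measurable_int _ fi.
have mf' : measurable_fun (setT : set (measurableTypeR R)) f by exact/measurable_EFinP.
have qint k : mu01.-integrable setT (fun x => (q k x * f x)%:E).
  apply: le_integrable fi => //.
    by apply/measurable_EFinP; exact: measurable_funM.
  move=> x _; rewrite lee_fin normrM ler_piMl//.
  by have /andP[? ?] := q01 k x; rewrite ger0_norm.
have mA : measurable (`]a, +oo[ : set (measurableTypeR R)) by exact: measurable_itv.
rewrite integral_mkcond.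
have E x : ((fun x => (f x)%:E) \_ `]a, +oo[) x = ((a < x)%R%:R * f x)%:E.
  by rewrite /patch mem_setE in_itv /= andbT; case: ifP => _; rewrite ?mul1r ?mul0r.
under eq_integral do rewrite E.
have [] := @dominated_convergence _ _ _ mu01 setT measurableT
  (fun k x => (q k x * f x)%:E) (fun x => ((a < x)%R%:R * f x)%:E)
  (fun x => `|(f x)%:E|%E).
- by move=> k; apply: measurable_int (qint k).
- under eq_fun do rewrite -E.
  by apply/(measurable_restrictT _ mA); exact: measurable_funTS mf.
- apply: ae_mu01_co => x x01 _; apply: cvg_EFin; first exact: nearW.
  by apply: cvgMl; exact: qa.
- exact: integrable_abse.
- apply: aeW => x k _; rewrite /= lee_fin normrM ler_piMl//.
  by have /andP[? ?] := q01 k x; rewrite ger0_norm.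
move=> _ _; rewrite (_ : (fun n => _) = cst 0%E); last first.
  apply/funext => k /=; rewrite -[LHS]fineK ?(integrable_fin_num _ (qint k))//.
  by rewrite -[X in X%:E]/(Rintegral _ _ _) q0.
by move/(cvg_unique _ (cvg_cst 0%E)) => <-.
Qed.

Theorem coefs_vanish_eq0 u : coefs_vanish u -> u = 0.
Proof.
move=> u0.
have u1 : L2repr u \in Lp 1.
  rewrite (_ : L2repr u = fun t => L2repr u t * 1); last by apply/funext => t; rewrite mulr1.
  by apply: Lp2M => //; apply: Lp2_bmeas; exact: bmeas_cst.
have [i1 i2] := Lp1_int u1.
have s1 := stab_int0 (q := fun=> 1) (stab_cst 1) (fun _ => erefl) u0.
have q_meas (z : T -> C) (q : R -> R) : stab z -> (forall x, z (cis x) = (q x)%:C) ->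
    measurable_fun (setT : set (measurableTypeR R)) q.
  move=> [[[z1 _] _] _] zq; move: z1.
  by rewrite (_ : (fun x => _) = q)//; apply/funext => x; rewrite zq.
have H1 : {ae mu01, forall x, Re (L2repr u (cis x)) = 0}.
  apply: ae_eq0_of_rays => //.
    rewrite -[LHS]fineK ?(integrable_fin_num _ i1)//.
    by congr EFin; rewrite -[RHS]s1.1; apply: eq_Rintegral => x _; rewrite mul1r.
  move=> a; have [z [q [sz zq q01 qa]]] := stab_ray a.
  apply: (ray_int0 i1 _ q01 qa) => k; first exact: q_meas (sz k) (zq k).
  exact: (stab_int0 (sz k) (zq k) u0).1.
have H2 : {ae mu01, forall x, Im (L2repr u (cis x)) = 0}.
  apply: ae_eq0_of_rays => //.
    rewrite -[LHS]fineK ?(integrable_fin_num _ i2)//.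
    by congr EFin; rewrite -[RHS]s1.2; apply: eq_Rintegral => x _; rewrite mul1r.
  move=> a; have [z [q [sz zq q01 qa]]] := stab_ray a.
  apply: (ray_int0 i2 _ q01 qa) => k; first exact: q_meas (sz k) (zq k).
  exact: (stab_int0 (sz k) (zq k) u0).2.
apply/L2_eqP; apply: aeq_trans _ (aeq_sym (@L2repr0 R)).
by apply: aeW2 H1 H2 => x; case: (L2repr u (cis x)) => a b /= -> ->.
Qed.

End Total.

(** * Orthogonal projections and Fourier coefficients *)

Section Projection.
Variable R : realType.
Local Notation C := R[i].
Local Notation T := (circle R).
Local Notation L2 := (L2 R).
Local Notation ee := (ee R).
Implicit Types (f z w : T -> C) (u v g h : L2).

Definition sqmod (c : C) : R := Re c ^+ 2 + Im c ^+ 2.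

Lemma sqmod_ge0 c : 0 <= sqmod c.
Proof. by rewrite addr_ge0 ?sqr_ge0. Qed.

Lemma sqmod_eq0 c : sqmod c = 0 -> c = 0.
Proof.
move=> /eqP; rewrite /sqmod paddr_eq0 ?sqr_ge0// !sqrf_eq0 => /andP[/eqP a0 /eqP b0].
by case: c a0 b0 => a b /= -> ->.
Qed.

Lemma sqmod_conj c : c * conjc c = (sqmod c)%:C.
Proof.
rewrite /sqmod; case: c => a b; apply/eqP; rewrite eq_complex /=.
by apply/andP; split; apply/eqP; ring.
Qed.

Lemma nsqB u v : nsq (u - v) = nsq u + nsq v - 2 * Re (inner u v).
Proof.
rewrite /nsq !innerBl !innerBr (inner_conj u v).
by case: (inner u u) (inner u v) (inner v v) => [? ?] [? ?] [? ?] /=; ring.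
Qed.

Lemma nsqD_orth u v : inner u v = 0 -> nsq (u + v) = nsq u + nsq v.
Proof.
move=> uv; rewrite /nsq !innerDl !innerDr (inner_conj u v) uv conjc0 addr0 add0r.
by case: (inner u u) (inner v v) => [? ?] [? ?].
Qed.

Lemma cauchy_schwarz u v : sqmod (inner u v) <= nsq u * nsq v.
Proof.
have [v0|v0] := eqVneq (nsq v) 0.
  by rewrite (nsq_eq0 v0) inner0r /sqmod /= expr0n addr0 mulr_ge0 ?nsq_ge0.
have v_gt0 : 0 < nsq v by rewrite lt_neqAle eq_sym v0 nsq_ge0.
(* This is [nsq v] times the component of u orthogonal to v; its square carries a spare factor
   [nsq v], cancelled at the end. *)
have := nsq_ge0 ((nsq v)%:C *: u - inner u v *: v).
rewrite nsqB !nsqZ innerZl innerZr /sqmod.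
move: (inner u v) (nsq u) (nsq v) v_gt0 => [x y] b c c0 /= h.
have : 0 <= c * (b * c - (x ^+ 2 + y ^+ 2)) by lra.
by rewrite pmulr_rge0// subr_ge0.
Qed.

Section Orthonormal.
Variable e : nat -> L2.
Hypothesis e_on : forall i j, inner (e i) (e j) = (i == j)%:R.
Variable u : L2.

Let c k := inner u (e k).
Let S n := \sum_(0 <= k < n) c k *: e k.

Lemma inner_psum n k : inner (S n) (e k) = if (k < n)%N then c k else 0.
Proof.
rewrite /S inner_suml; under eq_bigr do rewrite innerZl e_on.
rewrite big_mkord; case: ltnP => kn.
  rewrite (bigD1 (Ordinal kn))//= eqxx mulr1 big1 ?addr0// => i /eqP ik.
  by case: eqP => [h|_]; [case: ik; exact: val_inj|rewrite mulr0].
by apply: big1 => i _; case: eqP => [h|_]; [move: (ltn_ord i); rewrite h ltnNge kn|rewrite mulr0].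
Qed.

Lemma inner_psum0 n h : (forall k, inner h (e k) = 0) -> inner (S n) h = 0.
Proof.
move=> h0; rewrite /S inner_suml big1// => k _.
by rewrite innerZl inner_conj h0 conjc0 mulr0.
Qed.

Lemma nsq_psum n : nsq (S n) = \sum_(0 <= k < n) sqmod (c k).
Proof.
elim: n => [|n IH].
  by rewrite /S !big_geq// /nsq inner0l.
rewrite big_nat_recr//= -IH /S big_nat_recr//= nsqD_orth.
  by congr (_ + _); rewrite nsqZ /nsq e_on eqxx mulr1.
by rewrite innerZr inner_psum ltnn mulr0.
Qed.

Lemma inner_u_psum n : inner u (S n) = (\sum_(0 <= k < n) sqmod (c k))%:C.
Proof.
rewrite inner_conj /S inner_suml raddf_sum [RHS]raddf_sum; apply: eq_bigr => k _.
rewrite -[LHS]/(conjc (inner (c k *: e k) u)) -[RHS]/((sqmod (c k))%:C).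
by rewrite innerZl [inner (e k) u]inner_conj -/(c k) sqmod_conj conjc_real.
Qed.

Lemma bessel n : \sum_(0 <= k < n) sqmod (c k) <= nsq u.
Proof.
have := nsq_ge0 (u - S n); rewrite nsqB inner_u_psum nsq_psum /=; lra.
Qed.

Lemma nsq_psumB m n : (n <= m)%N ->
  nsq (S m - S n) = \sum_(0 <= k < m) sqmod (c k) - \sum_(0 <= k < n) sqmod (c k).
Proof.
move=> nm; have -> : nsq (S m - S n) = \sum_(n <= k < m) sqmod (c k).
  elim: m nm => [|m IH]; first by rewrite leqn0 => /eqP ->; rewrite subrr /nsq inner0l big_geq.
  rewrite leq_eqVlt => /predU1P[->|]; first by rewrite subrr /nsq inner0l big_geq.
  rewrite ltnS => nm; rewrite big_nat_recr//= -IH//.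
  have -> : S m.+1 - S n = (S m - S n) + c m *: e m.
    by rewrite /S big_nat_recr//= addrAC.
  rewrite nsqD_orth ?nsqZ; first by rewrite {2}/nsq e_on eqxx mulr1.
  by rewrite innerZr innerBl !inner_psum ltnn ltnNge nm /= subrr mulr0.
by rewrite [\sum_(0 <= k < m) _](@big_cat_nat _ _ _ n)//= addrAC subrr add0r.
Qed.

Lemma psum_cauchy (eps : R) : 0 < eps -> exists N, forall m n, (N <= m)%N -> (N <= n)%N ->
  nsq (S m - S n) <= eps.
Proof.
move=> eps0; pose a n := \sum_(0 <= k < n) sqmod (c k).
have nda : nondecreasing_seq a.
  by apply: nondecreasing_series => k _ _; exact: sqmod_ge0.
have ca : cvgn a.
  by apply: nondecreasing_is_cvgn => //; exists (nsq u) => _ [n _ <-]; exact: bessel.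
have ale n : a n <= limn a by exact: nondecreasing_cvgn_le.
have /cvgrPdist_le/(_ _ eps0)[N _ NP] := ca.
have {}NP n : (N <= n)%N -> limn a - a n <= eps.
  by move=> /NP /=; apply: le_trans; exact: ler_norm.
have H m n : (N <= n)%N -> (n <= m)%N -> nsq (S m - S n) <= eps.
  move=> Nn nm; rewrite nsq_psumB//.
  by apply: le_trans (NP n Nn); rewrite lerD2r; exact: ale.
exists N => m n Nm Nn; have [nm|/ltnW mn] := leqP n m; first exact: H.
have -> : nsq (S m - S n) = nsq (S n - S m); last exact: H.
by rewrite -opprB -scaleN1r nsqZ /= sqrrN expr1n oppr0 expr0n addr0 mul1r.
Qed.

(** The partial sums are Cauchy by Bessel. The second property replaces membership in the closed
    span: it expresses that g lies in the double orthogonal complement of the [e k]. *)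
Lemma orthonormal_projection : exists g,
  (forall k, inner g (e k) = c k) /\
  (forall h, (forall k, inner h (e k) = 0) -> inner g h = 0).
Proof.
have [g gP] := L2_complete psum_cauchy; exists g.
(* Weak continuity in the only form required: all the inner products concerned are eventually
   constant. *)
have key h d n0 : (forall n, (n0 <= n)%N -> inner (S n) h = d) -> inner g h = d.
  move=> Sd; apply/esym/eqP; rewrite -subr_eq0; apply/eqP/sqmod_eq0/eqP.
  rewrite eq_le sqmod_ge0 andbT leNgt; apply/negP => d0.
  set D := sqmod (d - inner g h) in d0 *.
  have h1 : 0 < 1 + nsq h by rewrite ltr_wpDr ?nsq_ge0.
  (* With this precision Cauchy-Schwarz yields [D <= D / 2], a contradiction; the 1 guards against
     [nsq h = 0]. *)
  have [N NP] := gP (D / (2 * (1 + nsq h))) (divr_gt0 d0 (mulr_gt0 (ltr0Sn R 1) h1)).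
  have := NP (maxn N n0) (leq_maxl _ _); set s := nsq _ => sle.
  have := cauchy_schwarz (S (maxn N n0) - g) h.
  rewrite innerBl Sd ?leq_maxr// -/D -/s => Ds.
  have h0 := nsq_ge0 h.
  have : s * nsq h <= D / (2 * (1 + nsq h)) * (1 + nsq h).
    apply: ler_pM => //; first exact: nsq_ge0.
    by rewrite lerDr.
  rewrite invfM mulrA -mulrA mulVf ?gt_eqF// mulr1; lra.
split=> [k|h h0].
  by apply: (key _ _ k.+1) => n kn; rewrite inner_psum kn.
by apply: (key _ _ 0%N) => n _; exact: inner_psum0.
Qed.

End Orthonormal.

Lemma coefs_inj u v : (forall n, inner u (ee n) = inner v (ee n)) -> u = v.
Proof.
move=> h; apply/eqP; rewrite -subr_eq0; apply/eqP/coefs_vanish_eq0 => n.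
by rewrite innerBl h subrr.
Qed.

(** The two halves of the exponentials as sequences, the second starting at -1, in the form
    [orthonormal_projection] expects. *)
Let epos (k : nat) := ee k%:Z.
Let eneg (k : nat) := ee (- 1 - k%:Z).

Lemma epos_on i j : inner (epos i) (epos j) = (i == j)%:R.
Proof. by rewrite ee_orthonormal. Qed.

Lemma eneg_on i j : inner (eneg i) (eneg j) = (i == j)%:R.
Proof. by rewrite ee_orthonormal; congr (_ %:R : C); congr nat_of_bool; apply/eqP/eqP; lia. Qed.

Lemma coef_proj u n : inner (projP1 u) (ee n) = if 0 <= n then inner u (ee n) else 0.
Proof.
rewrite /projP1; case: xgetP => [g _ /= /(_ n)|]; first by rewrite !fourierE.
(* Existence of the class sought by [xget]: the exponentials of negative index are orthogonal to all
   [epos k], hence to the projection. *)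
have [g [g1 g2]] := orthonormal_projection epos_on u.
move=> /(_ g) []; move=> m; rewrite !fourierE.
case: m => m /=; first exact: g1.
by apply: g2 => k; rewrite ee_orthonormal.
Qed.

Lemma projD u v : projP1 (u + v) = projP1 u + projP1 v.
Proof.
apply: coefs_inj => n; rewrite innerDl !coef_proj innerDl.
by case: ifP => // _; rewrite addr0.
Qed.

Lemma projZ (a : C) u : projP1 (a *: u) = a *: projP1 u.
Proof.
apply: coefs_inj => n; rewrite innerZl !coef_proj innerZl.
by case: ifP => // _; rewrite mulr0.
Qed.

Lemma projK u : projP1 (projP1 u) = projP1 u.
Proof. by apply: coefs_inj => n; rewrite !coef_proj; case: (0 <= n). Qed.

Lemma coef_flip u n : inner (flipJ1 u) (ee n) = inner u (ee (- 1 - n)).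
Proof. by rewrite inner_flip flip_ee. Qed.

(** The factor [t^-1] in J makes it act on indices by n -> -1 - n, which exchanges n >= 0 and n < 0
    with no index left over. *)
Lemma proj_flip u : projP1 (flipJ1 u) = flipJ1 (u - projP1 u).
Proof.
apply: coefs_inj => n; rewrite coef_flip innerBl !coef_proj coef_flip.
have [n0|n0] := lerP 0 n; first by rewrite ifF ?subr0//; lia.
by rewrite ifT ?subrr//; lia.
Qed.

Lemma proj_orth u v : inner (projP1 u) (v - projP1 v) = 0.
Proof.
have [g [g1 g2]] := orthonormal_projection epos_on u.
have -> : projP1 u = g.
  apply: coefs_inj => -[n|n]; rewrite coef_proj /=; first by rewrite g1.
  by rewrite g2// => k; rewrite ee_orthonormal.
by apply: g2 => k; rewrite innerBl coef_proj /= subrr.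
Qed.

Lemma inner_proj u v : inner (projP1 u) v = inner u (projP1 v).
Proof.
have h1 := proj_orth u v; have h2 := proj_orth v u.
rewrite innerBr in h1; rewrite innerBr in h2.
rewrite (subr0_eq h1) [RHS]inner_conj (subr0_eq h2) -inner_conj//.
Qed.

Lemma nsq_proj u : nsq (projP1 u) <= nsq u.
Proof.
rewrite -[in leRHS](subrKC (projP1 u) u) nsqD_orth ?proj_orth//.
by rewrite lerDl nsq_ge0.
Qed.

(** A convolution formula for the coefficients of a product is avoided: z moves to the exponential
    [ee n], n >= 0, and its conjugate times [ee n] is orthogonal to every [eneg k], since only the
    coefficient of z at n + 1 + k > 0 occurs. *)
Lemma proj_mul_coproj z u : bmeas z -> (forall n, 0 < n -> fourier z n = 0) ->
  projP1 (mulL2 z (u - projP1 u)) = 0.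
Proof.
move=> bz z0; set w := u - projP1 u.
have w0 n : 0 <= n -> inner w (ee n) = 0.
  by move=> n0; rewrite innerBl coef_proj n0 subrr.
have [g [g1 g2]] := orthonormal_projection eneg_on w.
have -> : w = g.
  apply: coefs_inj => n; have [n0|n0] := lerP 0 n.
    rewrite w0// g2// => k; rewrite ee_orthonormal.
    by case: eqP => // h; exfalso; lia.
  have -> : ee n = eneg `|n|.-1 by congr ee; lia.
  by rewrite g1.
apply: coefs_inj => n; rewrite inner0l coef_proj; case: ifP => // n0.
rewrite inner_mulL2//; apply: g2 => k.
rewrite inner_mulL2; last exact: bmeas_conj.
rewrite (_ : (fun t => _) = z); last by apply/funext => t; rewrite conjcK.
rewrite inner_conj inner_mulL2_ee// z0 ?conjc0//; lia.
Qed.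

Lemma fourier_ptinv z n : bmeas z -> fourier (fun t => z (ptinv t)) n = fourier z (- n).
Proof.
move=> bz; rewrite /fourier -[RHS]cint_ptinv.
  by congr cint; apply/funext => t; rewrite ptval_inv opprK exprz_inv.
by apply: bmeas_cmeas; apply: bmeasM => //; exact: bmeas_ptvalX.
Qed.

Lemma fourier_conj z n : bmeas z -> fourier (fun t => conjc (z t)) n = conjc (fourier z (- n)).
Proof.
move=> bz; rewrite /fourier -cint_conj.
  by congr cint; apply/funext => t; rewrite cconjM conj_ptvalX opprK.
by apply: bmeas_Lp1; apply: bmeasM => //; exact: bmeas_ptvalX.
Qed.

(** The mirror image of [proj_mul_coproj] under the flip. *)
Lemma proj_mul_proj z u : bmeas z -> (forall n, n < 0 -> fourier z n = 0) ->
  projP1 (mulL2 z (projP1 u)) = mulL2 z (projP1 u).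
Proof.
move=> bz z0; have bz' := bmeas_ptinv bz.
have z0' n : 0 < n -> fourier (fun t => z (ptinv t)) n = 0.
  by move=> n0; rewrite fourier_ptinv// z0// oppr_lt0.
have := proj_mul_coproj (flipJ1 u) bz' z0'.
have -> : flipJ1 u - projP1 (flipJ1 u) = flipJ1 (projP1 u).
  by rewrite proj_flip -scaleN1r -flipZ -flipD scaleN1r opprB subrKC.
rewrite -flip_mulL2// proj_flip => h.
have : flipJ1 (flipJ1 (mulL2 z (projP1 u) - projP1 (mulL2 z (projP1 u)))) = flipJ1 0 by rewrite h.
rewrite flipK -[in flipJ1 0](scale0r 0) flipZ scale0r => /subr0_eq; exact: esym.
Qed.

End Projection.

(** * Dimensions of the scalar kernels *)

Section Dim.
Variable R : realType.
Local Notation C := R[i].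

Lemma has_dim_fin (V : lmodType C) (K : set V) (I : finType) (e : I -> V) :
  (forall i, K (e i)) ->
  (forall c : I -> C, \sum_i c i *: e i = 0 -> forall i, c i = 0) ->
  (forall v, K v -> exists c : I -> C, v = \sum_i c i *: e i) ->
  has_dim K (#|I|)%:Z.
Proof.
move=> eK ei es; exists #|I|, (fun k => e (enum_val k)); split => //.
- move=> c c0 k; have := ei (fun i => c (enum_rank i)).
  have -> : \sum_i c (enum_rank i) *: e i = 0.
    rewrite -[RHS]c0 (reindex (@enum_val I I)) /=.
      by apply: eq_bigr => i _; rewrite enum_valK.
    by apply: onW_bij; exact: enum_val_bij.
  by move=> /(_ erefl (enum_val k)); rewrite enum_valK.
- move=> v /es[c ->]; exists (fun k => c (enum_val k)).
  by rewrite (reindex (@enum_val I I)) //=; apply: onW_bij; exact: enum_val_bij.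
Qed.

Lemma linear0' (V W : lmodType C) (f : V -> W) : linear f -> f 0 = 0.
Proof. by move=> lf; have := lf (-1) 0 0; rewrite scaler0 addr0 scaleN1r addNr. Qed.

Lemma linearD' (V W : lmodType C) (f : V -> W) : linear f -> {morph f : x y / x + y}.
Proof. by move=> lf x y; have := lf 1 x y; rewrite !scale1r. Qed.

Lemma linearZ' (V W : lmodType C) (f : V -> W) : linear f ->
  forall a x, f (a *: x) = a *: f x.
Proof. by move=> lf a x; have := lf a x 0; rewrite !addr0 linear0'// addr0. Qed.

Lemma linearN' (V W : lmodType C) (f : V -> W) : linear f -> {morph f : x / - x}.
Proof. by move=> lf x; rewrite -scaleN1r linearZ'// scaleN1r. Qed.

Lemma linearB' (V W : lmodType C) (f : V -> W) : linear f -> {morph f : x y / x - y}.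
Proof. by move=> lf x y; rewrite linearD'// linearN'. Qed.

Lemma linear_sum' (V W : lmodType C) (f : V -> W) : linear f ->
  forall (I : Type) (r : seq I) (c : I -> C) (e : I -> V),
  f (\sum_(i <- r) c i *: e i) = \sum_(i <- r) c i *: f (e i).
Proof.
move=> lf I r c e; elim: r => [|i r IH]; first by rewrite !big_nil linear0'.
by rewrite !big_cons linearD'// linearZ'// IH.
Qed.

Lemma has_dim_iso (V W : lmodType C) (K : set V) (K' : set W) (d : int)
    (phi : V -> W) (psi : W -> V) : linear phi -> linear psi ->
  (forall v, K v -> K' (phi v)) -> (forall w, K' w -> K (psi w)) ->
  (forall v, K v -> psi (phi v) = v) -> (forall w, K' w -> phi (psi w) = w) ->
  has_dim K' d -> has_dim K d.
Proof.
move=> lphi lpsi phiK psiK phiV psiV [n [e [-> eK ei es]]].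
exists n, (fun i => psi (e i)); split => //.
- by move=> i; exact: psiK.
- move=> c c0; apply: ei; rewrite -[RHS](linear0' lphi) -[in RHS]c0 linear_sum'//.
  by apply: eq_bigr => i _; rewrite psiV.
- move=> v Kv; have [c cE] := es _ (phiK _ Kv); exists c.
  by rewrite -[LHS]phiV// cE linear_sum'.
Qed.

(** The basis is the disjoint union of the given ones, indexed by a sigma type, each vector being
    placed in its own coordinate. *)
Lemma has_dim_ffun n (K : 'I_n -> set (L2 R)) (d : 'I_n -> int) :
  (forall k, K k 0) -> (forall k, has_dim (K k) (d k)) ->
  has_dim [set y : L2v R n | forall k, K k (y k)] (\sum_k d k).
Proof.
move=> K0 h.
pose m k := projT1 (cid (h k)).
pose e k : 'I_(m k) -> L2 R := projT1 (cid (projT2 (cid (h k)))).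
have H k : [/\ d k = (m k)%:Z, forall i, K k (e k i),
    forall c : 'I_(m k) -> C, \sum_i c i *: e k i = 0 -> forall i, c i = 0 &
    forall v, K k v -> exists c : 'I_(m k) -> C, v = \sum_i c i *: e k i].
  exact: (projT2 (cid (projT2 (cid (h k))))).
clearbody e; move: (m) e H => {}m e H.
pose I : finType := {k : 'I_n & 'I_(m k)}.
have -> : \sum_k d k = (#|I|)%:Z.
  rewrite card_tagged sumnE big_map big_enum /= (big_morph Posz PoszD (erefl _)).
  by apply: eq_bigr => k _; rewrite card_ord; have [] := H k.
pose E (i : I) : L2v R n := [ffun k => if k =P tag i is ReflectT ki then
  e k (eq_rect_r (fun k => 'I_(m k)) (tagged i) ki) else 0].
have sumE (c : I -> C) k : (\sum_i c i *: E i) k = \sum_(j < m k) c (Tagged _ j) *: e k j.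
  rewrite sum_ffunE.
  transitivity (\sum_k' \sum_(j < m k') (c (Tagged _ j) *: E (Tagged _ j)) k).
    by rewrite sig_big_dep /=; apply: eq_bigr => -[k' j] _.
  rewrite (bigD1 k)//= [X in _ + X]big1 ?addr0.
    apply: eq_bigr => j _; rewrite !ffunE /=; case: eqP => // kk.
    by rewrite (eq_axiomK kk).
  move=> k' kk'; apply: big1 => j _; rewrite !ffunE /=; case: eqP => [kk|_].
    by rewrite kk eqxx in kk'.
  by rewrite scaler0.
apply: (has_dim_fin (e := E)).
- move=> [k' j] k; rewrite ffunE /=; case: eqP => [kk|_]; last exact: K0.
  by case: _ / kk j => j; have [] := H k.
- move=> c c0 [k j]; have [_ _ + _] := H k.
  move=> /(_ (fun j => c (Tagged _ j))); apply.
  by rewrite -sumE c0 ffunE.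
- move=> v Kv.
  have hc k : exists c : 'I_(m k) -> C, v k = \sum_j c j *: e k j.
    by have [_ _ _] := H k; apply; exact: Kv.
  exists (fun i : I => projT1 (cid (hc (tag i))) (tagged i)).
  by apply/ffunP => k; rewrite sumE; exact: (projT2 (cid (hc k))).
Qed.

End Dim.

(** * Scalar vectors fixed by D J *)

Section ScalarDim.
Variable R : realType.
Local Notation C := R[i].
Local Notation T := (circle R).
Local Notation L2 := (L2 R).
Local Notation ee := (ee R).
Implicit Types (u v : L2) (rho kappa : int).

Definition dmul rho kappa u : L2 := mulL2 (fun t : T => rho%:~R * ptval t ^ kappa) u.

Lemma bmeas_dmul rho kappa : bmeas (fun t : T => (rho%:~R : C) * ptval t ^ kappa).
Proof. by apply: bmeasM; [exact: bmeas_cst|exact: bmeas_ptvalX]. Qed.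

Lemma coef_dmul rho kappa u n :
  inner (dmul rho kappa u) (ee n) = rho%:~R * inner u (ee (n - kappa)).
Proof.
rewrite /dmul -mulL2A; [|exact: bmeas_cst|exact: bmeas_ptvalX].
rewrite mulL2_cst innerZl inner_mulL2; last exact: bmeas_ptvalX.
rewrite (_ : (fun t => conjc _) = (fun t : T => ptval t ^ (- kappa))); last first.
  by apply/funext => t; exact: conj_ptvalX.
by rewrite mulL2_ptvalX_ee addrC.
Qed.

Lemma coef_coproj u n :
  inner (u - projP1 u) (ee n) = if 0 <= n then 0 else inner u (ee n).
Proof. by rewrite innerBl coef_proj; case: ifP; rewrite ?subrr ?subr0. Qed.

(** In coefficients: [v_n = 0] for n >= 0 and [v_n = rho v_(kappa - 1 - n)]. *)
Definition fixQ rho kappa : set L2 :=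
  [set y | projP1 y = 0 /\ y = dmul rho kappa (flipJ1 y)].

Lemma sum_deltaP d (c : 'I_d -> C) (x : int) :
  (forall i : 'I_d, x = i%:Z -> \sum_(j < d) c j * (x == j%:Z)%:R = c i) /\
  ((forall i : 'I_d, x <> i%:Z) -> \sum_(j < d) c j * (x == j%:Z)%:R = 0).
Proof.
split=> [i ->|xi].
  rewrite (bigD1 i)//= eqxx mulr1 big1 ?addr0// => j ji.
  by case: eqP => [[/val_inj ij]|_]; rewrite ?mulr0//; rewrite ij eqxx in ji.
by apply: big1 => j _; case: eqP => [/xi//|_]; rewrite mulr0.
Qed.

Lemma fixQ_dim0 rho kappa : 0 <= kappa -> has_dim (fixQ rho kappa) 0.
Proof.
move=> k0; exists 0%N, (fun=> 0); split => //; first by case.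
  by move=> c _ [].
move=> v [Pv vE]; exists (fun=> 0); rewrite big_ord0.
have v0 n : 0 <= n -> inner v (ee n) = 0.
  by move=> n0; have := coef_proj v n; rewrite Pv inner0l n0.
apply: coefs_inj => n; rewrite inner0l; have [n0|n0] := lerP 0 n; first exact: v0.
by rewrite vE coef_dmul coef_flip v0 ?mulr0//; lia.
Qed.

(** Indices j < d label the exponents j - m in the left half of the window from -m to -1; the centre
    [2 j + 1 = m] counts only for rho = 1. Stating d through this equivalence leaves the index
    comparisons to linear arithmetic. *)
Lemma fixQ_dim_aux rho (m d : nat) : rho = 1 \/ rho = -1 ->
  (forall j : nat, (j < d)%N = (2 * j + 1 < m)%N || ((2 * j + 1 == m)%N && (rho == 1))) ->
  has_dim (fixQ rho (- m%:Z)) d%:Z.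
Proof.
move=> rho1 Hd.
have rr : (rho%:~R * rho%:~R : C) = 1 by case: rho1 => ->; rewrite ?mulr1// mulrNN mulr1.
(* An exponential plus rho times its mirror image under n -> -m - 1 - n; at the centre both
   coincide. *)
pose vv (j : 'I_d) := ee (j%:Z - m%:Z) + rho%:~R *: ee (- 1 - j%:Z).
have dE (j : 'I_d) := Hd j; have dl (j : 'I_d) := ltn_ord j.
have coefS (c : 'I_d -> C) n : inner (\sum_i c i *: vv i) (ee n) =
    \sum_(i < d) c i * (n + m%:Z == i%:Z)%:R + rho%:~R * \sum_(i < d) c i * (- 1 - n == i%:Z)%:R.
  rewrite inner_suml mulr_sumr -big_split /=; apply: eq_bigr => i _.
  rewrite innerZl innerDl innerZl !ee_orthonormal mulrDr [rho%:~R * (c i * _)]mulrCA.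
  congr (_ * _%:R + _ * (_ * _%:R)); congr nat_of_bool; apply/eqP/eqP; lia.
exists d, vv; split => //.
- move=> j; split.
    apply: coefs_inj => n; rewrite inner0l coef_proj innerDl innerZl !ee_orthonormal.
    case: ifP => // n0; have := dl j; rewrite Hd => jd.
    have e1 : (j%:Z - m%:Z == n) = false by apply/eqP; lia.
    have e2 : (- 1 - j%:Z == n) = false by apply/eqP; lia.
    by rewrite e1 e2 mulr0 addr0.
  apply: coefs_inj => n; rewrite coef_dmul coef_flip !innerDl !innerZl !ee_orthonormal.
  rewrite mulrDr mulrA rr mul1r addrC.
  congr (_ * _%:R + _%:R); congr nat_of_bool; apply/eqP/eqP; lia.
- move=> c c0 j; have := coefS c (j%:Z - m%:Z); rewrite c0 inner0l.
  rewrite (proj1 (sum_deltaP _ _) j); last by lia.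
  have [mj|mj] := eqVneq (2 * j + 1)%N m.
    have r1 : rho = 1 by have := dl j; rewrite Hd; case: rho1 => // ->; lia.
    rewrite (proj1 (sum_deltaP _ _) j); last by lia.
    rewrite r1 mul1r -mulr2n => /esym/eqP; rewrite mulrn_eq0 /= => /eqP//.
  rewrite (proj2 (sum_deltaP _ _)) ?mulr0 ?addr0//.
  by move=> i; have := dl j; have := dl i; rewrite !Hd; lia.
- move=> v [Pv vE].
  have v0 n : 0 <= n -> inner v (ee n) = 0.
    by move=> n0; have := coef_proj v n; rewrite Pv inner0l n0.
  have vr n : inner v (ee n) = rho%:~R * inner v (ee (- m%:Z - 1 - n)).
    by rewrite {1}vE coef_dmul coef_flip; congr (_ * inner v (ee _)); lia.
  (* The central basis vector is twice an exponential, hence the division by 2. *)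
  pose c (j : nat) : C := inner v (ee (j%:Z - m%:Z)) / (if (2 * j + 1)%N == m then 2 else 1).
  exists (fun i : 'I_d => c i); apply: coefs_inj => n; rewrite coefS.
  have [n0|n0] := lerP 0 n.
    rewrite v0// !(proj2 (sum_deltaP _ _)) ?mulr0 ?addr0//.
      by move=> i; lia.
    by move=> i; have := dl i; rewrite Hd; lia.
  have [nm|nm] := ltrP n (- m%:Z).
    rewrite vr v0; last by lia.
    rewrite !(proj2 (sum_deltaP _ _)) ?mulr0 ?addr0//.
      by move=> i; have := dl i; rewrite Hd; lia.
    by move=> i; lia.
  have [j jE] : exists j : nat, n = j%:Z - m%:Z by exists (absz (n + m%:Z)); lia.
  have jm : (j < m)%N by lia.
  have [jd|jd] := ltnP j d.
    rewrite (proj1 (sum_deltaP _ _) (Ordinal jd)); last by rewrite /= jE; lia.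
    have [mj|mj] := eqVneq (2 * j + 1)%N m.
      have r1 : rho = 1 by move: jd; rewrite Hd; case: rho1 => // ->; lia.
      rewrite (proj1 (sum_deltaP _ _) (Ordinal jd)); last by rewrite /=; lia.
      by rewrite /c /= mj eqxx r1 mul1r -jE -splitr.
    rewrite (proj2 (sum_deltaP _ _)) ?mulr0 ?addr0.
      by rewrite /c /= (negPf mj) divr1 -jE.
    by move=> i; move: jd; have := dl i; rewrite !Hd; lia.
  rewrite (proj2 (sum_deltaP _ _)); last first.
    by move=> i; have := dl i; lia.
  rewrite add0r; have [jd'|jd'] := ltnP (m - 1 - j) d.
    rewrite (proj1 (sum_deltaP _ _) (Ordinal jd')); last by rewrite /=; lia.
    rewrite /c /= ifF; last by apply/negP => /eqP; move: jd jd'; rewrite leqNgt !Hd; lia.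
    by rewrite divr1 vr; congr (_ * inner v (ee _)); lia.
  rewrite (proj2 (sum_deltaP _ _)); last first.
    by move=> i; have := dl i; lia.
  (* No basis vector covers n: it is the centre with rho = -1, where the symmetry makes the
     coefficient its own negative. *)
  have [mj rm] : (2 * j + 1)%N = m /\ rho = -1.
    move: jd; rewrite leqNgt Hd negb_or => /andP[a1 a2].
    move: jd'; rewrite leqNgt Hd negb_or => /andP[b1 b2].
    have mj : (2 * j + 1)%N = m by move: a1 b1 jm; clear; lia.
    by split => //; case: rho1 => // r1; move: a2; rewrite mj r1 !eqxx.
  have := vr n; rewrite mulr0 rm (_ : - m%:Z - 1 - n = n); last by lia.
  have -> : (-1)%:~R = -1 :> C by [].
  rewrite mulN1r; case: (inner v _) => a b [ha hb].
  by apply/eqP; rewrite eq_complex /=; apply/andP; split; apply/eqP; lra.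
Qed.

Lemma fixQ_dim rho kappa : rho = 1 \/ rho = -1 ->
  has_dim (fixQ rho kappa) (if kappa < 0 then - Theta rho kappa else 0).
Proof.
move=> rho1; case: ltrP => k0; last exact: fixQ_dim0.
have [m mE] : exists m : nat, kappa = - m%:Z by exists (absz kappa); lia.
have -> : - Theta rho kappa = ((m + (odd m && (rho == 1)))./2)%:Z.
  rewrite /Theta mE.
  have := odd_double_half m; case: (odd m) => /= mm.
    rewrite ifF; last by apply/negP; lia.
    by case: rho1 => ->; lia.
  rewrite ifT; lia.
rewrite mE; apply: fixQ_dim_aux => // j.
have := odd_double_half m; case: (odd m) => /=; case: rho1 => -> /=; lia.
Qed.

End ScalarDim.

(** * Vector-valued operators *)

Section VectorOps.
Variable R : realType.
Local Notation C := R[i].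
Local Notation T := (circle R).
Local Notation L2 := (L2 R).
Variable n : nat.
Implicit Types (A B : T -> 'M[C]_n) (f g : L2v R n).

Definition bmx A := forall i j, bmeas (fun t => A t i j).

Lemma mulME A f i : mulM A f i = \sum_j mulL2 (fun t => A t i j) (f j).
Proof. by rewrite ffunE. Qed.

Lemma mulM_linear A : bmx A -> linear (mulM A).
Proof.
move=> bA a f g; apply/ffunP => i; rewrite !ffunE scaler_sumr -big_split /=.
by apply: eq_bigr => j _; rewrite !ffunE -[LHS]/(mulL2 _ _) mulL2Dr// mulL2Zr.
Qed.

Lemma bmxM A B : bmx A -> bmx B -> bmx (fun t => A t *m B t).
Proof.
move=> bA bB i j; under eq_fun do rewrite mxE.
by apply: bmeas_sum => k; exact: bmeasM.
Qed.

Lemma mulM_comp A B f : bmx A -> bmx B -> mulM A (mulM B f) = mulM (fun t => A t *m B t) f.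
Proof.
move=> bA bB; apply/ffunP => i; rewrite !mulME.
under eq_bigr do rewrite mulME.
have E k : mulL2 (fun t => (A t *m B t) i k) (f k) =
    \sum_j mulL2 (fun t => A t i j) (mulL2 (fun t => B t j k) (f k)).
  under eq_fun do rewrite mxE.
  rewrite mulL2_sum; last by move=> j; exact: bmeasM.
  by apply: eq_bigr => j _; rewrite mulL2A.
under [RHS]eq_bigr do rewrite E.
rewrite exchange_big /=; apply: eq_bigr => j _.
have lin : linear (mulL2 (fun t => A t i j)).
  by move=> a u v; rewrite mulL2Dr// mulL2Zr.
elim/big_ind2: _ => [|x x' y y' <- <-|//]; first exact: linear0'.
exact: linearD'.
Qed.

Lemma mulM1 f : mulM (fun=> 1%:M) f = f.
Proof.
apply/ffunP => i; rewrite mulME (bigD1 i)//= big1 => [|j ji].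
  by rewrite addr0 mxE eqxx mulL2_cst scale1r.
by rewrite mxE eq_sym (negPf ji) mulL2_cst scale0r.
Qed.

Lemma mulMK A B f : bmx A -> bmx B -> (forall t, A t *m B t = 1%:M) ->
  mulM A (mulM B f) = f.
Proof.
move=> bA bB AB; rewrite mulM_comp// -[RHS]mulM1; congr mulM.
by apply/funext => t; rewrite AB.
Qed.

Lemma projP_linear : linear (@projP R n).
Proof. by move=> a f g; apply/ffunP => i; rewrite !ffunE projD projZ. Qed.

Lemma flipJ_linear : linear (@flipJ R n).
Proof. by move=> a f g; apply/ffunP => i; rewrite !ffunE flipD flipZ. Qed.

Lemma flipJK f : flipJ (flipJ f) = f.
Proof. by apply/ffunP => i; rewrite !ffunE flipK. Qed.

Lemma projPK f : projP (projP f) = projP f.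
Proof. by apply/ffunP => i; rewrite !ffunE projK. Qed.

Lemma projP_flipJ f : projP (flipJ f) = flipJ (f - projP f).
Proof. by apply/ffunP => i; rewrite !ffunE proj_flip. Qed.

Lemma bmx_tilde A : bmx A -> bmx (tilde A).
Proof. by move=> bA i j; exact: bmeas_ptinv (bA i j). Qed.

Lemma flipJ_mulM A f : bmx A -> flipJ (mulM A f) = mulM (tilde A) (flipJ f).
Proof.
move=> bA; apply/ffunP => i; rewrite ffunE !mulME.
have flip0 : flipJ1 (0 : L2) = 0 by rewrite -(scale0r 0) flipZ !scale0r.
rewrite (big_morph (@flipJ1 R) (@flipD R) flip0); apply: eq_bigr => j _.
by rewrite ffunE flip_mulL2.
Qed.

Definition anti_mx A := forall i j k, 0 < k -> fourier (fun t => A t i j) k = 0.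
Definition anal_mx A := forall i j k, k < 0 -> fourier (fun t => A t i j) k = 0.

Lemma proj0 : projP1 (0 : L2) = 0.
Proof. by rewrite -(scale0r 0) projZ !scale0r. Qed.

Lemma projP_anti A f : bmx A -> anti_mx A -> projP f = 0 -> projP (mulM A f) = 0.
Proof.
move=> bA aA f0; apply/ffunP => i; rewrite ffunE mulME ffunE.
rewrite (big_morph (@projP1 R) (@projD R) proj0); apply: big1 => j _.
have fj : projP1 (f j) = 0 by have /ffunP/(_ j) := f0; rewrite !ffunE.
by have := proj_mul_coproj (f j) (bA i j) (aA i j); rewrite fj subr0.
Qed.

Lemma projP_anal A f : bmx A -> anal_mx A -> projP f = f -> projP (mulM A f) = mulM A f.
Proof.
move=> bA aA f0; apply/ffunP => i; rewrite ffunE mulME.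
rewrite (big_morph (@projP1 R) (@projD R) proj0); apply: eq_bigr => j _.
have fj : projP1 (f j) = f j by have /ffunP/(_ j) := f0; rewrite !ffunE.
by rewrite -fj proj_mul_proj// => k; exact: aA.
Qed.

Definition adjmx A (t : T) : 'M[C]_n := (map_mx (@conjc R) (A t))^T.

Lemma bmx_adj A : bmx A -> bmx (adjmx A).
Proof.
by move=> bA i j; under eq_fun do rewrite !mxE; exact: bmeas_conj (bA j i).
Qed.

Lemma inner_sumr (I : Type) (r : seq I) (F : I -> L2) v :
  inner v (\sum_(i <- r) F i) = \sum_(i <- r) inner v (F i).
Proof. exact: (big_morph (fun u => inner v u) (fun x y => innerDr v x y) (inner0r v)). Qed.

Lemma vinner_mulM A f g : bmx A -> vinner (mulM A f) g = vinner f (mulM (adjmx A) g).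
Proof.
move=> bA; rewrite /vinner.
under eq_bigr do rewrite mulME inner_suml.
under [RHS]eq_bigr do rewrite mulME inner_sumr.
rewrite exchange_big /=; apply: eq_bigr => j _; apply: eq_bigr => i _.
have -> : (fun t => adjmx A t j i) = (fun t => conjc (A t i j)).
  by apply/funext => t; rewrite !mxE.
exact: inner_mulL2.
Qed.

Lemma vinner_projP f g : vinner (projP f) g = vinner f (projP g).
Proof. by apply: eq_bigr => i _; rewrite !ffunE inner_proj. Qed.

Lemma vinner_conj f g : vinner g f = conjc (vinner f g).
Proof. by rewrite /vinner rmorph_sum /=; apply: eq_bigr => i _; exact: inner_conj. Qed.

Lemma cRe_sum (I : Type) (r : seq I) (F : I -> C) :
  Re (\sum_(i <- r) F i) = \sum_(i <- r) Re (F i).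
Proof. by elim: r => [|i r IH]; rewrite ?big_nil// !big_cons cReD IH. Qed.

Definition vnsq f : R := \sum_i nsq (f i).

Lemma vnormE f : vnorm f = Num.sqrt (vnsq f).
Proof.
congr Num.sqrt; rewrite /vinner /vnsq.
exact: cRe_sum.
Qed.

(** Tested at [h = f - g]; this is the uniqueness that identifies the value of [adjoint]. *)
Lemma vinner_inj f g : (forall h, vinner h f = vinner h g) -> f = g.
Proof.
move=> h; have /eqP : vnsq (f - g) = 0.
  have -> : vnsq (f - g) = Re (vinner (f - g) (f - g)).
    by rewrite /vinner cRe_sum.
  have -> : vinner (f - g) (f - g) = vinner (f - g) f - vinner (f - g) g.
    by rewrite /vinner -sumrB; apply: eq_bigr => i _; rewrite !ffunE innerBr.
  by rewrite h subrr.
rewrite psumr_eq0 => [/allP fg|i _]; last exact: nsq_ge0.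
apply/ffunP => i; apply/eqP; rewrite -subr_eq0; apply/eqP/nsq_eq0/eqP.
by have := fg i; rewrite mem_index_enum !ffunE; exact.
Qed.

End VectorOps.

(** * Bounded operators *)

Section Bounded.
Variable R : realType.
Local Notation C := R[i].
Local Notation T := (circle R).

(** Bounds on squared norms with nonnegative constants compose and add without square roots;
    [bop_bounded] returns to [vnorm]. *)
Definition bop m n (X : L2v R m -> L2v R n) :=
  linear X /\ exists2 M : R, 0 <= M & forall f, vnsq (X f) <= M * vnsq f.

Lemma bop_bounded m n (X : L2v R m -> L2v R n) : bop X -> bounded_op X.
Proof.
move=> [lX [M M0 XM]]; split => //; exists (Num.sqrt M) => f.
by rewrite !vnormE -sqrtrM// ler_wsqrtr.
Qed.

Lemma bop_comp m n p (X : L2v R n -> L2v R p) (Y : L2v R m -> L2v R n) :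
  bop X -> bop Y -> bop (X \o Y).
Proof.
move=> [lX [M M0 XM]] [lY [K K0 YK]]; split.
  by move=> a f g /=; rewrite lY lX.
exists (M * K) => [|f /=]; first exact: mulr_ge0.
by apply: le_trans (XM _) _; rewrite -mulrA ler_wpM2l.
Qed.

Lemma vnsqD_le n (f g : L2v R n) : vnsq (f + g) <= 2 * vnsq f + 2 * vnsq g.
Proof.
rewrite /vnsq !mulr_sumr -big_split /=; apply: ler_sum => i _.
by rewrite ffunE; exact: nsqD_le.
Qed.

Lemma bopD m n (X Y : L2v R m -> L2v R n) : bop X -> bop Y -> bop (fun f => X f + Y f).
Proof.
move=> [lX [M M0 XM]] [lY [K K0 YK]]; split.
  by move=> a f g /=; rewrite lY lX scalerDr addrACA.
exists (2 * M + 2 * K) => [|f]; first by rewrite addr_ge0// mulr_ge0.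
apply: le_trans (vnsqD_le _ _) _.
by have := XM f; have := YK f; lra.
Qed.

Lemma bopZ m n (a : C) (X : L2v R m -> L2v R n) : bop X -> bop (fun f => a *: X f).
Proof.
move=> [lX [M M0 XM]]; split.
  by move=> b f g /=; rewrite lX scalerDr !scalerA mulrC.
exists (sqmod a * M) => [|f]; first by rewrite mulr_ge0// sqmod_ge0.
rewrite -mulrA; apply: le_trans (_ : _ <= sqmod a * vnsq (X f)) _; last first.
  by apply: ler_wpM2l; rewrite ?sqmod_ge0.
by rewrite /vnsq mulr_sumr; apply: ler_sum => i _; rewrite ffunE nsqZ.
Qed.

Lemma bop_id n : bop (@id (L2v R n)).
Proof. by split => //; exists 1 => // f; rewrite mul1r. Qed.

Lemma bop_ext m n (X Y : L2v R m -> L2v R n) : X =1 Y -> bop X -> bop Y.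
Proof. by move=> /funext ->. Qed.

Lemma bop_projP n : bop (@projP R n).
Proof.
split; first exact: projP_linear.
exists 1 => // f; rewrite mul1r; apply: ler_sum => i _.
by rewrite ffunE nsq_proj.
Qed.

Lemma bop_coord m n (X : 'I_n -> L2v R m -> L2 R) :
  (forall i a f g, X i (a *: f + g) = a *: X i f + X i g) ->
  (forall i, exists2 M : R, 0 <= M & forall f, nsq (X i f) <= M * vnsq f) ->
  bop (fun f => [ffun i => X i f] : L2v R n).
Proof.
move=> lX bX; split; first by move=> a f g; apply/ffunP => i; rewrite !ffunE lX.
pose M i := projT1 (cid (let: ex_intro2 M M0 h := bX i in ex_intro (fun M => 0 <= M /\ _) M (conj M0 h))).
have MP i : 0 <= M i /\ forall f, nsq (X i f) <= M i * vnsq f.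
  exact: (projT2 (cid (let: ex_intro2 M M0 h := bX i in ex_intro (fun M => 0 <= M /\ _) M (conj M0 h)))).
exists (\sum_i M i) => [|f]; first by apply: sumr_ge0 => i _; case: (MP i).
by rewrite mulr_suml; apply: ler_sum => i _; rewrite ffunE; case: (MP i).
Qed.

Lemma nsq_le_vnsq n (f : L2v R n) j : nsq (f j) <= vnsq f.
Proof. by rewrite /vnsq (bigD1 j)//= lerDl sumr_ge0// => i _; exact: nsq_ge0. Qed.

Lemma bop_mulM n (A : T -> 'M[C]_n) : bmx A -> bop (mulM A).
Proof.
move=> bA; apply: bop_coord => [i a f g|i].
  by have /ffunP/(_ i) := mulM_linear bA a f g; rewrite !ffunE.
rewrite -[index_enum _]/(index_enum _); elim: (index_enum _) => [|j r [M M0 IH]].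
  by exists 0 => // f; rewrite big_nil /nsq inner0l mul0r.
have [K K0 h] := nsq_mulL2 (bA i j).
exists (2 * K + 2 * M) => [|f]; first by rewrite addr_ge0// mulr_ge0.
rewrite big_cons; apply: le_trans (nsqD_le _ _) _.
have h1 : K * nsq (f j) <= K * vnsq f by apply: ler_wpM2l => //; exact: nsq_le_vnsq.
by have := h (f j); have := IH f; lra.
Qed.

End Bounded.

(** * Passage to twice as many components *)

Section Doubling.
Variable R : realType.
Local Notation C := R[i].
Local Notation T := (circle R).
Variable N : nat.
Implicit Types (f : L2v R N) (g : L2v R (N + N)) (A : T -> 'M[C]_(N + N)).

Definition Vop f : L2v R (N + N) := colop id (@flipJ R N) f.
Definition Vst g : L2v R N := rowop id (@flipJ R N) g.
Definition Sw g : L2v R (N + N) := mulM (fun=> Wmx R N) g.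

Lemma colopE (X Y : L2v R N -> L2v R N) f k :
  colop X Y f k = match fintype.split k with inl i => X f i | inr i => Y f i end.
Proof. by rewrite ffunE. Qed.

Lemma split_l (i : 'I_N) : fintype.split (lshift N i) = inl i.
Proof. exact: (unsplitK (inl i)). Qed.
Lemma split_r (i : 'I_N) : fintype.split (rshift N i) = inr i.
Proof. exact: (unsplitK (inr i)). Qed.

Lemma ffun_lrP g g' : (forall i, g (lshift N i) = g' (lshift N i)) ->
  (forall i, g (rshift N i) = g' (rshift N i)) -> g = g'.
Proof. by move=> hl hr; apply/ffunP => k; case: (fintype.splitP k) => i ki;
  [have -> : k = lshift N i by exact: val_inj|have -> : k = rshift N i by exact: val_inj]. Qed.

Lemma flipJE n (h : L2v R n) k : flipJ h k = flipJ1 (h k). Proof. by rewrite ffunE. Qed.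
Lemma projPE n (h : L2v R n) k : projP h k = projP1 (h k). Proof. by rewrite ffunE. Qed.

Lemma VopL f i : Vop f (lshift N i) = f i.
Proof. by rewrite /Vop colopE split_l. Qed.
Lemma VopR f i : Vop f (rshift N i) = flipJ1 (f i).
Proof. by rewrite /Vop colopE split_r ffunE. Qed.

Lemma VstE g i : Vst g i = g (lshift N i) + flipJ1 (g (rshift N i)).
Proof. by rewrite /Vst /rowop !ffunE. Qed.

Lemma SwL g i : Sw g (lshift N i) = g (rshift N i).
Proof.
rewrite /Sw mulME big_split_ord /= big1 => [|j _].
  rewrite add0r (bigD1 i)//= big1 => [|j ji].
    by rewrite addr0 block_mxEur mxE eqxx mulL2_cst scale1r.
  by rewrite block_mxEur mxE eq_sym (negPf ji) mulL2_cst scale0r.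
by rewrite block_mxEul mxE mulL2_cst scale0r.
Qed.

Lemma SwR g i : Sw g (rshift N i) = g (lshift N i).
Proof.
rewrite /Sw mulME big_split_ord /= [X in _ + X]big1 => [|j _].
  rewrite addr0 (bigD1 i)//= big1 => [|j ji].
    by rewrite addr0 block_mxEdl mxE eqxx mulL2_cst scale1r.
  by rewrite block_mxEdl mxE eq_sym (negPf ji) mulL2_cst scale0r.
by rewrite block_mxEdr mxE mulL2_cst scale0r.
Qed.

Lemma Vop_linear : linear Vop.
Proof.
move=> a f f'; apply: ffun_lrP => i; rewrite !ffunE.
  by rewrite !split_l !ffunE.
by rewrite !split_r !ffunE flipD flipZ.
Qed.

Lemma Vst_linear : linear Vst.
Proof.
by move=> a g g'; apply/ffunP => i; rewrite !(ffunE, VstE) flipD flipZ scalerDr addrACA.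
Qed.

Lemma bmx_W : bmx (fun _ : T => Wmx R N).
Proof. by move=> i j; exact: bmeas_cst. Qed.

Lemma Sw_linear : linear Sw.
Proof. exact: mulM_linear bmx_W. Qed.

Lemma VopVst g : Vop (Vst g) = g + flipJ (Sw g).
Proof.
apply: ffun_lrP => i.
  by rewrite VopL VstE ffunE flipJE SwL.
by rewrite VopR VstE ffunE flipJE SwR flipD flipK addrC.
Qed.

Lemma SwVop f : Sw (Vop f) = flipJ (Vop f).
Proof.
apply: ffun_lrP => i.
  by rewrite SwL flipJE VopR VopL.
by rewrite SwR flipJE VopR VopL flipK.
Qed.

Lemma Vst_flipSw g : Vst (flipJ (Sw g)) = Vst g.
Proof.
apply/ffunP => i; rewrite !VstE !flipJE SwL SwR flipK.
by rewrite addrC.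
Qed.

Lemma projP_Sw g : projP (Sw g) = Sw (projP g).
Proof.
by apply: ffun_lrP => i; rewrite ?(SwL, SwR, flipJE, projPE).
Qed.

Lemma flipJ_Sw g : flipJ (Sw g) = Sw (flipJ g).
Proof.
by apply: ffun_lrP => i; rewrite ?(SwL, SwR, flipJE, projPE).
Qed.

Lemma VstVop f : Vst (Vop f) = f + f.
Proof. by apply/ffunP => i; rewrite VstE VopL VopR flipK ffunE. Qed.

(** This is [P + J P J = I], because [J P J = Q]. *)
Lemma Vst_proj_Vop f : Vst (projP (Vop f)) = f.
Proof.
apply/ffunP => i; rewrite VstE !projPE VopL VopR.
by rewrite proj_flip flipK addrC subrK.
Qed.

Lemma rowop_proj g : rowop (@projP R N) (@flipJ R N \o @projP R N) g = Vst (projP g).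
Proof.
by apply/ffunP => i; rewrite VstE /rowop !ffunE.
Qed.

Lemma colop_proj f : colop (@projP R N) (@projP R N \o @flipJ R N) f = projP (Vop f).
Proof.
apply: ffun_lrP => i; rewrite colopE ?(split_l, split_r) [RHS]projPE ?(VopL, VopR).
  by rewrite ffunE.
by rewrite /= !ffunE.
Qed.

Lemma colop_coproj f : colop (@projQ R N) (@projQ R N \o @flipJ R N) f = Vop f - projP (Vop f).
Proof.
apply: ffun_lrP => i; rewrite colopE ?(split_l, split_r) [RHS]ffunE.
  by rewrite [X in _ = _ + X]ffunE projPE VopL !ffunE.
by rewrite [X in _ = _ + X]ffunE projPE VopR /= !ffunE.
Qed.

Lemma PhiE A f : Phi A f = Vst (projP (mulM A (Vop f))).
Proof. by rewrite -rowop_proj. Qed.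
Lemma PsiE A f : Psi A f = Vst (mulM A (projP (Vop f))).
Proof. by rewrite -colop_proj. Qed.
Lemma opTE A f : opT A f = Vst (projP (mulM A (projP (Vop f)))).
Proof. by rewrite -rowop_proj -colop_proj. Qed.
Lemma opHE A f : opH A f = Vst (projP (mulM A (Vop f - projP (Vop f)))).
Proof. by rewrite -rowop_proj -colop_coproj. Qed.

Lemma bop_Vop : bop Vop.
Proof.
apply: (bop_ext (X := fun f => [ffun k => match fintype.split k with
  inl i => f i | inr i => flipJ1 (f i) end])).
  by move=> f; apply: ffun_lrP => i; rewrite ffunE ?(split_l, split_r) ?(VopL, VopR).
apply: bop_coord => k; case: (fintype.split k) => i.
- by move=> a f g; rewrite !ffunE.
- by move=> a f g; rewrite !ffunE flipD flipZ.
- by exists 1 => // f; rewrite mul1r nsq_le_vnsq.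
- by exists 1 => // f; rewrite mul1r nsq_flip nsq_le_vnsq.
Qed.

Lemma bop_Vst : bop Vst.
Proof.
apply: (bop_ext (X := fun g => [ffun i => g (lshift N i) + flipJ1 (g (rshift N i))])).
  by move=> f; apply/ffunP => i; rewrite VstE ffunE.
apply: bop_coord => i.
- by move=> a f g; rewrite !ffunE flipD flipZ scalerDr addrACA.
- exists 4 => // f; apply: le_trans (nsqD_le _ _) _; rewrite nsq_flip.
  by have := nsq_le_vnsq f (lshift N i); have := nsq_le_vnsq f (rshift N i); lra.
Qed.

Lemma bop_Phi A : bmx A -> bop (Phi A).
Proof.
move=> bA; apply: (bop_ext (fun f => esym (PhiE A f))).
apply: (bop_comp (X := Vst)); first exact: bop_Vst.
apply: (bop_comp (X := @projP R _)); first exact: bop_projP.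
by apply: (bop_comp (X := mulM A)); [exact: bop_mulM|exact: bop_Vop].
Qed.

Lemma bop_Psi A : bmx A -> bop (Psi A).
Proof.
move=> bA; apply: (bop_ext (fun f => esym (PsiE A f))).
apply: (bop_comp (X := Vst)); first exact: bop_Vst.
apply: (bop_comp (X := mulM A)); first exact: bop_mulM.
by apply: (bop_comp (X := @projP R _)); [exact: bop_projP|exact: bop_Vop].
Qed.

Lemma bop_opT A : bmx A -> bop (opT A).
Proof.
move=> bA; apply: (bop_ext (fun f => esym (opTE A f))).
apply: (bop_comp (X := Vst)); first exact: bop_Vst.
apply: (bop_comp (X := @projP R _)); first exact: bop_projP.
apply: (bop_comp (X := mulM A)); first exact: bop_mulM.
by apply: (bop_comp (X := @projP R _)); [exact: bop_projP|exact: bop_Vop].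
Qed.

Lemma bop_opH A : bmx A -> bop (opH A).
Proof.
move=> bA; apply: (bop_ext (fun f => esym (opHE A f))).
apply: (bop_comp (X := Vst)); first exact: bop_Vst.
apply: (bop_comp (X := @projP R _)); first exact: bop_projP.
apply: (bop_comp (X := mulM A)); first exact: bop_mulM.
apply: (bop_comp (X := fun g => g - projP g)); last exact: bop_Vop.
apply: bop_ext (bopD (@bop_id R _) (bopZ (-1) (@bop_projP R _))) => g.
by rewrite scaleN1r.
Qed.

Lemma bop_id_minus_half n (X : L2v R n -> L2v R n) : bop X -> bop (id_minus_half X).
Proof.
move=> bX; apply: bop_ext (bopD (@bop_id R _) (bopZ (- 2^-1) bX)) => g.
by rewrite scaleNr.
Qed.

Lemma vinner_Vst f g : vinner (Vst g) f = vinner g (Vop f).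
Proof.
transitivity (\sum_i (inner (g (lshift N i)) (f i) + inner (g (rshift N i)) (flipJ1 (f i)))).
  by apply: eq_bigr => i _; rewrite VstE innerDl inner_flip.
rewrite big_split /vinner big_split_ord /=; congr (_ + _); apply: eq_bigr => i _.
  by rewrite VopL.
by rewrite VopR.
Qed.

Lemma vinner_Vop f g : vinner (Vop f) g = vinner f (Vst g).
Proof. by rewrite vinner_conj -vinner_Vst -vinner_conj. Qed.

Lemma adjoint_eq n m (X : L2v R m -> L2v R n) (Y : L2v R n -> L2v R m) : bop Y ->
  (forall (f : L2v R m) (g : L2v R n), vinner (X f) g = vinner f (Y g)) ->
  adjoint X = Y.
Proof.
move=> bY XY; rewrite /adjoint; case: xgetP => [Z _ /= [_ XZ]|/(_ Y) []]; last first.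
  by split => //; exact: bop_bounded.
by apply/funext => g; apply: vinner_inj => f; rewrite -XZ XY.
Qed.

Lemma adjoint_Phi A : bmx A -> adjoint (Phi A) = Psi (adjmx A).
Proof.
move=> bA; apply: adjoint_eq; first exact: bop_Psi (bmx_adj bA).
by move=> f g; rewrite PhiE PsiE vinner_Vst vinner_projP vinner_mulM// vinner_Vop.
Qed.

Lemma adjoint_Psi A : bmx A -> adjoint (Psi A) = Phi (adjmx A).
Proof.
move=> bA; apply: adjoint_eq; first exact: bop_Phi (bmx_adj bA).
by move=> f g; rewrite PhiE PsiE vinner_Vst vinner_mulM// vinner_projP vinner_Vop.
Qed.

End Doubling.

Lemma halfD (R : realType) (W : lmodType R[i]) (x : W) : 2^-1 *: (x + x) = x.
Proof.
by rewrite -{1 2}(scale1r x) -scalerDl scalerA -[1 + 1]/(2%:R) mulVf ?scale1r ?pnatr_eq0.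
Qed.

(** * The algebra of the flip *)

(* P, J, S, Vo, Vs stand for P, J, M(W), f |-> (f, J f) and (f, g) |-> f + J g. *)
Record flip_model (R : realType) (U V : lmodType R[i]) (P J S : V -> V)
    (Vo : U -> V) (Vs : V -> U) : Prop := FlipModel {
  fm_linP : linear P; fm_linJ : linear J; fm_linS : linear S;
  fm_linVo : linear Vo; fm_linVs : linear Vs;
  fm_PK : forall g, P (P g) = P g;
  fm_JK : forall g, J (J g) = g;
  fm_PJ : forall g, P (J g) = J (g - P g);
  fm_JS : forall g, J (S g) = S (J g);
  fm_PS : forall g, P (S g) = S (P g);
  fm_VoVs : forall g, Vo (Vs g) = g + J (S g);
  fm_SVo : forall f, S (Vo f) = J (Vo f);
  fm_VsJS : forall g, Vs (J (S g)) = Vs g;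
  fm_VsVo : forall f, Vs (Vo f) = f + f;
  fm_VsPVo : forall f, Vs (P (Vo f)) = f
}.

(* b, bi, d, di stand for multiplication by B, B^-1, D, D^-1; [ff_bSJbi] encodes
   B W B~^-1 = D, and [ff_star1], [ff_star2] are P D Q D^-1 Q = 0 = Q D Q D^-1 P. *)
Record flip_factors (R : realType) (V : lmodType R[i]) (P J S b bi d di : V -> V) : Prop :=
    FlipFactors {
  ff_linb : linear b; ff_linbi : linear bi; ff_lind : linear d; ff_lindi : linear di;
  ff_bbi : forall g, b (bi g) = g; ff_bib : forall g, bi (b g) = g;
  ff_ddi : forall g, d (di g) = g; ff_did : forall g, di (d g) = g;
  ff_JdJ : forall g, J (d (J g)) = di g;
  ff_bSJbi : forall g, b (S (J (bi g))) = d (J g);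
  ff_star1 : forall g, P (d (di (g - P g) - P (di (g - P g)))) = 0;
  ff_star2 : forall g, d (di (P g) - P (di (P g))) = P (d (di (P g) - P (di (P g))))
}.

Section FlipAlgebra.
Variables (R : realType) (U V : lmodType R[i]).
Variables (P J S : V -> V) (Vo : U -> V) (Vs : V -> U).
Hypothesis M : flip_model P J S Vo Vs.

Let linP := fm_linP M. Let linJ := fm_linJ M. Let linS := fm_linS M.
Let linVo := fm_linVo M. Let linVs := fm_linVs M.
Let PK := fm_PK M. Let JK := fm_JK M. Let PJ := fm_PJ M.
Let JS := fm_JS M. Let PS := fm_PS M. Let VoVs := fm_VoVs M.
Let SVo := fm_SVo M. Let VsJS := fm_VsJS M. Let VsVo := fm_VsVo M.
Let VsPVo := fm_VsPVo M.

Local Notation PhiA a f := (Vs (P (a (Vo f)))).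
Local Notation PsiA a f := (Vs (a (P (Vo f)))).
Local Notation TA a f := (Vs (P (a (P (Vo f))))).

Let Q g := g - P g.

Let PD : {morph P : f g / f + g} := linearD' linP.
Let PB : {morph P : f g / f - g} := linearB' linP.
Let P0 : P 0 = 0 := linear0' linP.
Let PQ g : P (Q g) = 0. Proof. by rewrite PB PK subrr. Qed.
Let PDQ g : P g + Q g = g. Proof. by rewrite addrC subrK. Qed.
Let Q_P0 g : P g = 0 -> Q g = g. Proof. by rewrite /Q => ->; rewrite subr0. Qed.
Let JP g : J (P g) = Q (J g).
Proof. by rewrite /Q PJ (linearB' linJ) opprB addrC subrK. Qed.
Let QQ g : Q (Q g) = Q g. Proof. exact/Q_P0/PQ. Qed.
Let QD : {morph Q : f g / f + g}.
Proof. by move=> f g; rewrite /Q PD opprD addrACA. Qed.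

(** In [Vo Vs = I + J S] the second term sends the range of P into that of Q. Thus [Vs] on the range
    of P is inverse to [P Vo], and adjacent operators can be multiplied whenever a P stands between
    them. *)
Let PVoVs g : P (Vo (Vs (P g))) = P g.
Proof. by rewrite VoVs PD PK -PS JP PQ addr0. Qed.

Lemma T_Phi a b f : (forall g, P (a (P g)) = P (a g)) -> TA a (PhiA b f) = PhiA (fun g => a (b g)) f.
Proof. by move=> aP; rewrite PVoVs aP. Qed.

Lemma Psi_T a b f : (forall g, P (b (P g)) = b (P g)) -> PsiA a (TA b f) = PsiA (fun g => a (b g)) f.
Proof. by move=> bP; rewrite PVoVs bP. Qed.

Lemma T_T a b f : (forall g, P (a (P (b (P g)))) = P g) -> TA a (TA b f) = f.
Proof. by move=> ab; rewrite PVoVs ab VsPVo. Qed.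

Lemma Vs_inj g : Vs (P g) = 0 -> P g = 0.
Proof. by move=> h; rewrite -PVoVs h (linear0' linVo) P0. Qed.

Variables b bi d di : V -> V.
Hypothesis FF : flip_factors P J S b bi d di.

Let linb := ff_linb FF. Let linbi := ff_linbi FF.
Let lind := ff_lind FF. Let lindi := ff_lindi FF.
Let bbi := ff_bbi FF. Let bib := ff_bib FF.
Let ddi := ff_ddi FF. Let did := ff_did FF.
Let JdJ := ff_JdJ FF. Let bSJbi := ff_bSJbi FF.
Let star1 g : P (d (Q (di (Q g)))) = 0. Proof. exact: ff_star1 FF g. Qed.
Let star2 g : Q (d (Q (di (P g)))) = 0.
Proof. by apply/eqP; rewrite subr_eq0; apply/eqP; exact: ff_star2 FF g. Qed.

Let Jd g : J (d g) = di (J g).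
Proof. by rewrite -JdJ JK. Qed.

Let SJbi g : S (J (bi g)) = bi (d (J g)).
Proof. by rewrite -bSJbi bib. Qed.

Let bSJ g : b (S (J g)) = d (J (b g)).
Proof. by rewrite -bSJbi bib. Qed.

(** The range of [Vo] is fixed by [S J], and b carries the fixed vectors of [S J] to those of
    [d J]. *)
Let JbVo f : J (b (Vo f)) = di (b (Vo f)).
Proof.
have e : b (Vo f) = d (J (b (Vo f))) by rewrite -bSJ -JS SVo JK.
by rewrite [in RHS]e did.
Qed.

(** Invariance under [d J]: consequently [Vs bi] annihilates every vector with [d J g = - g]. *)
Let Vsbi g : Vs (bi g) = Vs (bi (d (J g))).
Proof. by rewrite -SJbi -JS VsJS. Qed.

Lemma kernel_Phi f : PhiA b f = 0 ->
  P (b (Vo f)) = 0 /\ b (Vo f) = d (J (b (Vo f))).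
Proof. by move=> /Vs_inj h; split => //; rewrite JbVo ddi. Qed.

Lemma Phi_kernel g : P g = 0 -> g = d (J g) -> PhiA b (2^-1 *: Vs (bi g)) = 0 /\
  b (Vo (2^-1 *: Vs (bi g))) = g.
Proof.
move=> Pg gE; have e : b (Vo (2^-1 *: Vs (bi g))) = g.
  rewrite (linearZ' linVo) VoVs JS SJbi -gE.
  by rewrite halfD bbi.
by rewrite e Pg (linear0' linVs).
Qed.

Lemma Phi_kernelK f : 2^-1 *: Vs (bi (b (Vo f))) = f.
Proof. by rewrite bib VsVo halfD. Qed.

Lemma kernel_Psi f : PsiA bi f = 0 ->
  P (P (Vo f)) = P (Vo f) /\ d (J (P (Vo f))) = - P (Vo f).
Proof.
set g := P (Vo f) => h; split; first by rewrite /g PK.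
have : Vo (Vs (bi g)) = 0 by rewrite h (linear0' linVo).
rewrite VoVs JS SJbi => /eqP; rewrite addrC addr_eq0 => /eqP e.
by rewrite -[LHS]bbi e (linearN' linb) bbi.
Qed.

Lemma Psi_kernel g : P g = g -> d (J g) = - g ->
  PsiA bi (Vs g) = 0 /\ P (Vo (Vs g)) = g.
Proof.
move=> Pg gE; have e : P (Vo (Vs g)) = g by rewrite -Pg PVoVs.
split => //; rewrite e.
have : Vs (bi g) = - Vs (bi g).
  by rewrite [LHS]Vsbi gE (linearN' linbi) (linearN' linVs).
by move=> /eqP; rewrite -addr_eq0 => /eqP h; rewrite -[LHS]halfD h scaler0.
Qed.

(** H transported to the range of P by [P Vo] and [Vs]; see [H_Vs]. *)
Let k g := P (d (J (P g))).
Let H f := Vs (P (d (S (Vo f - P (Vo f))))).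

Let kE g : k g = P (d (Q (J g))).
Proof. by rewrite /k JP. Qed.

Let HE f : H f = Vs (k (Vo f)).
Proof.
rewrite /H kE; congr (Vs (P (d _))).
by rewrite (linearB' linS) -PS SVo.
Qed.

Let kP g : k (P g) = k g. Proof. by rewrite /k PK. Qed.
Let Pk g : P (k g) = k g. Proof. by rewrite /k PK. Qed.

Let H_Vs g : H (Vs (P g)) = Vs (k g).
Proof. by rewrite HE -kP PVoVs kP. Qed.

(** Moving the second J to the right turns P into Q and d into [di]. *)
Let kk g : k (k g) = P (d (Q (di (P g)))).
Proof. by rewrite kE {1}/k JP QQ Jd JK. Qed.

Let Phi_Psi g : PhiA b (PsiA bi g) = g + H g.
Proof.
rewrite VoVs (linearD' linb) PD (linearD' linVs) bbi PK VsPVo.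
by rewrite JS bSJbi HE.
Qed.

(** For [g = b (Vo f)] one has [J g = di g], so [k g = P d Q di g], while [k (k g) = P d Q di P g];
    the difference is the vanishing [P d Q di Q g]. *)
Let HH_Phi f : H (H (PhiA b f)) = H (PhiA b f).
Proof.
rewrite H_Vs -[in LHS](Pk (b (Vo f))) H_Vs; congr Vs.
rewrite kk kE JbVo -[in RHS](PDQ (b (Vo f))) (linearD' lindi) QD (linearD' lind) PD.
by rewrite star1 addr0.
Qed.

(** By [Vsbi], [k g] may be replaced under [Vs bi] by [d J (k g) = d Q di P g], whose P part is
    [k (k g)] and whose Q part vanishes by [star2]. *)
Let Psi_HH f : PsiA bi (H (H f)) = PsiA bi (H f).
Proof.
rewrite (HE f) -Pk H_Vs -[k (k _)]Pk !PVoVs Pk [RHS]Vsbi Pk.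
congr (Vs (bi _)).
have -> : J (k (Vo f)) = Q (di (P (Vo f))) by rewrite /k JP Jd JK.
by rewrite kk -[RHS]PDQ star2 addr0.
Qed.

Let linH : linear H.
Proof.
move=> a f g; rewrite !HE /k linVo !linP linJ lind linP.
by rewrite linVs.
Qed.

Let linPsi : linear (fun f => PsiA bi f).
Proof. by move=> a f g; rewrite linVo linP linbi linVs. Qed.

Let S1 f := f - 2^-1 *: H f.

Let half (f : U) : f - 2^-1 *: f = 2^-1 *: f.
Proof.
by rewrite -{1}(halfD f) scalerDr addrK.
Qed.

Let Phi_pinv f : PhiA b (PsiA bi (S1 (PhiA b f))) = PhiA b f.
Proof.
rewrite Phi_Psi /S1; set u := PhiA b f.
rewrite (linearB' linH) (linearZ' linH) HH_Phi half.
by rewrite subrK.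
Qed.

Let Psi_pinv g : PsiA bi (S1 (PhiA b (PsiA bi g))) = PsiA bi g.
Proof.
rewrite Phi_Psi /S1 (linearD' linH).
(* The deviation of [(I - H/2)(I + H)] from I is a multiple of [H - H^2], which [PsiA bi] kills. *)
have -> : g + H g - 2^-1 *: (H g + H (H g)) = g + 2^-1 *: (H g - H (H g)).
  rewrite scalerDr opprD addrA -(addrA g) half scalerBr -addrA.
  by [].
rewrite [X in Vo X]addrC; have /= -> := linPsi 2^-1 (H g - H (H g)) g.
have := linearB' linPsi (H g) (H (H g)) => /= ->.
by rewrite Psi_HH subrr scaler0 add0r.
Qed.

Local Notation halfH f := (f - 2^-1 *: Vs (P (d (S (Vo f - P (Vo f)))))).

Lemma Phi_pseudoinverse f :
  let u := PhiA b f in PhiA b (PsiA bi (halfH u)) = u.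
Proof. exact: Phi_pinv. Qed.

Lemma Psi_pseudoinverse g :
  let f := PsiA bi g in let u := PhiA b f in PsiA bi (halfH u) = f.
Proof. exact: Psi_pinv. Qed.

End FlipAlgebra.

(** * Diagonal factors *)

Section DiagonalFactor.
Variable R : realType.
Local Notation C := R[i].
Variable n : nat.
Variable rho : 'I_n -> int.
Hypothesis rho1 : forall k, rho k = 1 \/ rho k = -1.
Implicit Types (kappa : 'I_n -> int) (g : L2v R n).

Local Notation diag kappa := (@diagt R n rho kappa).

Lemma rho_sqr k : (rho k)%:~R * (rho k)%:~R = 1 :> C.
Proof. by case: (rho1 k) => ->; rewrite ?mulr1// mulrNN mulr1. Qed.

Lemma diagt_mulN kappa t : diag kappa t *m diag (fun k => - kappa k) t = 1%:M.
Proof.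
rewrite /diagt mulmx_diag; apply/matrixP => i j; rewrite !mxE.
have [_|//] := eqVneq i j; rewrite mulrACA rho_sqr mul1r -expfzDr ?ptval_neq0//.
by rewrite subrr.
Qed.

Lemma diagt_Nmul kappa t : diag (fun k => - kappa k) t *m diag kappa t = 1%:M.
Proof.
rewrite -[RHS](diagt_mulN (fun k => - kappa k) t); congr (_ *m diagt _ _ _).
by apply/funext => k; rewrite opprK.
Qed.

Lemma tilde_diagt kappa t : tilde (diag kappa) t = diag (fun k => - kappa k) t.
Proof.
apply/matrixP => i j; rewrite !mxE; case: eqP => //= _; congr (_ * _).
by rewrite -[ptval (ptinv t)]/((ptval t)^-1) exprz_inv.
Qed.

Lemma minv_diagt kappa t : minv (diag kappa) t = diag (fun k => - kappa k) t.
Proof.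
have u : diag kappa t \in unitmx by case/mulmx1_unit: (diagt_mulN kappa t).
by rewrite -[LHS]mulmx1 -(diagt_mulN kappa t) mulmxA mulVmx// mul1mx.
Qed.

Lemma adj_diagt kappa t : adjmx (diag kappa) t = diag (fun k => - kappa k) t.
Proof.
apply/matrixP => i j; rewrite !mxE eq_sym; case: eqP => /= [->|_]; last first.
  by rewrite mulr0n oppr0.
rewrite !mulr1n rmorphM /=; congr (_ * _); last exact: conj_ptvalX.
by rewrite rmorph_int.
Qed.

Lemma bmx_diagt kappa : bmx (diag kappa).
Proof.
move=> i j; under eq_fun do rewrite !mxE.
case: eqP => _ /=; last by under eq_fun do rewrite mulr0n; exact: bmeas_cst.
by under eq_fun do rewrite mulr1n; exact: bmeas_dmul.
Qed.

Lemma mulM_diagt kappa g k : mulM (diag kappa) g k = dmul (rho k) (kappa k) (g k).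
Proof.
rewrite mulME (bigD1 k)//= big1 => [|j jk].
  by rewrite addr0; congr mulL2; apply/funext => t; rewrite !mxE eqxx mulr1n.
rewrite (_ : (fun t => _) = (fun=> 0)) ?mulL2_cst ?scale0r//.
by apply/funext => t; rewrite !mxE eq_sym (negPf jk) mulr0n.
Qed.

End DiagonalFactor.

Lemma Theta_opp (r k : int) : r = 1 \/ r = -1 -> Theta (- r) (- k) = - Theta r k.
Proof.
move=> r1; rewrite /Theta dvdzE abszN -dvdzE.
have [/dvdzP[q ->]|] := boolP (2 %| k)%Z; first by rewrite -mulNr !mulzK.
by case: r1 => -> h; lia.
Qed.

Section DiagonalFixedPoints.
Variable R : realType.
Variable n : nat.
Variable rho : 'I_n -> int.
Hypothesis rho1 : forall k, rho k = 1 \/ rho k = -1.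
Variable kappa : 'I_n -> int.
Implicit Types g : L2v R n.

Local Notation D := (@diagt R n rho kappa).
Local Notation Di := (@diagt R n rho (fun k => - kappa k)).

Lemma ffunBE g h k : (g - h) k = g k - h k.
Proof. by rewrite !ffunE. Qed.
Lemma ffunNE g k : (- g) k = - g k.
Proof. by rewrite !ffunE. Qed.

(** For diagonal D every coefficient is shifted and shifted back, so [D Q D^-1] only cuts
    coefficients off; it commutes with P, and [P Q = 0]. The next identity has the same reason. *)
Lemma proj_diagt_coproj g :
  projP (mulM D (mulM Di (g - projP g) - projP (mulM Di (g - projP g)))) = 0.
Proof.
apply/ffunP => k; rewrite projPE [RHS]ffunE.
rewrite mulM_diagt ffunBE projPE mulM_diagt ffunBE projPE; apply: coefs_inj => m.
rewrite coef_proj inner0l; case: ifP => // m0.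
rewrite coef_dmul coef_coproj; case: ifP => _; first by rewrite mulr0.
by rewrite coef_dmul coef_coproj opprK subrK m0 !mulr0.
Qed.

Lemma coproj_diagt_proj g :
  mulM D (mulM Di (projP g) - projP (mulM Di (projP g))) =
  projP (mulM D (mulM Di (projP g) - projP (mulM Di (projP g)))).
Proof.
apply/ffunP => k; rewrite projPE mulM_diagt ffunBE projPE mulM_diagt projPE; apply: coefs_inj => m.
rewrite coef_proj; case: ifP => // m0.
rewrite coef_dmul coef_coproj; case: ifP => _; first by rewrite mulr0.
by rewrite coef_dmul coef_proj opprK subrK m0 !mulr0.
Qed.

Lemma fixQ_diagt_dim :
  has_dim [set g : L2v R n | projP g = 0 /\ g = mulM D (flipJ g)]
    (- \sum_(k | kappa k < 0) Theta (rho k) (kappa k)).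
Proof.
rewrite (_ : [set g | _] = [set g : L2v R n | forall k, fixQ (rho k) (kappa k) (g k)]).
  rewrite -sumrN big_mkcond /=.
  apply: (has_dim_ffun (K := fun k => fixQ (rho k) (kappa k))) => k; last exact: fixQ_dim.
  split; first exact: proj0.
  by apply: coefs_inj => m; rewrite coef_dmul coef_flip !inner0l mulr0.
apply/seteqP; split => [g [Pg gE] k|g h].
  split; first by have /ffunP/(_ k) := Pg; rewrite projPE ffunE.
  by have /ffunP/(_ k) := gE; rewrite mulM_diagt flipJE.
split; apply/ffunP => k; first by rewrite projPE ffunE (proj1 (h k)).
by rewrite mulM_diagt flipJE -(proj2 (h k)).
Qed.

Lemma dmulN r s (u : L2 R) : dmul (- r) s u = - dmul r s u.
Proof.
by apply: coefs_inj => m; rewrite innerNl !coef_dmul rmorphN mulNr.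
Qed.

(** J exchanges P and Q and turns [D J g = - g] into [h = - D^-1 J h] for [h = J g]: the fixed-point
    problem with both rho and kappa negated, where [Theta_opp] applies. *)
Lemma fixP_diagt_dim :
  has_dim [set g : L2v R n | projP g = g /\ mulM D (flipJ g) = - g]
    (\sum_(k | 0 < kappa k) Theta (rho k) (kappa k)).
Proof.
apply: (has_dim_iso (phi := @flipJ R n) (psi := @flipJ R n)
  (K' := [set g : L2v R n | forall k, fixQ (- rho k) (- kappa k) (g k)])).
- exact: flipJ_linear.
- exact: flipJ_linear.
- move=> g [Pg gE] k; rewrite flipJE; split.
    have /ffunP/(_ k) := Pg; rewrite projPE => Pgk.
    by rewrite proj_flip Pgk subrr -(scale0r 0) flipZ !scale0r.
  have /ffunP/(_ k) := gE; rewrite mulM_diagt flipJE ffunNE => e.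
  apply: coefs_inj => m; rewrite flipK dmulN innerNl coef_dmul opprK.
  rewrite -[inner (g k) _]opprK -innerNl -e coef_dmul addrK mulrN opprK.
  by rewrite mulrA rho_sqr// mul1r.
- move=> g h; split; apply/ffunP => k; have [Pg gE] := h k.
    by rewrite projPE flipJE proj_flip Pg subr0.
  rewrite mulM_diagt flipJE ffunNE flipJE flipK.
  apply: coefs_inj => m; rewrite {1}gE dmulN coef_dmul !innerNl coef_dmul opprK.
  by rewrite subrK mulrN mulrA rho_sqr// mul1r.
- by move=> g _; rewrite flipJK.
- by move=> g _; rewrite flipJK.
rewrite big_mkcond /=.
apply: (has_dim_ffun (K := fun k => fixQ (- rho k) (- kappa k))) => k.
  split; first exact: proj0.
  by apply: coefs_inj => m; rewrite coef_dmul coef_flip !inner0l mulr0.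
have r1 : - rho k = 1 \/ - rho k = -1 by case: (rho1 k) => ->; [right|left].
have := @fixQ_dim R _ (- kappa k) r1; rewrite oppr_lt0.
by rewrite Theta_opp ?opprK.
Qed.

End DiagonalFixedPoints.

(** * Factorizations *)

Section MatrixFactors.
Variables (R : realType) (N : nat).
Local Notation C := R[i].
Local Notation T := (circle R).
Implicit Types (A B : T -> 'M[C]_(N + N)) (f : L2v R N).

Lemma L2_flip_model : flip_model (@projP R (N + N)) (@flipJ R (N + N)) (@Sw R N)
  (@Vop R N) (@Vst R N).
Proof.
split; [exact: projP_linear|exact: flipJ_linear|exact: Sw_linear|exact: Vop_linear
  |exact: Vst_linear|exact: projPK|exact: flipJK|exact: projP_flipJ|exact: flipJ_Sw
  |exact: projP_Sw|exact: VopVst|exact: SwVop|exact: Vst_flipSw|exact: VstVop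
  |exact: Vst_proj_Vop].
Qed.

Record W_factors B Bi (rho kappa : 'I_(N + N) -> int) : Prop := WFactors {
  wf_bmx : bmx B; wf_bmxi : bmx Bi;
  wf_BBi : forall t, B t *m Bi t = 1%:M; wf_BiB : forall t, Bi t *m B t = 1%:M;
  wf_rho : forall k, rho k = 1 \/ rho k = -1;
  wf_rel : forall t, B t *m Wmx R N *m tilde Bi t = diagt rho kappa t
}.

Lemma W_flip_factors B Bi rho kappa : W_factors B Bi rho kappa ->
  flip_factors (@projP R (N + N)) (@flipJ R (N + N)) (@Sw R N) (mulM B) (mulM Bi)
    (mulM (diagt rho kappa)) (mulM (diagt rho (fun k => - kappa k))).
Proof.
move=> [bB bBi BBi BiB r1 rel].
have bD := @bmx_diagt R _ rho kappa.
have bDi := @bmx_diagt R _ rho (fun k => - kappa k).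
split.
- exact: mulM_linear.
- exact: mulM_linear.
- exact: mulM_linear.
- exact: mulM_linear.
- by move=> g; exact: mulMK.
- by move=> g; exact: mulMK.
- by move=> g; apply: mulMK => // t; exact: diagt_mulN.
- by move=> g; apply: mulMK => // t; exact: diagt_Nmul.
- move=> g; rewrite (flipJ_mulM (flipJ g) bD) flipJK.
  have -> // : tilde (diagt rho kappa) = @diagt R _ rho (fun k => - kappa k).
  by apply/funext => t; exact: tilde_diagt.
- move=> g; have bti := bmx_tilde bBi; have bW := @bmx_W R N.
  rewrite flipJ_mulM// /Sw (mulM_comp _ bW bti).
  rewrite mulM_comp//; last exact: bmxM.
  by congr mulM; apply/funext => t; rewrite mulmxA rel.
- exact: proj_diagt_coproj.
- exact: coproj_diagt_proj.
Qed.

Lemma ker_Phi_dim B Bi rho kappa : W_factors B Bi rho kappa ->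
  has_dim (ker (Phi B)) (- \sum_(k | kappa k < 0) Theta (rho k) (kappa k)).
Proof.
move=> w; have FF := W_flip_factors w; have M := L2_flip_model.
apply: (has_dim_iso (phi := fun f => mulM B (Vop f))
  (psi := fun g => 2^-1 *: Vst (mulM Bi g)) _ _ _ _ _ _ (fixQ_diagt_dim R (wf_rho w) kappa)).
- by move=> a f g /=; rewrite Vop_linear (mulM_linear (wf_bmx w)).
- move=> a f g /=; rewrite (mulM_linear (wf_bmxi w)) Vst_linear.
  by rewrite scalerDr !scalerA mulrC.
- move=> f; rewrite /ker /= PhiE => f0.
  by have := kernel_Phi M FF f0.
- move=> g [Pg gE]; rewrite /ker /= PhiE.
  by have [] := Phi_kernel M FF Pg gE.
- by move=> f _; have := Phi_kernelK M FF f.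
- by move=> g [Pg gE]; have [] := Phi_kernel M FF Pg gE.
Qed.

Lemma ker_Psi_dim B Bi rho kappa : W_factors B Bi rho kappa ->
  has_dim (ker (Psi Bi)) (\sum_(k | 0 < kappa k) Theta (rho k) (kappa k)).
Proof.
move=> w; have FF := W_flip_factors w; have M := L2_flip_model.
apply: (has_dim_iso (phi := fun f => projP (Vop f))
  (psi := @Vst R N) _ _ _ _ _ _ (fixP_diagt_dim R (wf_rho w) kappa)).
- by move=> a f g /=; rewrite Vop_linear projP_linear.
- exact: Vst_linear.
- move=> f; rewrite /ker /= PsiE => f0.
  by have := kernel_Psi M FF f0.
- move=> g [Pg gE]; rewrite /ker /= PsiE.
  by have [] := Psi_kernel M FF Pg gE.
- by move=> f _; exact: Vst_proj_Vop.
- by move=> g [Pg gE]; have [] := Psi_kernel M FF Pg gE.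
Qed.

Section Pseudoinverse.
Variables (B Bi : T -> 'M[C]_(N + N)) (rho kappa : 'I_(N + N) -> int).
Hypothesis w : W_factors B Bi rho kappa.
Local Notation S1 := (id_minus_half (opH (fun t => diagt rho kappa t *m Wmx R N))).

Lemma Sop_expand f : S1 f =
  f - 2^-1 *: Vst (projP (mulM (diagt rho kappa) (Sw (Vop f - projP (Vop f))))).
Proof.
rewrite /id_minus_half opHE; congr (_ - _ *: Vst (projP _)).
by rewrite /Sw mulM_comp//; [exact: bmx_diagt|exact: bmx_W].
Qed.

Lemma Phi_S1_Psi f : Phi B (Psi Bi (S1 (Phi B f))) = Phi B f.
Proof.
rewrite Sop_expand [LHS]PhiE (PsiE Bi) (PhiE B f).
exact: (Phi_pseudoinverse L2_flip_model (W_flip_factors w) f).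
Qed.

Lemma Psi_Phi_S1 f : Psi Bi (S1 (Phi B (Psi Bi f))) = Psi Bi f.
Proof.
rewrite Sop_expand [LHS]PsiE (PhiE B) (PsiE Bi f).
exact: (Psi_pseudoinverse L2_flip_model (W_flip_factors w) f).
Qed.

End Pseudoinverse.
End MatrixFactors.

Section Adjoints.
Variable R : realType.
Local Notation C := R[i].
Local Notation T := (circle R).

Lemma adjmxM n (A B : T -> 'M[C]_n) t :
  adjmx A t *m adjmx B t = adjmx (fun s => B s *m A s) t.
Proof. by rewrite /adjmx -trmx_mul map_mxM. Qed.

Lemma adjmx1 n t : adjmx (fun=> 1%:M : 'M[C]_n) t = 1%:M.
Proof. by rewrite /adjmx map_mx1 trmx1. Qed.

Lemma adjmxW N t : adjmx (fun=> Wmx R N) t = Wmx R N.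
Proof.
rewrite /adjmx /Wmx map_block_mx tr_block_mx !map_mx1 !map_mx0.
by rewrite !trmx1 !trmx0.
Qed.

Lemma WmxK N : Wmx R N *m Wmx R N = 1%:M.
Proof.
rewrite /Wmx mulmx_block !mulmx0 !mul0mx !mulmx1 !add0r !addr0.
by rewrite -scalar_mx_block.
Qed.

Lemma anal_adj n (A : T -> 'M[C]_n) : bmx A -> anti_mx A -> anal_mx (adjmx A).
Proof.
move=> bA aA i j k k0; under eq_fun do rewrite !mxE.
rewrite fourier_conj; last exact: bA.
by rewrite aA ?oppr_gt0// conjc0.
Qed.

Lemma anti_adj n (A : T -> 'M[C]_n) : bmx A -> anal_mx A -> anti_mx (adjmx A).
Proof.
move=> bA aA i j k k0; under eq_fun do rewrite !mxE.
rewrite fourier_conj; last exact: bA.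
by rewrite aA ?oppr_lt0// conjc0.
Qed.

(** Inverting t in the relation gives [tilde B W Bi = D^-1]; its adjoint is the same relation for
    the adjoint matrices, with D unchanged since D is unitary on the circle. *)
Lemma W_factors_adj N (B Bi : T -> 'M[C]_(N + N)) rho kappa :
  W_factors B Bi rho kappa -> W_factors (adjmx Bi) (adjmx B) rho kappa.
Proof.
move=> [bB bBi BBi BiB r1 rel]; split => //; try exact: bmx_adj.
- move=> t; rewrite adjmxM -[RHS](adjmx1 _ t); congr (adjmx _ t).
  by apply/funext => s; exact: BBi.
- move=> t; rewrite adjmxM -[RHS](adjmx1 _ t); congr (adjmx _ t).
  by apply/funext => s; exact: BiB.
move=> t; have -> : tilde (adjmx B) t = adjmx (tilde B) t by [].
rewrite -{1}(adjmxW N t) !adjmxM.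
have -> : (fun s => tilde B s *m (Wmx R N *m Bi s)) = diagt rho (fun k => - kappa k).
  apply/funext => s; rewrite mulmxA -tilde_diagt /tilde -rel /tilde.
  by rewrite ptinvK.
rewrite adj_diagt; congr diagt; apply/funext => k; exact: opprK.
Qed.

End Adjoints.

Lemma has_dim_ext (R : realType) (V : lmodType R[i]) (K K' : set V) d :
  (forall v, K v <-> K' v) -> has_dim K d -> has_dim K' d.
Proof. by move=> e; rewrite (_ : K = K')//; apply/seteqP; split => v /e. Qed.

(** * Splitting off invertible Toeplitz-type factors *)

Section ToeplitzFactors.
Variables (R : realType) (N : nat).
Local Notation C := R[i].
Local Notation T := (circle R).
Implicit Types (A B : T -> 'M[C]_(N + N)) (f : L2v R N).

Lemma projP_anti_proj A (g : L2v R (N + N)) : bmx A -> anti_mx A ->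
  projP (mulM A (projP g)) = projP (mulM A g).
Proof.
move=> bA aA; apply/esym/eqP; rewrite -subr_eq0.
rewrite -(linearB' (@projP_linear R _)) -(linearB' (mulM_linear bA)).
apply/eqP; apply: projP_anti => //.
by rewrite (linearB' (@projP_linear R _)) projPK subrr.
Qed.

Lemma opT_Phi A B f : bmx A -> bmx B -> anti_mx A ->
  opT A (Phi B f) = Phi (fun t => A t *m B t) f.
Proof.
move=> bA bB aA; rewrite opTE !PhiE -(mulM_comp _ bA bB).
have h g := projP_anti_proj g bA aA.
by have := T_Phi (L2_flip_model R N) (a := mulM A) (mulM B) f h.
Qed.

Lemma Psi_opT A B f : bmx A -> bmx B -> anal_mx B ->
  Psi A (opT B f) = Psi (fun t => A t *m B t) f.
Proof.
move=> bA bB aB; rewrite opTE !PsiE -(mulM_comp _ bA bB).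
have h g := projP_anal bB aB (projPK g).
by have := Psi_T (L2_flip_model R N) (mulM A) (b := mulM B) f h.
Qed.

Lemma opT_antiK A A' f : bmx A -> bmx A' -> (forall t, A t *m A' t = 1%:M) ->
  anti_mx A -> opT A (opT A' f) = f.
Proof.
move=> bA bA' AA' aA; rewrite !opTE.
have h g : projP (mulM A (projP (mulM A' (projP g)))) = projP g.
  by rewrite (projP_anti_proj _ bA aA) (mulMK _ bA bA' AA') projPK.
by have := T_T (L2_flip_model R N) (a := mulM A) (b := mulM A') f h.
Qed.

Lemma opT_analK A A' f : bmx A -> bmx A' -> (forall t, A t *m A' t = 1%:M) ->
  anal_mx A' -> opT A (opT A' f) = f.
Proof.
move=> bA bA' AA' aA'; rewrite !opTE.
have h g : projP (mulM A (projP (mulM A' (projP g)))) = projP g.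
  rewrite [X in mulM A X](projP_anal bA' aA' (projPK g)).
  rewrite (mulMK (projP g) bA bA' AA').
  exact: projPK.
by have := T_T (L2_flip_model R N) (a := mulM A) (b := mulM A') f h.
Qed.

Lemma ker_Phi_anti A Ai B C0 d : bmx A -> bmx Ai -> bmx B ->
  (forall t, Ai t *m A t = 1%:M) -> anti_mx A -> anti_mx Ai ->
  (forall t, A t *m B t = C0 t) ->
  has_dim (ker (Phi B)) d -> has_dim (ker (Phi C0)) d.
Proof.
move=> bA bAi bB AiA aA aAi /funext <-.
apply: has_dim_ext => f; rewrite /ker /=; split; rewrite -(opT_Phi f bA bB aA) => f0.
  by rewrite f0 (linear0' (proj1 (bop_opT bA))).
by rewrite -(opT_antiK (Phi B f) bAi bA AiA aAi) f0 (linear0' (proj1 (bop_opT bAi))).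
Qed.

(** The invertible factor [opT A] stands on the right, so the kernel is transported by it; in
    [ker_Phi_anti] it stands on the left and the kernel stays the same. *)
Lemma ker_Psi_anal A Ai B C0 d : bmx A -> bmx Ai -> bmx B ->
  (forall t, Ai t *m A t = 1%:M) -> (forall t, A t *m Ai t = 1%:M) ->
  anal_mx A -> anal_mx Ai ->
  (forall t, B t *m A t = C0 t) ->
  has_dim (ker (Psi B)) d -> has_dim (ker (Psi C0)) d.
Proof.
move=> bA bAi bB AiA AAi aA aAi /funext <-.
apply: (has_dim_iso (proj1 (bop_opT bA)) (proj1 (bop_opT bAi))).
- move=> f; rewrite /ker /= => f0.
  by rewrite (Psi_opT f bB bA aA).
- move=> f; rewrite /ker /= -(Psi_opT _ bB bA aA) => f0.
  by rewrite (opT_analK f bA bAi AAi aAi).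
- by move=> f _; rewrite (opT_analK f bAi bA AiA aA).
- by move=> f _; rewrite (opT_analK f bA bAi AAi aAi).
Qed.

End ToeplitzFactors.

(** * The operators attached to the given factorizations *)

Section Factorizations.
Variables (R : realType) (N : nat).
Local Notation C := R[i].
Local Notation T := (circle R).
Variables (A Ai : T -> 'M[C]_(N + N)) (rho kappa : 'I_(N + N) -> int).
Hypotheses (bA : bmx A) (bAi : bmx Ai).
Hypotheses (AAi : forall t, A t *m Ai t = 1%:M) (AiA : forall t, Ai t *m A t = 1%:M).
Hypothesis rho1 : forall k, rho k = 1 \/ rho k = -1.

Section AntiAnalytic.
Variables (Am Ami : T -> 'M[C]_(N + N)).
Hypotheses (bAm : bmx Am) (bAmi : bmx Ami).
Hypotheses (AmAmi : forall t, Am t *m Ami t = 1%:M)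
  (AmiAm : forall t, Ami t *m Am t = 1%:M).
Hypotheses (aAm : anti_mx Am) (aAmi : anti_mx Ami).
Hypothesis fact : forall t, A t *m Wmx R N *m tilde Ai t =
  Am t *m diagt rho kappa t *m tilde Ami t.

Let B t := Ami t *m A t.
Let Bi t := Ai t *m Am t.

Let w : W_factors B Bi rho kappa.
Proof.
split => //; try exact: bmxM.
- by move=> t; rewrite /B /Bi mulmxA -(mulmxA _ (A t)) AAi mulmx1.
- by move=> t; rewrite /B /Bi mulmxA -(mulmxA _ (Am t)) AmAmi mulmx1.
move=> t; have -> : tilde Bi t = tilde Ai t *m tilde Am t by [].
have -> : B t *m Wmx R N *m (tilde Ai t *m tilde Am t) =
    Ami t *m (A t *m Wmx R N *m tilde Ai t) *m tilde Am t by rewrite /B !mulmxA.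
rewrite fact !mulmxA AmiAm mul1mx.
have e : tilde Ami t *m tilde Am t = 1%:M by exact: AmiAm.
by rewrite -mulmxA e mulmx1.
Qed.

Let AmB t : Am t *m B t = A t.
Proof. by rewrite /B mulmxA AmAmi mul1mx. Qed.

Let PhiA f : Phi A f = opT Am (Phi B f).
Proof.
rewrite (opT_Phi f bAm (wf_bmx w) aAm); congr (Phi _ f).
by apply/funext => t; rewrite AmB.
Qed.

Let opT_Phi_A f : opT Ami (Phi A f) = Phi B f.
Proof. by rewrite PhiA (opT_antiK _ bAmi bAm AmiAm aAmi). Qed.

Lemma minus_dim_ker : has_dim (ker (Phi A))
  (- \sum_(k | kappa k < 0) Theta (rho k) (kappa k)).
Proof.
exact: ker_Phi_anti bAm bAmi (wf_bmx w) AmiAm aAm aAmi AmB (ker_Phi_dim w).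
Qed.

(** The adjoint of A is that of B times that of [Am]; the latter is analytic and splits off on the
    right, and [W_factors_adj] keeps D. *)
Lemma minus_dim_coker : has_dim (ker (adjoint (Phi A)))
  (\sum_(k | 0 < kappa k) Theta (rho k) (kappa k)).
Proof.
have E t : adjmx Am t *m adjmx Ami t = 1%:M.
  by rewrite adjmxM -[RHS](adjmx1 _ t); congr (adjmx _ t); apply/funext => s; rewrite ?AmAmi ?AmiAm.
have E' t : adjmx Ami t *m adjmx Am t = 1%:M.
  by rewrite adjmxM -[RHS](adjmx1 _ t); congr (adjmx _ t); apply/funext => s; rewrite ?AmAmi ?AmiAm.
have F t : adjmx B t *m adjmx Am t = adjmx A t.
  by rewrite adjmxM; congr (adjmx _ t); apply/funext => s; exact: AmB.
rewrite (adjoint_Phi bA); apply: (ker_Psi_anal _ _ _ E' E _ _ F).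
- exact: bmx_adj.
- exact: bmx_adj.
- exact: bmx_adj (wf_bmx w).
- exact: anal_adj.
- exact: anal_adj.
exact: ker_Psi_dim (W_factors_adj w).
Qed.

Local Notation S1 := (id_minus_half (opH (fun t => diagt rho kappa t *m Wmx R N))).

Lemma minus_pseudoinverse : pseudoinverse (Phi A) (Psi Bi \o S1 \o opT Ami).
Proof.
have bS := bop_id_minus_half (bop_opH (bmxM (bmx_diagt R rho kappa) (@bmx_W R N))).
split.
- exact/bop_bounded/bop_Phi.
- apply: bop_bounded; apply: bop_comp; last exact: bop_opT.
  by apply: bop_comp => //; exact: bop_Psi (wf_bmxi w).
- have E f : Phi A (Psi Bi (S1 (opT Ami (Phi A f)))) = Phi A f.
    rewrite (opT_Phi_A f) [LHS]PhiA (Phi_S1_Psi w f).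
    exact (esym (PhiA f)).
  exact E.
- have E h : Psi Bi (S1 (opT Ami (Phi A (Psi Bi h)))) = Psi Bi h.
    by rewrite (opT_Phi_A (Psi Bi h)); exact (Psi_Phi_S1 w h).
  exact (fun f => E (S1 (opT Ami f))).
Qed.

End AntiAnalytic.

Section Analytic.
Variables (Ap Api : T -> 'M[C]_(N + N)).
Hypotheses (bAp : bmx Ap) (bApi : bmx Api).
Hypotheses (ApApi : forall t, Ap t *m Api t = 1%:M)
  (ApiAp : forall t, Api t *m Ap t = 1%:M).
Hypotheses (aAp : anal_mx Ap) (aApi : anal_mx Api).
Hypothesis fact : forall t, tilde Ai t *m Wmx R N *m A t =
  tilde Api t *m diagt rho kappa t *m Ap t.

Let B t := Ap t *m Ai t.
Let Bi t := A t *m Api t.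
Let kappaN k := - kappa k.

(** Here the diagonal factor is [D^-1]; inversion leaves rho unchanged because its values are
    signs. *)
Let w : W_factors B Bi rho kappaN.
Proof.
split => //; try exact: bmxM.
- by move=> t; rewrite /B /Bi mulmxA -(mulmxA _ (Ai t)) AiA mulmx1.
- by move=> t; rewrite /B /Bi mulmxA -(mulmxA _ (Api t)) ApiAp mulmx1.
move=> t; set X := LHS.
(* It is enough that X is a left inverse of D: writing D through the factorization makes all factors
   cancel in pairs. *)
have XD : X *m diagt rho kappa t = 1%:M.
  have -> : diagt rho kappa t =
      tilde Ap t *m (tilde Api t *m diagt rho kappa t *m Ap t) *m Api t.
    have e : tilde Ap t *m tilde Api t = 1%:M by exact: ApApi.
    by rewrite !mulmxA e mul1mx -mulmxA ApApi mulmx1.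
  rewrite -fact /X (_ : tilde Bi t = tilde A t *m tilde Api t)//.
  have e1 : tilde Api t *m tilde Ap t = 1%:M by exact: ApiAp.
  have e2 : tilde A t *m tilde Ai t = 1%:M by exact: AAi.
  rewrite !mulmxA -(mulmxA _ (tilde Api t)) e1 mulmx1.
  rewrite -[X in X *m Wmx R N]mulmxA e2 mulmx1.
  rewrite -[X in X *m A t]mulmxA WmxK mulmx1.
  by rewrite /B -(mulmxA _ (Ai t)) AiA mulmx1 ApApi.
by rewrite -[X]mulmx1 -(diagt_mulN rho1 kappa t) mulmxA XD mul1mx.
Qed.

Let BiAp t : Bi t *m Ap t = A t.
Proof. by rewrite /Bi -mulmxA ApiAp mulmx1. Qed.

Let PsiA f : Psi A f = Psi Bi (opT Ap f).
Proof.
rewrite (Psi_opT f (wf_bmxi w) bAp aAp); congr (Psi _ f).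
by apply/funext => t; rewrite BiAp.
Qed.

Let Psi_A_opT f : Psi A (opT Api f) = Psi Bi f.
Proof. by rewrite PsiA (opT_analK _ bAp bApi ApApi aApi). Qed.

(** Negative kappa are positive for [D^-1], so the count for [Psi Bi] applies, and [Theta_opp] moves
    the sign from kappa to rho. *)
Lemma plus_dim_ker : has_dim (ker (Psi A))
  (- \sum_(k | kappa k < 0) Theta (- rho k) (kappa k)).
Proof.
rewrite -sumrN (eq_bigl (fun k => 0 < kappaN k)); last first.
  by move=> k; rewrite /kappaN oppr_gt0.
rewrite (eq_bigr (fun k => Theta (rho k) (kappaN k))); last first.
  move=> k _; rewrite -Theta_opp ?opprK//.
  by case: (rho1 k) => ->; [right|left; rewrite opprK].
exact: ker_Psi_anal bAp bApi (wf_bmxi w) ApiAp ApApi aAp aApi BiAp (ker_Psi_dim w).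
Qed.

Lemma plus_dim_coker : has_dim (ker (adjoint (Psi A)))
  (\sum_(k | 0 < kappa k) Theta (- rho k) (kappa k)).
Proof.
have -> : \sum_(k | 0 < kappa k) Theta (- rho k) (kappa k) =
    - \sum_(k | kappaN k < 0) Theta (rho k) (kappaN k).
  rewrite -sumrN; apply: eq_big => k; first by rewrite /kappaN oppr_lt0.
  by move=> _; rewrite -Theta_opp ?opprK.
have E t : adjmx Api t *m adjmx Ap t = 1%:M.
  by rewrite adjmxM -[RHS](adjmx1 _ t); congr (adjmx _ t); apply/funext => s; rewrite ApApi.
have F t : adjmx Ap t *m adjmx Bi t = adjmx A t.
  by rewrite adjmxM; congr (adjmx _ t); apply/funext => s; exact: BiAp.
rewrite (adjoint_Psi bA); apply: (ker_Phi_anti _ _ _ E _ _ F).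
- exact: bmx_adj.
- exact: bmx_adj.
- exact: bmx_adj (wf_bmxi w).
- exact: anti_adj.
- exact: anti_adj.
exact: ker_Phi_dim (W_factors_adj w).
Qed.

Local Notation S1 := (id_minus_half (opH (fun t => diagt rho kappaN t *m Wmx R N))).

Lemma plus_pseudoinverse : pseudoinverse (Psi A) (opT Api \o S1 \o Phi B).
Proof.
have bS := bop_id_minus_half (bop_opH (bmxM (bmx_diagt R rho kappaN) (@bmx_W R N))).
split.
- exact/bop_bounded/bop_Psi.
- apply: bop_bounded; apply: bop_comp; last exact: bop_Phi (wf_bmx w).
  by apply: bop_comp => //; exact: bop_opT.
- have E f : Psi A (opT Api (S1 (Phi B (Psi A f)))) = Psi A f.
    rewrite (PsiA f) Psi_A_opT.
    exact (Psi_Phi_S1 w (opT Ap f)).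
  exact E.
- have E f : opT Api (S1 (Phi B (Psi A (opT Api (S1 (Phi B f)))))) =
      opT Api (S1 (Phi B f)).
    rewrite (Psi_A_opT (S1 (Phi B f))).
    by rewrite (Phi_S1_Psi w f).
  exact E.
Qed.

End Analytic.
End Factorizations.

(** Inverses are unique, so the pointwise inverse is the one whose entries lie in S. *)
Lemma GLmx_minv (R : realType) n (S : set (circle R -> R[i])) (A : circle R -> 'M[R[i]]_n) :
  GLmx S A -> [/\ forall i j, S (fun t => A t i j), forall i j, S (fun t => minv A t i j),
    forall t, A t *m minv A t = 1%:M & forall t, minv A t *m A t = 1%:M].
Proof.
move=> [SA [A' SA' AA']].
have u t : A t \in unitmx by case: (AA' t) => /mulmx1_unit[].
have e : minv A = A'.
  apply/funext => t; rewrite /minv -[LHS]mulmx1 -(proj1 (AA' t)) mulmxA.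
  by rewrite mulVmx// mul1mx.
by split => // [i j|t|t]; rewrite ?e//; case: (AA' t).
Qed.

Lemma bmx_standing (R : realType) (B : set (circle R -> R[i])) nB n
    (A : circle R -> 'M[R[i]]_n) : standing_assumptions B nB ->
  (forall i j, B (fun t => A t i j)) -> bmx A.
Proof. by move=> hB BA i j; exact/bmeas_continuous/(sa_continuous hB)/BA. Qed.

Theorem theorem5p4 (R : realType) (N : nat) (hN : (0 < N)%N)
    (B : set (circle R -> R[i])) (nB : (circle R -> R[i]) -> R)
    (hB : standing_assumptions B nB)
    (A : circle R -> 'M[R[i]]_(N + N)) (hA : GLmx B A) :
  (forall (Am : circle R -> 'M[R[i]]_(N + N)) (rho kappa : 'I_(N + N) -> int),
     antisym_fact_minus B (fun t => A t *m Wmx R N *m minv (tilde A) t)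
       Am rho kappa ->
     [/\ has_dim (ker (Phi A)) (- \sum_(k | kappa k < 0) Theta (rho k) (kappa k)),
         has_dim (ker (adjoint (Phi A)))
           (\sum_(k | 0 < kappa k) Theta (rho k) (kappa k)) &
         pseudoinverse (Phi A)
           (Psi (fun t => minv A t *m Am t)
            \o id_minus_half (opH (fun t => diagt rho kappa t *m Wmx R N))
            \o opT (minv Am))]) /\
  (forall (Ap : circle R -> 'M[R[i]]_(N + N)) (rho kappa : 'I_(N + N) -> int),
     antisym_fact_plus B (fun t => minv (tilde A) t *m Wmx R N *m A t)
       Ap rho kappa ->
     [/\ has_dim (ker (Psi A))
           (- \sum_(k | kappa k < 0) Theta (- rho k) (kappa k)),
         has_dim (ker (adjoint (Psi A)))
           (\sum_(k | 0 < kappa k) Theta (- rho k) (kappa k)) &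
         pseudoinverse (Psi A)
           (opT (minv Ap)
            \o id_minus_half
                 (opH (fun t => minv (diagt rho kappa) t *m Wmx R N))
            \o Phi (fun t => Ap t *m minv A t))]).
Proof.
have [BA BAi AAi AiA] := GLmx_minv hA.
have bA := bmx_standing hB BA; have bAi := bmx_standing hB BAi.
split=> [Am rho kappa [GA rho1 fact]|Ap rho kappa [GA rho1 fact]].
- have [BF BFi FFi FiF] := GLmx_minv GA.
  have bF := bmx_standing hB (fun i j => proj1 (BF i j)).
  have bFi := bmx_standing hB (fun i j => proj1 (BFi i j)).
  have aF : anti_mx Am by move=> i j; exact: (proj2 (proj2 (proj2 (BF i j)))).
  have aFi : anti_mx (minv Am) by move=> i j; exact: (proj2 (proj2 (proj2 (BFi i j)))).
  split.
  + exact: (minus_dim_ker bA bAi AAi AiA rho1 bF bFi FFi FiF aF aFi fact).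
  + exact: (minus_dim_coker bA bAi AAi AiA rho1 bF bFi FFi FiF aF aFi fact).
  + exact: (minus_pseudoinverse bA bAi AAi AiA rho1 bF bFi FFi FiF aF aFi fact).
- have [BF BFi FFi FiF] := GLmx_minv GA.
  have bF := bmx_standing hB (fun i j => proj1 (BF i j)).
  have bFi := bmx_standing hB (fun i j => proj1 (BFi i j)).
  have aF : anal_mx Ap by move=> i j; exact: (proj2 (proj2 (proj2 (BF i j)))).
  have aFi : anal_mx (minv Ap) by move=> i j; exact: (proj2 (proj2 (proj2 (BFi i j)))).
  (* [D^-1] is put in the diagonal form with exponents -kappa used by [plus_pseudoinverse]. *)
  have -> : (fun t => minv (diagt rho kappa) t *m Wmx R N) =
      (fun t => diagt rho (fun k => - kappa k) t *m Wmx R N).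
    by apply/funext => t; rewrite minv_diagt.
  split.
  + exact: (plus_dim_ker bA bAi AAi AiA rho1 bF bFi FFi FiF aF aFi fact).
  + exact: (plus_dim_coker bA bAi AAi AiA rho1 bF bFi FFi FiF aF aFi fact).
  + exact: (plus_pseudoinverse bA bAi AAi AiA rho1 bF bFi FFi FiF aF aFi fact).
Qed.
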